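(* Let $A$ be a unital bornological algebra and let $\mathfrak T\subseteq\mathrm{Der}(A)$ be a triangulated subcategory. Then $\mathfrak T=\mathrm{Der}(A)$ provided either $\mathfrak T$ contains all free modules and is closed under direct sums, or $\mathfrak T$ contains all cofree modules and is closed under direct products.
   Context: All bornological vector spaces are complete and convex over $\mathbb C$ (every bounded subset is contained in a bounded absolutely convex $T$ whose span is a Banach space with closed unit ball $T$). $\mathrm{Mod}(A)$ is the category of bornological left $A$-modules (unital modules with a bounded bilinear action) and bounded $A$-module homomorphisms. Free modules are those of the form $A\hat\otimes V$, cofree modules those of the form $\mathrm{Hom}(A,V)$ with $(a f)(x)=f(xa)$, for bornological vector spaces $V$; here $\hat\otimes$ is the complete bornological tensor product (universal for bounded bilinear maps) and $\mathrm{Hom}$ is the space of bounded linear maps with the equibounded bornology. $\mathrm{Ho}(A)$ is the homotopy category of (unbounded) chain complexes over $\mathrm{Mod}(A)$ (bounded $A$-linear chain maps and homotopies), a triangulated category with direct sums and products formed degreewise. A complex is exact if it has a bounded linear (not necessarily $A$-linear) contracting homotopy. $\mathrm{Der}(A)$ is the localisation of $\mathrm{Ho}(A)$ at the exact complexes; modules are viewed as complexes concentrated in degree $0$. A triangulated subcategory is a full subcategory closed under isomorphism, under $\Sigma^{\pm1}$, and such that if two objects of an exact triangle belong to it so does the third. *)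

(* Defs.v *)
From mathcomp Require Import all_boot all_order all_algebra.
From mathcomp Require Import complex.
From mathcomp Require Import boolp classical_sets reals.

Set Implicit Arguments.
Unset Strict Implicit.
Unset Printing Implicit Defensive.

Import Order.TTheory GRing.Theory Num.Theory.
Import Normc.

#[local] Obligation Tactic := idtac.
Local Open Scope classical_set_scope.
Local Open Scope ring_scope.

Section BanachDisk.
Context {R : realType} {V : lmodType R[i]}.

Definition subspace (U : set V) : Prop :=
  U 0 /\ forall (c : R[i]) (x y : V), U x -> U y -> U (c *: x + y).

Definition lspan (T : set V) : set V :=
  [set x | forall U : set V, subspace U -> T `<=` U -> U x].

Definition absolutely_convex (T : set V) : Prop :=
  forall (a b : R[i]) (x y : V),
    T x -> T y -> normc a + normc b <= 1 -> T (a *: x + b *: y).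

Definition norm_on (U : set V) (N : V -> R) : Prop :=
  [/\ forall x y, U x -> U y -> N (x + y) <= N x + N y,
      forall c x, U x -> N (c *: x) = normc c * N x
    & forall x, U x -> N x = 0 -> x = 0].

Definition complete_on (U : set V) (N : V -> R) : Prop :=
  forall u : nat -> V, (forall n, U (u n)) ->
  (forall e : R, 0 < e -> exists k : nat, forall m n : nat,
     (k <= m)%N -> (k <= n)%N -> N (u m - u n) < e) ->
  exists2 l, U l & forall e : R, 0 < e -> exists k : nat, forall n : nat,
     (k <= n)%N -> N (u n - l) < e.

(* The span of [T] is a Banach space with closed unit ball [T]; the norm [N] is
   determined on the span, being the gauge of [T]. *)
Definition banach_disk (T : set V) : Prop :=
  absolutely_convex T /\
  exists N : V -> R,
    [/\ norm_on (lspan T) N, complete_on (lspan T) N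
      & T = [set x | lspan T x /\ N x <= 1]].

End BanachDisk.

(* [bdd_banach] expresses convexity and completeness. *)
Record bornSpace (R : realType) := BornSpace {
  born_sort :> lmodType R[i];
  bdd : set (set born_sort);
  bdd_set1 : forall x : born_sort, bdd [set x];
  bdd_sub : forall S T : set born_sort, S `<=` T -> bdd T -> bdd S;
  bdd_setU : forall S T : set born_sort, bdd S -> bdd T -> bdd (S `|` T);
  bdd_add : forall S T : set born_sort, bdd S -> bdd T ->
    bdd [set x + y | x in S & y in T];
  bdd_scale : forall (r : R) (S : set born_sort), bdd S ->
    bdd [set c *: x | c in [set c : R[i] | normc c <= r] & x in S];
  bdd_banach : forall S : set born_sort, bdd S ->
    exists T : set born_sort, [/\ S `<=` T, bdd T & banach_disk T]
}.

Section BoundedMaps.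
Context {R : realType}.
Implicit Types U V W : bornSpace R.

Definition bounded_linear U V (f : U -> V) : Prop :=
  linear f /\ forall S : set U, bdd S -> bdd (f @` S).

Definition bounded_bilinear U V W (b : U -> V -> W) : Prop :=
  [/\ forall v, linear (b^~ v), forall u, linear (b u)
    & forall (S : set U) (T : set V), bdd S -> bdd T ->
        bdd [set b u v | u in S & v in T]].

Definition equibounded U V (F : set (U -> V)) : Prop :=
  forall S : set U, bdd S -> bdd [set f x | f in F & x in S].

(* Completed tensor product: the target [Z] ranges over complete spaces. *)
Definition is_tensor_product U V W (t : U -> V -> W) : Prop :=
  bounded_bilinear t /\
  forall (Z : bornSpace R) (b : U -> V -> Z), bounded_bilinear b ->
    exists! h : W -> Z, bounded_linear h /\ forall u v, h (t u v) = b u v.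

End BoundedMaps.

(* Not built on algType, which would exclude the zero algebra. *)
Record bornAlg (R : realType) := BornAlg {
  alg_space :> bornSpace R;
  amul : alg_space -> alg_space -> alg_space;
  aone : alg_space;
  amul_bounded : bounded_bilinear amul;
  amulA : associative amul;
  amul1l : left_id aone amul;
  amul1r : right_id aone amul
}.

Record bornMod (R : realType) (A : bornAlg R) := BornMod {
  mod_space :> bornSpace R;
  act : A -> mod_space -> mod_space;
  act_bounded : bounded_bilinear act;
  actA : forall a b x, act a (act b x) = act (amul a b) x;
  act1 : forall x, act (aone A) x = x
}.

Record modHom (R : realType) (A : bornAlg R) (M N : bornMod A) := ModHom {
  hom_fun :> M -> N;
  hom_bounded : bounded_linear hom_fun;
  hom_act : forall a x, hom_fun (act a x) = act a (hom_fun x)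
}.

Section FreeCofree.
Context {R : realType} {A : bornAlg R}.

Definition is_free (F : bornMod A) : Prop :=
  exists (V : bornSpace R) (t : A -> V -> F),
    is_tensor_product t /\ forall a b v, act a (t b v) = t (amul a b) v.

(* [phi] is an isomorphism of bornological modules from [F] onto the space of
   bounded linear maps from [A] to [V]. *)
Definition is_cofree (F : bornMod A) : Prop :=
  exists (V : bornSpace R) (phi : F -> (A -> V)),
    [/\ forall c x y, phi (c *: x + y) = (fun a => c *: phi x a + phi y a),
        injective phi,
        range phi = [set f | bounded_linear f],
        forall S : set F, bdd S <-> equibounded (phi @` S)
      & forall a x b, phi (act a x) b = phi x (amul b a)].

Definition is_coproduct (I : Type) (M : I -> bornMod A) (S : bornMod A)
    (inj : forall i, modHom (M i) S) : Prop :=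
  forall (N : bornMod A) (g : forall i, modHom (M i) N),
    exists h : modHom S N, (forall i x, h (inj i x) = g i x) /\
      forall h' : modHom S N, (forall i x, h' (inj i x) = g i x) -> h' =1 h.

Definition is_product (I : Type) (M : I -> bornMod A) (P : bornMod A)
    (proj : forall i, modHom P (M i)) : Prop :=
  forall (N : bornMod A) (g : forall i, modHom N (M i)),
    exists h : modHom N P, (forall i x, proj i (h x) = g i x) /\
      forall h' : modHom N P, (forall i x, proj i (h' x) = g i x) -> h' =1 h.

End FreeCofree.

Section BornFacts.
Context {R : realType}.
Implicit Types U V W : bornSpace R.

Lemma lin0 (U V : lmodType R[i]) (f : U -> V) : linear f -> f 0 = 0.
Proof.
by move=> lf; have := lf (-1) 0 0; rewrite scaler0 addr0 scaleN1r addNr.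
Qed.

Lemma linN (U V : lmodType R[i]) (f : U -> V) : linear f ->
  forall x, f (- x) = - f x.
Proof.
by move=> lf x; have := lf (-1) x 0; rewrite (lin0 lf) !addr0 !scaleN1r.
Qed.

Lemma linD (U V : lmodType R[i]) (f : U -> V) : linear f ->
  forall x y, f (x + y) = f x + f y.
Proof. by move=> lf x y; have := lf 1 x y; rewrite !scale1r. Qed.

Lemma normcN1 : normc (-1 : R[i]) = 1.
Proof. exact: etrans (normcN (1 : Rcomplex R)) (normc1 R). Qed.

Lemma bdd_opp V (S : set V) : bdd S -> bdd (-%R @` S).
Proof.
move=> /(@bdd_scale _ V 1); apply: bdd_sub => _ [x Sx <-].
exists (-1); last by exists x => //; rewrite scaleN1r.
by rewrite /mkset normcN1.
Qed.

Lemma bounded_linear_id V : bounded_linear (fun x : V => x).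
Proof. by split=> // S; rewrite image_id. Qed.

Lemma bounded_linear_comp U V W (g : V -> W) (f : U -> V) :
  bounded_linear g -> bounded_linear f -> bounded_linear (fun x => g (f x)).
Proof.
move=> [lg bg] [lf bf]; split=> [c x y|S bS]; first by rewrite lf lg.
by have := bg _ (bf _ bS); rewrite image_comp.
Qed.

Lemma bounded_linear_cst0 U V : bounded_linear (fun _ : U => 0 : V).
Proof.
split=> [c x y|S _]; first by rewrite scaler0 addr0.
by apply: bdd_sub (bdd_set1 0) => _ [x _ <-].
Qed.

Lemma bounded_linear_opp U V (f : U -> V) :
  bounded_linear f -> bounded_linear (fun x => - f x).
Proof.
move=> [lf bf]; split=> [c x y|S bS]; first by rewrite lf opprD scalerN.
apply: bdd_sub (bdd_opp (bf _ bS)) => _ [x Sx <-].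
by exists (f x) => //; exists x.
Qed.

Lemma bounded_linear_add U V (f g : U -> V) :
  bounded_linear f -> bounded_linear g -> bounded_linear (fun x => f x + g x).
Proof.
move=> [lf bf] [lg bg]; split=> [c x y|S bS].
  by rewrite lf lg scalerDr addrACA.
apply: bdd_sub (bdd_add (bf _ bS) (bg _ bS)) => _ [x Sx <-].
by exists (f x); [exists x|exists (g x) => //; exists x].
Qed.

End BornFacts.

Section ZeroSpace.
Variable R : realType.
Let Z : lmodType R[i] := 'rV[R[i]]_0.

Lemma zero_banach_disk (T : set Z) : T 0 -> banach_disk T.
Proof.
have E (x : Z) : x = 0 by apply/rowP; case.
move=> T0; have HT x : T x by rewrite (E x).
split=> [a b x y _ _ _|]; first exact: HT.
have hT x : lspan T x by move=> U _; apply.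
exists (fun=> 0); split.
- by split=> [x y _ _|c x _|x _ _]; rewrite ?addr0 ?mulr0.
- by move=> u _ _; exists 0 => // e e0; exists 0%N.
- by apply/seteqP; split=> x _ //; split; rewrite ?ler01.
Qed.

Program Definition zeroSpace : bornSpace R :=
  @BornSpace R Z setT _ _ _ _ _ _.
Next Obligation. by []. Qed.
Next Obligation. by []. Qed.
Next Obligation. by []. Qed.
Next Obligation. by []. Qed.
Next Obligation. by []. Qed.
Next Obligation. by exists setT; split=> //; exact: zero_banach_disk. Qed.

Program Definition zeroMod (A : bornAlg R) : bornMod A :=
  @BornMod R A zeroSpace (fun _ x => x) _ _ _.
Next Obligation. by move=> A; split=> // u c x y; apply/rowP; case. Qed.
Next Obligation. by []. Qed.
Next Obligation. by []. Qed.

End ZeroSpace.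

Section ProdSpace.
Context {R : realType}.

Lemma lspan_sub (V : lmodType R[i]) (T : set V) : T `<=` lspan T.
Proof. by move=> x Tx U _; apply. Qed.

Lemma subspace_lspan (V : lmodType R[i]) (T : set V) : subspace (lspan T).
Proof.
split=> [U [] //|c x y hx hy U sU TU].
by apply: (proj2 sU); [exact: hx|exact: hy].
Qed.

Lemma norm_on0 (V : lmodType R[i]) (U : set V) (N : V -> R) :
  subspace U -> norm_on U N -> N 0 = 0.
Proof.
by move=> [U0 _] [_ NZ _]; rewrite -(scale0r 0) NZ // normc0 mul0r.
Qed.

Lemma norm_on_ge0 (V : lmodType R[i]) (U : set V) (N : V -> R) :
  subspace U -> norm_on U N -> forall x, U x -> 0 <= N x.
Proof.
move=> sU nU x Ux; have N0 := norm_on0 sU nU; case: nU => NT NZ _.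
have UNx : U (- x).
  by have := sU.2 (-1) x 0 Ux sU.1; rewrite scaleN1r addr0.
have := NT _ _ Ux UNx; rewrite subrr N0 -scaleN1r NZ // normcN1 mul1r.
by rewrite -mulr2n pmulrn_lge0.
Qed.

Lemma subspaceB (V : lmodType R[i]) (U : set V) : subspace U ->
  forall x y, U x -> U y -> U (x - y).
Proof.
by move=> sU x y Ux Uy; have := sU.2 (-1) y x Uy Ux; rewrite scaleN1r addrC.
Qed.

Lemma prod_banach_disk (V W : lmodType R[i]) (S : set V) (T : set W) :
  banach_disk S -> banach_disk T -> banach_disk (S `*` T).
Proof.
move=> [cS [N [nN kN eS]]] [cT [M [nM kM eT]]].
have sS := subspace_lspan S; have sT := subspace_lspan T.
have N0 := norm_on0 sS nN; have M0 := norm_on0 sT nM.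
have S0 : S 0 by rewrite eS; split; [case: sS|rewrite N0 ler01].
have T0 : T 0 by rewrite eT; split; [case: sT|rewrite M0 ler01].
have eL : lspan (S `*` T) = lspan S `*` lspan T.
  apply/seteqP; split=> [p hp|[x y] [/= hx hy]].
    apply: hp => [|[x y] [/= Sx Ty]].
      split=> [|c [x y] [x' y'] [/= ? ?] [/= ? ?]].
        by split; [case: sS|case: sT].
      by split=> /=; [apply: sS.2|apply: sT.2].
    by split; apply: lspan_sub.
  move=> U sU hU.
  have hx0 : U (x, 0).
    apply: (hx [set x | U (x, 0)]) => [|x' Sx' /=]; last exact: hU.
    split=> [|c a b Ua Ub /=]; first exact: sU.1.
    have := sU.2 c _ _ Ua Ub; congr (U _).
    by congr pair; rewrite /= scaler0 addr0.
  have hy0 : U (0, y).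
    apply: (hy [set y | U (0, y)]) => [|y' Ty' /=]; last exact: hU.
    split=> [|c a b Ua Ub /=]; first exact: sU.1.
    have := sU.2 c _ _ Ua Ub; congr (U _).
    by congr pair; rewrite /= scaler0 addr0.
  have := sU.2 1 _ _ hx0 hy0; congr (U _).
  by rewrite scale1r; congr pair; rewrite /= ?addr0 ?add0r.
split=> [a b [x y] [x' y'] [/= ? ?] [/= ? ?] ab|].
  by split=> /=; [apply: cS|apply: cT].
exists (fun p => Num.max (N p.1) (M p.2)); rewrite eL; split.
- case: (nN) (nM) => NT NZ ND [MT MZ MD]; split.
  + move=> [x y] [x' y'] [/= hx hy] [/= hx' hy'].
    rewrite ge_max; apply/andP; split.
      by apply: le_trans (NT _ _ hx hx') _; rewrite lerD // le_max lexx.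
    by apply: le_trans (MT _ _ hy hy') _; rewrite lerD // le_max lexx orbT.
  + move=> c [x y] [/= hx hy]; rewrite NZ // MZ // maxr_pMr //.
    by case: c => a b; rewrite /normc sqrtr_ge0.
  + move=> [x y] [/= hx hy] e.
    have Nx : N x <= 0 by rewrite -e le_max lexx.
    have My : M y <= 0 by rewrite -e le_max lexx orbT.
    congr pair.
      by apply: ND => //; apply/eqP; rewrite eq_le Nx (norm_on_ge0 sS nN).
    by apply: MD => //; apply/eqP; rewrite eq_le My (norm_on_ge0 sT nM).
- move=> u Uu cu.
  have [x Ux xE] : exists2 l, lspan S l & forall e : R, 0 < e ->
      exists k : nat, forall n : nat, (k <= n)%N -> N ((u n).1 - l) < e.
    apply: kN => [n|e e0]; first by case: (Uu n).
    have [k hk] := cu e e0; exists k => m n km kn.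
    by have := hk m n km kn; rewrite gt_max => /andP[].
  have [y Uy yE] : exists2 l, lspan T l & forall e : R, 0 < e ->
      exists k : nat, forall n : nat, (k <= n)%N -> M ((u n).2 - l) < e.
    apply: kM => [n|e e0]; first by case: (Uu n).
    have [k hk] := cu e e0; exists k => m n km kn.
    by have := hk m n km kn; rewrite gt_max => /andP[].
  exists (x, y) => // e e0; have [k hk] := xE e e0; have [l hl] := yE e e0.
  exists (maxn k l) => n; rewrite geq_max => /andP[kn ln].
  by rewrite gt_max /= hk // hl.
- apply/seteqP; split=> [[x y] [/= Sx Ty]|[x y] [[/= hx hy]]].
    move: Sx Ty; rewrite {1}eS {1}eT => -[hx Nx] [hy My].
    by split=> //; rewrite ge_max Nx My.
  by rewrite ge_max => /andP[Nx My]; split=> /=; [rewrite eS|rewrite eT].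
Qed.

Variables V W : bornSpace R.

Definition prod_bdd (S : set (V * W)%type) : Prop :=
  bdd (fst @` S) /\ bdd (snd @` S).

Program Definition prodSpace : bornSpace R :=
  @BornSpace R (V * W)%type prod_bdd _ _ _ _ _ _.
Next Obligation. by split; rewrite image_set1; apply: bdd_set1. Qed.
Next Obligation.
move=> S T ST [bT1 bT2].
by split; [apply: bdd_sub bT1|apply: bdd_sub bT2]; apply: image_subset.
Qed.
Next Obligation.
by move=> S T [? ?] [? ?]; split; rewrite image_setU; apply: bdd_setU.
Qed.
Next Obligation.
move=> S T [S1 S2] [T1 T2]; split.
  apply: bdd_sub (bdd_add S1 T1) => _ [_ [p Sp [q Tq <-]] <-].
  by exists p.1; [exists p|exists q.1 => //; exists q].
apply: bdd_sub (bdd_add S2 T2) => _ [_ [p Sp [q Tq <-]] <-].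
by exists p.2; [exists p|exists q.2 => //; exists q].
Qed.
Next Obligation.
move=> r S [S1 S2]; split.
  apply: bdd_sub (bdd_scale r S1) => _ [_ [c cr [p Sp <-]] <-].
  by exists c => //; exists p.1 => //; exists p.
apply: bdd_sub (bdd_scale r S2) => _ [_ [c cr [p Sp <-]] <-].
by exists c => //; exists p.2 => //; exists p.
Qed.
Next Obligation.
move=> S [/bdd_banach[T1 [ST1 bT1 dT1]] /bdd_banach[T2 [ST2 bT2 dT2]]].
exists (T1 `*` T2); split; last exact: prod_banach_disk.
  by move=> p Sp; split; [apply: ST1|apply: ST2]; exists p.
split; [apply: bdd_sub bT1|apply: bdd_sub bT2].
  by move=> _ [[x y] [/= ? ?] <-].
by move=> _ [[x y] [/= ? ?] <-].
Qed.

Lemma bounded_linear_fst : bounded_linear (fst : prodSpace -> V).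
Proof. by split=> // S []. Qed.

Lemma bounded_linear_snd : bounded_linear (snd : prodSpace -> W).
Proof. by split=> // S []. Qed.

Lemma bounded_linear_pair (U : bornSpace R) (f : U -> V) (g : U -> W) :
  bounded_linear f -> bounded_linear g ->
  bounded_linear (fun x => (f x, g x) : prodSpace).
Proof.
move=> [lf bf] [lg bg]; split=> [c x y|S bS]; first by rewrite lf lg.
split; [have := bf _ bS|have := bg _ bS]; apply: bdd_sub.
  by move=> _ [_ [x Sx <-] <-]; exists x.
by move=> _ [_ [x Sx <-] <-]; exists x.
Qed.

End ProdSpace.

Program Definition prodMod (R : realType) (A : bornAlg R) (M N : bornMod A) :
    bornMod A :=
  @BornMod R A (prodSpace M N) (fun a p => (act a p.1, act a p.2)) _ _ _.
Next Obligation.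
move=> R A M N.
have [lM1 lM2 bM] := act_bounded M; have [lN1 lN2 bN] := act_bounded N.
split=> [p c a b|a c p q|S T bS [bT1 bT2]] /=.
- by rewrite lM1 lN1.
- by rewrite lM2 lN2.
- split; [have := bM _ _ bS bT1|have := bN _ _ bS bT2]; apply: bdd_sub.
    by move=> _ [_ [a Sa [p Tp <-]] <-]; exists a => //; exists p.1 => //; exists p.
  by move=> _ [_ [a Sa [p Tp <-]] <-]; exists a => //; exists p.2 => //; exists p.
Qed.
Next Obligation. by move=> R A M N a b [x y]; rewrite !actA. Qed.
Next Obligation. by move=> R A M N [x y]; rewrite !act1. Qed.

Section ModHoms.
Context {R : realType} {A : bornAlg R}.
Implicit Types M N P : bornMod A.

Lemma act_opp M (a : A) (x : M) : act a (- x) = - act a x.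
Proof. by case: (act_bounded M) => _ /(_ a) /linN. Qed.

Lemma act0 M (a : A) : act a (0 : M) = 0.
Proof. by case: (act_bounded M) => _ /(_ a) /lin0. Qed.

Lemma act_add M (a : A) (x y : M) : act a (x + y) = act a x + act a y.
Proof. by case: (act_bounded M) => _ /(_ a) /linD. Qed.

Definition idHom M : modHom M M :=
  @ModHom R A M M (fun x => x) (bounded_linear_id M) (fun _ _ => erefl).

Program Definition compHom M N P (g : modHom N P) (f : modHom M N) :
    modHom M P := @ModHom R A M P (fun x => g (f x)) _ _.
Next Obligation.
by move=> *; apply: bounded_linear_comp; apply: hom_bounded.
Qed.
Next Obligation. by move=> *; rewrite /= !hom_act. Qed.

Program Definition zeroHom M N : modHom M N :=
  @ModHom R A M N (fun=> 0) _ _.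
Next Obligation. by move=> M N; apply: bounded_linear_cst0. Qed.
Next Obligation. by move=> *; rewrite /= act0. Qed.

Program Definition oppHom M N (f : modHom M N) : modHom M N :=
  @ModHom R A M N (fun x => - f x) _ _.
Next Obligation. by move=> *; apply/bounded_linear_opp/hom_bounded. Qed.
Next Obligation. by move=> *; rewrite /= hom_act act_opp. Qed.

Lemma hom0 M N (f : modHom M N) : f 0 = 0.
Proof. by apply: lin0; case: (hom_bounded f). Qed.

Lemma homN M N (f : modHom M N) x : f (- x) = - f x.
Proof. by apply: linN; case: (hom_bounded f). Qed.

Lemma homD M N (f : modHom M N) x y : f (x + y) = f x + f y.
Proof. by apply: linD; case: (hom_bounded f). Qed.

End ModHoms.

(* The differential lowers the degree. *)
Record chainComplex (R : realType) (A : bornAlg R) := Complex {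
  cpx_ob :> int -> bornMod A;
  cpx_d : forall n : int, modHom (cpx_ob n) (cpx_ob (n - 1));
  cpx_dd : forall n x, cpx_d (n - 1) (cpx_d n x) = 0
}.

Record chainMap (R : realType) (A : bornAlg R) (X Y : chainComplex A) := ChainMap {
  chain_fun :> forall n : int, modHom (X n) (Y n);
  chain_comm : forall n x, chain_fun (n - 1) (cpx_d X n x) = cpx_d Y n (chain_fun n x)
}.

Section Complexes.
Context {R : realType} {A : bornAlg R}.
Implicit Types X Y Z : chainComplex A.

Definition degree0_ob (M : bornMod A) (n : int) : bornMod A :=
  if n is Posz 0 then M else zeroMod A.

Definition in_degree0 (M : bornMod A) : chainComplex A :=
  @Complex R A (degree0_ob M) (fun n => zeroHom _ _) (fun _ _ => erefl).

Program Definition idMap X : chainMap X X :=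
  @ChainMap R A X X (fun n => idHom (X n)) _.
Next Obligation. by []. Qed.

Program Definition compMap X Y Z (g : chainMap Y Z) (f : chainMap X Y) :
    chainMap X Z := @ChainMap R A X Z (fun n => compHom (g n) (f n)) _.
Next Obligation. by move=> *; rewrite /= !chain_comm. Qed.

(* A homotopy raises the degree by one; it is indexed by the degree of its
   target, so that the degrees n - 1 below run through all integers. *)
Definition homotopic X Y (f g : chainMap X Y) : Prop :=
  exists h : forall n : int, modHom (X (n - 1)) (Y n),
    forall n x, f (n - 1) x - g (n - 1) x =
                cpx_d Y n (h n x) + h (n - 1) (cpx_d X (n - 1) x).

Definition exact X : Prop :=
  exists2 h : forall n : int, X (n - 1) -> X n,
    forall n, bounded_linear (h n)
    & forall n x, x = cpx_d X n (h n x) + h (n - 1) (cpx_d X (n - 1) x).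

Program Definition shift X : chainComplex A :=
  @Complex R A (fun n => X (n - 1)) (fun n => oppHom (cpx_d X (n - 1))) _.
Next Obligation. by move=> *; rewrite /= homN cpx_dd !oppr0. Qed.

Program Definition shiftMap X Y (f : chainMap X Y) :
    chainMap (shift X) (shift Y) :=
  @ChainMap R A (shift X) (shift Y) (fun n => f (n - 1)) _.
Next Obligation. by move=> *; rewrite /= homN chain_comm. Qed.

Program Definition cone_d X Y (f : chainMap X Y) (n : int) :
    modHom (prodMod (Y n) (X (n - 1))) (prodMod (Y (n - 1)) (X (n - 1 - 1))) :=
  @ModHom R A (prodMod (Y n) (X (n - 1))) (prodMod (Y (n - 1)) (X (n - 1 - 1)))
    (fun p => (cpx_d Y n p.1 + f (n - 1) p.2, - cpx_d X (n - 1) p.2)) _ _.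
Next Obligation.
move=> X Y f n; apply: bounded_linear_pair.
  apply: bounded_linear_add.
    exact: bounded_linear_comp (hom_bounded _) (bounded_linear_fst _ _).
  exact: bounded_linear_comp (hom_bounded _) (bounded_linear_snd _ _).
apply: bounded_linear_opp.
exact: bounded_linear_comp (hom_bounded _) (bounded_linear_snd _ _).
Qed.
Next Obligation.
by move=> X Y f n a [x y] /=; rewrite !hom_act act_add act_opp.
Qed.

Program Definition cone X Y (f : chainMap X Y) : chainComplex A :=
  @Complex R A (fun n => prodMod (Y n) (X (n - 1))) (cone_d f) _.
Next Obligation.
move=> X Y f n [y x] /=; rewrite homD !homN !cpx_dd add0r chain_comm subrr.
by rewrite !oppr0.
Qed.

Program Definition cone_in X Y (f : chainMap X Y) : chainMap Y (cone f) :=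
  @ChainMap R A Y (cone f)
    (fun n => @ModHom R A (Y n) (cone f n) (fun y => (y, 0)) _ _) _.
Next Obligation.
move=> X Y f n; apply: bounded_linear_pair; first exact: bounded_linear_id.
exact: bounded_linear_cst0.
Qed.
Next Obligation. by move=> *; rewrite /= act0. Qed.
Next Obligation. by move=> *; rewrite /= !hom0 addr0 oppr0. Qed.

Program Definition cone_out X Y (f : chainMap X Y) :
    chainMap (cone f) (shift X) :=
  @ChainMap R A (cone f) (shift X)
    (fun n => @ModHom R A (cone f n) (shift X n) snd _ _) _.
Next Obligation. by move=> *; apply: bounded_linear_snd. Qed.
Next Obligation. by []. Qed.
Next Obligation. by []. Qed.

Definition quasi_iso X Y (f : chainMap X Y) : Prop := exact (cone f).

Lemma quasi_iso_shift X Y (f : chainMap X Y) :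
  quasi_iso f -> quasi_iso (shiftMap f).
Proof.
move=> [h bh hE].
exists (fun n (p : cone (shiftMap f) (n - 1)) =>
  let q := h (n - 1) ((p.1, - p.2) : cone f (n - 1 - 1)) in (- q.1, q.2)).
  move=> n; apply: bounded_linear_pair.
    apply: bounded_linear_opp.
    apply: (bounded_linear_comp (bounded_linear_fst _ _)).
    apply: (bounded_linear_comp (bh (n - 1))).
    apply: bounded_linear_pair; first exact: bounded_linear_fst.
    by apply: bounded_linear_opp; apply: bounded_linear_snd.
  apply: (bounded_linear_comp (bounded_linear_snd _ _)).
  apply: (bounded_linear_comp (bh (n - 1))).
  apply: bounded_linear_pair; first exact: bounded_linear_fst.
  by apply: bounded_linear_opp; apply: bounded_linear_snd.
move=> n [y x] /=.
have := hE (n - 1) (y, - x); set q := h (n - 1) _ => /=.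
rewrite !homN opprK => E.
set r : cone f (n - 1 - 1 - 1) := (_ - _, _) in E.
set r' := (_, - cpx_d X (n - 1 - 1 - 1) x).
have -> : r' = - r by congr pair; rewrite /= opprD opprK.
rewrite (linN (proj1 (bh _))) /= !opprK.
have /= E1 := congr1 fst E; have /= E2 := congr1 snd E.
by congr pair => /=; [exact: E1|apply: oppr_inj; rewrite opprD opprK].
Qed.

End Complexes.

(* Morphisms of the derived category: formal composites of chain maps and of
   formal inverses of the chain maps with exact cone, up to the congruence
   [der_eq]; this is the localisation of the homotopy category at these maps. *)
Inductive derMap (R : realType) (A : bornAlg R) :
    chainComplex A -> chainComplex A -> Type :=
| Der_map X Y : chainMap X Y -> derMap X Y
| Der_inv X Y (s : chainMap X Y) : quasi_iso s -> derMap Y X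
| Der_comp X Y Z : derMap Y Z -> derMap X Y -> derMap X Z.

Notation "g \oD f" := (Der_comp g f) (at level 50, left associativity).

Inductive der_eq (R : realType) (A : bornAlg R) :
    forall X Y : chainComplex A, derMap X Y -> derMap X Y -> Prop :=
| Der_refl X Y (f : derMap X Y) : der_eq f f
| Der_sym X Y (f g : derMap X Y) : der_eq f g -> der_eq g f
| Der_trans X Y (f g h : derMap X Y) : der_eq f g -> der_eq g h -> der_eq f h
| Der_congr X Y Z (g g' : derMap Y Z) (f f' : derMap X Y) :
    der_eq g g' -> der_eq f f' -> der_eq (g \oD f) (g' \oD f')
| Der_assoc W X Y Z (h : derMap Y Z) (g : derMap X Y) (f : derMap W X) :
    der_eq (h \oD (g \oD f)) (h \oD g \oD f)
| Der_idl X Y (f : derMap X Y) : der_eq (Der_map (idMap Y) \oD f) f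
| Der_idr X Y (f : derMap X Y) : der_eq (f \oD Der_map (idMap X)) f
| Der_mapM X Y Z (g : chainMap Y Z) (f : chainMap X Y) :
    der_eq (Der_map (compMap g f)) (Der_map g \oD Der_map f)
| Der_homotopic X Y (f g : chainMap X Y) :
    homotopic f g -> der_eq (Der_map f) (Der_map g)
| Der_invl X Y (s : chainMap X Y) (qs : quasi_iso s) :
    der_eq (Der_inv qs \oD Der_map s) (Der_map (idMap X))
| Der_invr X Y (s : chainMap X Y) (qs : quasi_iso s) :
    der_eq (Der_map s \oD Der_inv qs) (Der_map (idMap Y)).

Section Derived.
Context {R : realType} {A : bornAlg R}.
Implicit Types X Y Z : chainComplex A.

Definition der_iso X Y (f : derMap X Y) : Prop :=
  exists g : derMap Y X, der_eq (g \oD f) (Der_map (idMap X)) /\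
                         der_eq (f \oD g) (Der_map (idMap Y)).

Fixpoint der_shift X Y (f : derMap X Y) : derMap (shift X) (shift Y) :=
  match f with
  | Der_map _ _ f => Der_map (shiftMap f)
  | Der_inv _ _ s qs => Der_inv (quasi_iso_shift qs)
  | Der_comp _ _ _ g f => der_shift g \oD der_shift f
  end.

Definition exact_triangle X Y Z
    (u : derMap X Y) (v : derMap Y Z) (w : derMap Z (shift X)) : Prop :=
  exists (X' Y' : chainComplex A) (f : chainMap X' Y')
    (a : derMap X X') (b : derMap Y Y') (c : derMap Z (cone f)),
    [/\ [/\ der_iso a, der_iso b & der_iso c],
        der_eq (b \oD u) (Der_map f \oD a),
        der_eq (c \oD v) (Der_map (cone_in f) \oD b)
      & der_eq (der_shift a \oD w) (Der_map (cone_out f) \oD c)].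

(* Full subcategories are given by their objects.  As every complex is the
   desuspension of its suspension, [shift X] in [T] implying [X] in [T] is
   closure under desuspension. *)
Record triangulated_subcategory (T : chainComplex A -> Prop) : Prop := {
  tri_iso : forall X Y (f : derMap X Y), der_iso f -> T X -> T Y;
  tri_shift : forall X, T X -> T (shift X);
  tri_unshift : forall X, T (shift X) -> T X;
  tri_triangle : forall X Y Z
    (u : derMap X Y) (v : derMap Y Z) (w : derMap Z (shift X)),
    exact_triangle u v w ->
    [/\ T X -> T Y -> T Z, T Y -> T Z -> T X & T X -> T Z -> T Y]
}.

(* Direct sums and products of complexes are formed degreewise. *)
Definition is_direct_sum (I : Type) (X : I -> chainComplex A)
    (S : chainComplex A) : Prop :=
  exists inj : forall i, chainMap (X i) S,
    forall n, is_coproduct (fun i => inj i n).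

Definition is_direct_product (I : Type) (X : I -> chainComplex A)
    (P : chainComplex A) : Prop :=
  exists proj : forall i, chainMap P (X i),
    forall n, is_product (fun i => proj i n).

Definition closed_under_direct_sums (T : chainComplex A -> Prop) : Prop :=
  forall (I : Type) (X : I -> chainComplex A) (S : chainComplex A),
    is_direct_sum X S -> (forall i, T (X i)) -> T S.

Definition closed_under_direct_products (T : chainComplex A -> Prop) : Prop :=
  forall (I : Type) (X : I -> chainComplex A) (P : chainComplex A),
    is_direct_product X P -> (forall i, T (X i)) -> T P.

End Derived.

(* Main.v *)
Require Import Defs.
From HB Require Import structures.
From mathcomp Require Import all_boot all_order all_algebra.
From mathcomp Require Import generic_quotient.
From mathcomp Require Import complex.
From mathcomp Require Import boolp classical_sets reals.
From mathcomp Require Import ring lra zify.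
From mathcomp.multinomials Require Import freeg.

(** The exact complexes are the linearly contractible ones, so a degreewise linearly
    split short exact sequence of complexes is an exact triangle of the derived
    category.  Every module has a linearly split resolution by free modules
    [A ⊗ V] (and a coresolution by cofree modules [Hom(A, V)]), and every complex is
    a telescope of complexes that are constant in each degree from some point on;
    the Milnor sequence of such a telescope is degreewise split.  Applied to brutal
    truncations this builds the bounded below complexes out of modules placed in one
    degree: first the resolutions, hence all modules, then all bounded below
    complexes.  Applied to the truncations [0 <- ker d_(-k) <- X_(-k+1) <- ...] it
    reaches unbounded complexes.  The product case is dual.

    The completed tensor product is the quotient of the bounded sequences [p] in the
    free vector space on [U × V], thought of as the sums of [2 ^- k.+1 *: p k], by those
    whose sum is killed by all bounded bilinear maps.  Completeness of disks is used
    throughout in the form: for [t] in the disk there is [rho] in the disk with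
    [q *: rho n = t n + rho n.+1]. *)

Set Implicit Arguments.
Unset Strict Implicit.
Unset Printing Implicit Defensive.

Import Order.TTheory GRing.Theory Num.Theory.
Import Normc.

#[local] Obligation Tactic := idtac.
Local Open Scope classical_set_scope.
Local Open Scope ring_scope.

(** * Banach disks *)

(** [is_free] only recognises a tensor product, so presenting a module by a free one requires
    constructing it, with a Banach disk around every bounded set. A bornological space has no
    topology to take limits in, and the recursion replaces them. Two bounded solutions for the same
    [t] differ by some [rho] with [q *: rho n = rho n.+1], which grows geometrically and so
    vanishes. Hence bounded solutions are unique and are respected by bounded linear maps, and
    completeness can be checked coordinatewise.

    The two ratios differ on purpose. Elements of the tensor product are series of ratio 1/2, while
    completeness is tested on series of ratio 1/4: summing the double series along diagonals gives
    coefficients [2 ^- m.+2], with sum below 1. With 1/2 twice, they would all be 1/2 and the sums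
    would leave the disk.

    Exactness asks for a bounded linear contraction, so a telescope with the right homology is not
    enough. Stabilisation in degree [n] from an index [N n] on permits explicit bounded splittings;
    [N n] may vary with [n]. *)

Section Disks.
Context {R : realType}.
Implicit Types V : lmodType R[i].

Local Notation "r %:C" := (real_complex R r).

Lemma normc_real (r : R) : normc r%:C = `|r|.
Proof. by rewrite /normc /= expr0n /= addr0 sqrtr_sqr. Qed.

Lemma normc_nat (n : nat) : normc (n%:R : R[i]) = n%:R.
Proof. by rewrite -(rmorph_nat (real_complex R)) normc_real ger0_norm. Qed.

Lemma normc_ge0 (c : R[i]) : 0 <= normc c.
Proof. by case: c => a b; rewrite sqrtr_ge0. Qed.

Lemma scale_realA V (r s : R) (x : V) : r%:C *: (s%:C *: x) = (r * s)%:C *: x.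
Proof. by rewrite scalerA -rmorphM. Qed.

Lemma scale_real1 V (x : V) : 1%:C *: x = x.
Proof. by rewrite rmorph1 scale1r. Qed.

Lemma scale_natE V (n : nat) (x : V) : n%:R *: x = n%:R%:C *: x.
Proof. by rewrite (rmorph_nat (real_complex R)). Qed.

(* [rho n] plays the role of the sum of [q ^- k.+1 *: t (n + k)] over all [k]. *)
Definition geometric_sum V (q : nat) (t rho : nat -> V) : Prop :=
  forall n, q%:R *: rho n = t n + rho n.+1.

Definition disk_separated V (T : set V) : Prop :=
  forall x, (forall r : R, 0 < r -> T (r%:C *: x)) -> x = 0.

(** Radial closure: for a disk it fills in the boundary of the unit ball of the gauge, see
    [disk_closure_ball]. *)
Definition disk_closure V (T : set V) : set V :=
  [set x | forall s : R, 0 < s -> s < 1 -> T (s%:C *: x)].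

(** * Consequences of being a Banach disk *)

Section FromBanach.
Variables (V : lmodType R[i]) (T : set V).
Hypothesis bT : banach_disk T.

Lemma banach_disk0 : T 0.
Proof.
case: bT => _ [N [nN _ ->]]; have sT := subspace_lspan T.
by split; [case: sT|rewrite (norm_on0 sT nN) ler01].
Qed.

(** The norm satisfies [n%:R * N x <= q%:R ^+ n * N x <= 1] for all [n], so it vanishes by the
    archimedean property. The powers of a single [q] suffice, and these are what a geometric
    recursion produces. *)
Lemma banach_disk_sep (q : nat) (x : V) : (1 < q)%N ->
  (forall n, T (q%:R ^+ n *: x)) -> x = 0.
Proof.
move=> q1 hT; case: bT => _ [N [nN _ eT]]; have sT := subspace_lspan T.
have Ux : lspan T x by apply: lspan_sub; have := hT 0%N; rewrite expr0 scale1r.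
have N0 := norm_on_ge0 sT nN Ux; case: (nN) => _ NZ ND.
apply: ND => //; apply/eqP; apply: contraT => Nx.
have {Nx N0}Nx : 0 < N x by rewrite lt_def Nx.
have hN n : n%:R * N x <= 1.
  have : T (q%:R ^+ n *: x) by [].
  rewrite {1}eT => -[_]; rewrite NZ // -natrX normc_nat.
  apply: le_trans; rewrite ler_pM2r // ler_nat.
  exact/ltnW/ltn_expl.
have := archi_boundP (ltW (divr_gt0 ltr01 Nx)).
by rewrite ltr_pdivrMr // ltNge hN.
Qed.

Lemma banach_disk_separated : disk_separated T.
Proof.
move=> x hx; apply: (@banach_disk_sep 2) => // n.
have := hx (2%:R ^+ n); rewrite rmorphXn /= rmorph_nat; apply.
by rewrite exprn_gt0.
Qed.

Lemma banach_disk_closed : disk_closure T `<=` T.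
Proof.
move=> x hx; have h2 : T ((2^-1)%:C *: x) by apply: hx; lra.
case: bT => _ [N [nN _ eT]]; have sT := subspace_lspan T.
have Ux : lspan T x.
  have := sT.2 2%:R _ 0 (lspan_sub h2) sT.1.
  by rewrite addr0 scale_natE scale_realA mulfV ?scale_real1 ?pnatr_eq0.
rewrite eT; split=> //; rewrite leNgt; apply/negP => N1.
case: (nN) => _ NZ _.
(* A factor below 1 that brings [x] to norm [(1 + N x) / 2], which is still above 1. *)
have : T (((1 + N x) / (2 * N x))%:C *: x).
  apply: hx; first by rewrite divr_gt0 //; lra.
  by rewrite ltr_pdivrMr; lra.
rewrite {1}eT => -[_]; rewrite NZ // normc_real ger0_norm; last first.
  by rewrite divr_ge0 //; lra.
have -> : (1 + N x) / (2 * N x) * N x = (1 + N x) / 2.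
  by rewrite invfM mulrA mulfVK // gt_eqF //; lra.
by rewrite ler_pdivrMr; lra.
Qed.

(** The sum of [q ^- j.+1 *: t (n + j)] over [j < k], in Horner form. *)
Fixpoint partial_sum (q : nat) (t : nat -> V) (k n : nat) : V :=
  if k is k'.+1 then q%:R^-1 *: (t n + partial_sum q t k' n.+1) else 0.

(** Both coefficients of a Horner step are 1/q, and 2/q <= 1 because q >= 2. *)
Lemma partial_sum_disk q t k n : (1 < q)%N -> (forall n, T (t n)) ->
  T (partial_sum q t k n).
Proof.
move=> q1 Tt; elim: k n => [|k IHk] n /=; first exact: banach_disk0.
rewrite scalerDr; apply: bT.1 => //.
rewrite normcV normc_nat -mulr2n -[_ *+ 2]mulr_natr.
by rewrite mulrC ler_pdivrMr ?ltr0n ?(ltn_trans _ q1)// mul1r ler_nat.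
Qed.

Lemma partial_sumD q t k j n :
  partial_sum q t (k + j) n - partial_sum q t k n =
  q%:R ^- k *: partial_sum q t j (n + k).
Proof.
elim: k n => [|k IHk] n; first by rewrite subr0 expr0 invr1 scale1r addn0.
rewrite addSn /= -scalerBr opprD addrACA subrr add0r IHk scalerA addSnnS.
by rewrite exprS invfM.
Qed.

(** Tails of the partial sums are [q ^- k] times elements of the disk, so the partial sums are
    Cauchy. Their limit stays in the disk because the disk is a closed unit ball, and the recursion
    passes to the limit. *)
Lemma banach_geometric_sum (q : nat) (t : nat -> V) : (1 < q)%N ->
  (forall n, T (t n)) ->
  exists2 rho, (forall n, T (rho n)) & geometric_sum q t rho.
Proof.
move=> q1 Tt; have hT := fun k n => @partial_sum_disk q t k n q1 Tt.
have q0 : 0 < q%:R :> R by rewrite ltr0n (ltn_trans _ q1).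
have qC : (q%:R : R[i]) != 0 by rewrite pnatr_eq0 -lt0n (ltn_trans _ q1).
case: bT => _ [N [nN kN eT]]; have sT := subspace_lspan T.
have [NT NZ ND] := nN; have N0 := norm_on_ge0 sT nN.
have NB x y : lspan T x -> lspan T y -> N (x - y) = N (y - x).
  move=> Ux Uy; rewrite -(opprB y x) -[- (y - x)]scaleN1r NZ ?normcN1 ?mul1r //.
  exact: (subspaceB sT).
have inT x : T x -> lspan T x /\ N x <= 1 by rewrite {1}eT.
have UT k n : lspan T (partial_sum q t k n) by case: (inT _ (hT k n)).
have small (e : R) : 0 < e -> exists k, q%:R ^- k < e.
  move=> e0; have := archi_boundP (ltW (divr_gt0 ltr01 e0)).
  set k := Num.bound _ => hk; exists k.
  rewrite invf_plt ?posrE ?exprn_gt0 // -div1r; apply: lt_le_trans hk _.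
  by rewrite -natrX ler_nat; apply/ltnW/ltn_expl.
have close k m n : (k <= m)%N ->
    N (partial_sum q t m n - partial_sum q t k n) <= q%:R ^- k.
  move=> /subnKC <-; rewrite partial_sumD NZ; last exact: UT.
  rewrite normcV -natrX normc_nat natrX ler_piMr //.
    by rewrite invr_ge0 exprn_ge0 // ltW.
  by case: (inT _ (hT (m - k)%N (n + k)%N)).
have : forall n, exists l, lspan T l /\ forall e : R, 0 < e ->
    exists k : nat, forall m : nat, (k <= m)%N -> N (partial_sum q t m n - l) < e.
  move=> n; have [|e e0|l Ul hl] := kN (fun m => partial_sum q t m n).
  - by move=> m; apply: UT.
  - have [k hk] := small (e / 2) (divr_gt0 e0 (ltr0Sn _ 1)).
    exists k => m m' km km'.
    have -> : partial_sum q t m n - partial_sum q t m' n =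
      (partial_sum q t m n - partial_sum q t k n) +
      (partial_sum q t k n - partial_sum q t m' n).
      by rewrite addrA subrK.
    apply: le_lt_trans (NT _ _ (subspaceB sT (UT _ _) (UT _ _))
      (subspaceB sT (UT _ _) (UT _ _))) _.
    rewrite (NB (partial_sum q t k n)) //.
    have := close _ _ n km; have := close _ _ n km'; lra.
  - by exists l.
move=> /choice[rho hrho]; exists rho.
  move=> n; have [Ul hl] := hrho n; rewrite eT; split=> //.
  apply/ler_addgt0Pl => e e0; have [k hk] := hl e e0.
  have [Up Np] := inT _ (hT k n).
  have -> : rho n = (rho n - partial_sum q t k n) + partial_sum q t k n.
    by rewrite subrK.
  apply: le_trans (NT _ _ (subspaceB sT Ul Up) Up) _.
  by rewrite lerD // NB // ltW // hk.
move=> n; have [Ul hl] := hrho n; have [Ul' hl'] := hrho n.+1.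
have Ut : lspan T (t n) by case: (inT _ (Tt n)).
apply/eqP; rewrite -subr_eq0; apply/eqP.
have Uq x : lspan T x -> lspan T (q%:R *: x).
  by move=> Ux; have := sT.2 q%:R x 0 Ux sT.1; rewrite addr0.
have Us : lspan T (q%:R *: rho n - (t n + rho n.+1)).
  apply: (subspaceB sT) => //; first exact: Uq.
  by have := sT.2 1 _ _ Ut Ul'; rewrite scale1r.
apply: ND => //; apply/eqP; rewrite eq_le N0 // andbT.
apply/ler_addgt0Pl => e e0; rewrite addr0.
(* The error is [q] times one distance plus another one, hence the divisor [q + 1]. Index [k.+1] at
   [n] goes with index [k] at [n.+1] because one Horner step links them. *)
have e1 : 0 < e / (q%:R + 1) by rewrite divr_gt0 // addr_gt0.
have [k1 hk1] := hl _ e1; have [k2 hk2] := hl' _ e1.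
pose k := maxn k1 k2.
have {}hk1 := hk1 k.+1 (leqW (leq_maxl _ _)).
have {}hk2 := hk2 k (leq_maxr _ _).
have -> : q%:R *: rho n - (t n + rho n.+1) =
    q%:R *: (rho n - partial_sum q t k.+1 n) + (partial_sum q t k n.+1 - rho n.+1).
  by rewrite scalerBr /= scalerA mulfV // scale1r !opprD !addrA subrK.
apply: le_trans (NT _ _ (Uq _ (subspaceB sT Ul (UT _ _))) (subspaceB sT (UT _ _) Ul')) _.
rewrite NZ; last exact: (subspaceB sT).
rewrite normc_nat NB //.
have : q%:R * N (partial_sum q t k.+1 n - rho n) <= q%:R * (e / (q%:R + 1)).
  by rewrite ler_pM2l // ltW.
have -> : q%:R * (e / (q%:R + 1)) = e - e / (q%:R + 1).
  by field; rewrite gt_eqF // addr_gt0.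
by move: hk2; lra.
Qed.

End FromBanach.

(** * Recognising Banach disks by their gauge *)

Section ToBanach.
Variables (V : lmodType R[i]) (T : set V).
Hypotheses (cT : absolutely_convex T) (T0 : T 0) (sepT : disk_separated T).

Lemma disk_scale (c : R[i]) (x : V) : normc c <= 1 -> T x -> T (c *: x).
Proof.
move=> c1 Tx; have := cT (a := c) (b := 0) Tx Tx.
by rewrite scale0r addr0 normc0 addr0; apply.
Qed.

Lemma disk_scale_le (r s : R) (x : V) : 0 <= r -> r <= s ->
  T (s%:C *: x) -> T (r%:C *: x).
Proof.
move=> r0 rs; have [s0|sN0] := eqVneq s 0 => Tx.
  by have -> : r = 0; [apply/eqP; rewrite eq_le r0 -s0 rs|rewrite scale0r].
have s0 : 0 < s by rewrite lt_def sN0 (le_trans r0).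
have -> : r%:C *: x = (r / s)%:C *: (s%:C *: x) by rewrite scale_realA divfK.
apply: disk_scale => //; rewrite normc_real ger0_norm ?divr_ge0 ?(ltW s0) //.
by rewrite ler_pdivrMr // mul1r.
Qed.

Definition absorbed : set V := [set x | exists2 r : R, 0 < r & T ((r^-1)%:C *: x)].

Definition gauge (x : V) : R := inf [set r : R | 0 < r /\ T ((r^-1)%:C *: x)].

(** The vector [x + y] divided by [r + s] is the convex combination of [x / r] and [y / s] with
    weights [r / (r + s)] and [s / (r + s)]. This is the triangle inequality of the gauge. *)
Lemma absorbed_add (r s : R) (x y : V) : 0 < r -> 0 < s ->
  T ((r^-1)%:C *: x) -> T ((s^-1)%:C *: y) -> T (((r + s)^-1)%:C *: (x + y)).
Proof.
move=> r0 s0 Tx Ty; have rs0 : 0 < r + s by rewrite addr_gt0.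
have := cT (a := (r / (r + s))%:C) (b := (s / (r + s))%:C) Tx Ty.
rewrite !scale_realA [r / _]mulrC [s / _]mulrC !mulfK ?gt_eqF // -scalerDr.
apply; rewrite !normc_real !ger0_norm ?mulr_ge0 ?invr_ge0 ?(ltW r0) ?(ltW s0) ?(ltW rs0) //.
by rewrite -mulrDr mulVf // gt_eqF.
Qed.

Lemma absorbed_disk : T `<=` absorbed.
Proof. by move=> x Tx; exists 1; rewrite ?invr1 ?scale_real1. Qed.

Lemma gauge_le (r : R) (x : V) : 0 < r -> T ((r^-1)%:C *: x) -> gauge x <= r.
Proof.
by move=> r0 Tx; apply: ge_inf; [exists 0 => s [/ltW]|split].
Qed.

Lemma gauge_lt (r : R) (x : V) : absorbed x -> gauge x < r ->
  T ((r^-1)%:C *: x).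
Proof.
move=> [s s0 Ts] /inf_lt[|u [u0 Tu] ur]; first by exists s.
have r0 := lt_trans u0 ur.
by apply: disk_scale_le Tu; rewrite ?invr_ge0 ?lef_pV2 ?posrE // ltW.
Qed.

Lemma gauge_ge0 x : 0 <= gauge x.
Proof.
have [A0|NA] := pselect (exists r : R, 0 < r /\ T ((r^-1)%:C *: x)).
  by apply: lb_le_inf A0 _ => s [/ltW].
rewrite /gauge (_ : mkset _ = set0) ?inf0 //; apply/seteqP; split=> // r.
by move=> rT; case: NA; exists r.
Qed.

Lemma subspace_absorbed : subspace absorbed.
Proof.
split=> [|c x y [r r0 Tx] [s s0 Ty]].
  by exists 1; rewrite // scaler0.
exists ((normc c + 1) * r + s).
  by rewrite addr_gt0 // mulr_gt0 // ltr_pwDr // normc_ge0.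
have c0 : 0 < normc c + 1 by rewrite ltr_pwDr // normc_ge0.
apply: absorbed_add => //; first by rewrite mulr_gt0.
rewrite invfM rmorphM /= scalerA mulrAC -scalerA.
apply: disk_scale => //; rewrite normcM normc_real ger0_norm ?invr_ge0 ?ltW //.
by rewrite mulrC ltr_pdivrMr // mul1r ltr_pwDr.
Qed.

Lemma lspan_closure : lspan (disk_closure T) = absorbed.
Proof.
apply/seteqP; split=> x.
  apply; first exact: subspace_absorbed.
  move=> y hy; exists 2 => //; apply: hy; lra.
move=> [r r0 Tx] U sU TU.
have -> : x = r%:C *: ((r^-1)%:C *: x) + 0.
  by rewrite scale_realA mulfV ?gt_eqF // scale_real1 addr0.
apply: sU.2 sU.1; apply: TU => s s0 s1.
by rewrite /=; apply: disk_scale => //; rewrite normc_real ger0_norm ltW.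
Qed.

Lemma gauge_scale_le (c : R[i]) (x : V) : absorbed x ->
  gauge (c *: x) <= normc c * gauge x.
Proof.
move=> Ux; have [->|c0] := eqVneq c 0.
  rewrite scale0r normc0 mul0r; apply/ler_addgt0Pl => e e0; rewrite addr0.
  by apply: gauge_le; rewrite // scaler0.
have nc0 : 0 < normc c.
  by rewrite lt_def normc_ge0 andbT; apply: contra_neq c0; apply: eq0_normc.
apply/ler_addgt0Pl => e e0.
pose r := gauge x + e / normc c.
have r0 : 0 < r by rewrite ltr_wpDl ?gauge_ge0 ?divr_gt0.
have -> : e + normc c * gauge x = normc c * r.
  by rewrite mulrDr mulrC [_ * (e / _)]mulrC divfK ?gt_eqF // addrC mulrC.
apply: gauge_le; first by rewrite mulr_gt0.
have Tx : T ((r^-1)%:C *: x) by apply: gauge_lt => //; rewrite ltrDl divr_gt0.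
rewrite invfM rmorphM /= scalerA mulrAC -scalerA.
apply: disk_scale => //; rewrite normcM normc_real ger0_norm ?invr_ge0 ?(ltW nc0) //.
by rewrite mulVf ?gt_eqF.
Qed.

Lemma gauge_norm : norm_on absorbed gauge.
Proof.
split=> [x y Ux Uy|c x Ux|x Ux gx].
- apply/ler_addgt0Pl => e e0.
  have e2 : 0 < e / 2 by rewrite divr_gt0.
  have -> : e + (gauge x + gauge y) = (gauge x + e / 2) + (gauge y + e / 2).
    by field.
  have [gx gy] := (gauge_ge0 x, gauge_ge0 y).
  apply: gauge_le; first by apply: addr_gt0; rewrite ltr_wpDl.
  by apply: absorbed_add; rewrite ?ltr_wpDl //; apply: gauge_lt; rewrite // ltrDl.
- apply/eqP; rewrite eq_le gauge_scale_le //=.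
  have [->|c0] := eqVneq c 0; first by rewrite normc0 mul0r gauge_ge0.
  have Ucx : absorbed (c *: x).
    by have := subspace_absorbed.2 c x 0 Ux subspace_absorbed.1; rewrite addr0.
  have nc0 : 0 < normc c.
    by rewrite lt_def normc_ge0 andbT; apply: contra_neq c0; apply: eq0_normc.
  have := gauge_scale_le c^-1 Ucx; rewrite scalerA mulVf // scale1r normcV.
  by rewrite mulrC ler_pdivlMr // mulrC.
- apply: sepT => r r0; rewrite -[r]invrK; apply: gauge_lt => //.
  by rewrite gx invr_gt0.
Qed.

Lemma disk_closure_ball :
  disk_closure T = [set x | absorbed x /\ gauge x <= 1].
Proof.
apply/seteqP; split=> [x hx|x [Ux gx] s s0 s1].
  split; first by rewrite -lspan_closure; apply: lspan_sub.
  apply/ler_addgt0Pl => e e0; apply: gauge_le; first by rewrite addr_gt0.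
  apply: hx; rewrite ?invr_gt0 ?addr_gt0 //.
  by rewrite invf_cp1 ?ltrDr ?addr_gt0.
rewrite -[s]invrK; apply: gauge_lt => //.
by apply: le_lt_trans gx _; rewrite invf_gt1.
Qed.

(** A Cauchy sequence has a subsequence whose increments have gauge below [4 ^- n.+1]. Rescaled by
    [4 ^+ n.+1] they lie in [T], and a solution of the recursion adds them up: the limit is
    [u (K 0) + rho 0]. So series of ratio 1/4 are enough to test completeness. *)
Lemma disk_closure_banach :
  (forall t : nat -> V, (forall n, T (t n)) ->
     exists2 rho, (forall n, T (rho n)) & geometric_sum 4 t rho) ->
  banach_disk (disk_closure T).
Proof.
move=> kT; split.
  move=> a b x y hx hy ab s s0 s1.
  rewrite scalerDr !scalerA ![s%:C * _]mulrC -!scalerA.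
  by apply: cT => //; [apply: hx|apply: hy].
exists gauge; rewrite lspan_closure; split; first exact: gauge_norm.
  2: exact: disk_closure_ball.
move=> u Uu cu.
have sU := subspace_absorbed; have nN := gauge_norm; have [NT NZ _] := nN.
have q0 n : 0 < 4%:R ^- n :> R by rewrite invr_gt0 exprn_gt0.
have /choice[kappa hk] : forall n, exists k, forall m m', (k <= m)%N -> (k <= m')%N ->
    gauge (u m - u m') < 4%:R ^- n.+1 by move=> n; apply: cu.
(* Cumulative sums make the indices monotone and keep them above [kappa]. *)
pose K n := (\sum_(i < n.+1) kappa i)%N.
have Kk n : (kappa n <= K n)%N by rewrite /K big_ord_recr leq_addl.
have KS n : (K n <= K n.+1)%N by rewrite {2}/K big_ord_recr leq_addr.
have UB m m' : absorbed (u m - u m') by apply: subspaceB.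
have C4 n : (4%:R ^+ n : R[i]) = (4%:R ^+ n : R)%:C by rewrite rmorphXn rmorph_nat.
have [n|rho Tr rE] := kT (fun n => 4%:R ^+ n.+1 *: (u (K n.+1) - u (K n))).
  rewrite C4 -[_ ^+ n.+1]invrK; apply: gauge_lt => //.
  by apply: hk; rewrite ?(leq_trans (Kk n)).
(* The remainder after [n] terms is [4 ^- n *: rho n] with [rho n] in [T], which bounds the distance
   to the limit. *)
have rhoE n : rho 0%N = (u (K n) - u (K 0%N)) + 4%:R ^- n *: rho n.
  elim: n => [|n IHn]; first by rewrite subrr add0r expr0 invr1 scale1r.
  rewrite {}IHn; have -> : rho n = 4%:R^-1 *: (4%:R *: rho n).
    by rewrite scalerA mulVf ?pnatr_eq0 // scale1r.
  rewrite rE scalerA -invfM -exprSr scalerDr scalerA mulVf ?expf_neq0 ?pnatr_eq0 //.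
  by rewrite scale1r addrA; congr (_ + _); rewrite addrC addrA subrK.
have Ur n : absorbed (rho n) by apply: absorbed_disk.
exists (u (K 0%N) + rho 0%N).
  by have := sU.2 1 _ _ (Uu (K 0%N)) (Ur 0%N); rewrite scale1r.
move=> e e0.
have [j hj] : exists j, 4%:R ^- j < e / 2.
  have e2 : 0 < e / 2 by rewrite divr_gt0.
  have := archi_boundP (ltW (divr_gt0 ltr01 e2)).
  set k := Num.bound _ => hk'; exists k.
  rewrite invf_plt ?posrE ?exprn_gt0 // -div1r; apply: lt_le_trans hk' _.
  by rewrite -natrX ler_nat; apply/ltnW/ltn_expl.
exists (K j) => n Kn.
have -> : u n - (u (K 0%N) + rho 0%N) = (u n - u (K j)) + (- 4%:R ^- j) *: rho j.
  rewrite (rhoE j) addrA [u (K 0%N) + _]addrC subrK opprD addrA; congr (_ + _).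
  by rewrite scaleNr.
have UZ c x : absorbed x -> absorbed (c *: x).
  by move=> Ux; have := sU.2 c x 0 Ux sU.1; rewrite addr0.
apply: le_lt_trans (NT _ _ (UB _ _) (UZ _ _ (Ur _))) _.
have g1 : gauge (u n - u (K j)) < 4%:R ^- j.+1.
  by apply: hk; rewrite ?(leq_trans (Kk j)).
have g2 : gauge (- 4%:R ^- j *: rho j) <= 4%:R ^- j.

  rewrite NZ // -mulN1r normcM normcN1 mul1r normcV C4 normc_real ger0_norm ?exprn_ge0 //.
  rewrite ler_piMr ?(ltW (q0 j)) //; apply: gauge_le => //.
  by rewrite invr1 scale_real1.
have : 4%:R ^- j.+1 <= 4%:R ^- j :> R.
  by rewrite lef_pV2 ?posrE ?exprn_gt0 // ler_eXn2l // ltr1n.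
lra.
Qed.

End ToBanach.

Lemma disk_banach V (T : set V) : absolutely_convex T -> T 0 ->
  disk_separated T -> disk_closure T `<=` T ->
  (forall t : nat -> V, (forall n, T (t n)) ->
     exists2 rho, (forall n, T (rho n)) & geometric_sum 4 t rho) ->
  banach_disk T.
Proof.
move=> cT T0 sT clT kT; have -> : T = disk_closure T.
  apply/seteqP; split=> // x Tx s s0 s1.
  by apply: disk_scale => //; rewrite normc_real ger0_norm ltW.
exact: disk_closure_banach.
Qed.

(* The limits [l i] of the images of a series must come from one vector of [E]. *)
Lemma banach_disk_preimage (E : lmodType R[i]) (I : Type) (V : I -> lmodType R[i])
    (e : forall i, E -> V i) (T : forall i, set (V i)) :
  (forall i, linear (e i)) -> (forall x, (forall i, e i x = 0) -> x = 0) ->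
  (forall i, banach_disk (T i)) ->
  (forall (t : nat -> E) (l : forall i, nat -> V i),
     (forall i n, T i (e i (t n))) -> (forall i n, T i (l i n)) ->
     (forall i, geometric_sum 4 (e i \o t) (l i)) ->
     exists y, forall i n, e i (y n) = l i n) ->
  banach_disk [set x | forall i, T i (e i x)].
Proof.
move=> le inj bT lim.
have eZ i c x : e i (c *: x) = c *: e i x.
  by have := le i c x 0; rewrite !(lin0 (le i)) !addr0.
apply: disk_banach => [a b x y Tx Ty ab i|i|x hx|x hx i|t Tt].
- rewrite linD ?eZ //; exact: (bT i).1.
- by rewrite lin0 //; apply: banach_disk0.
- apply: inj => i; apply: (banach_disk_separated (bT i)) => r r0.
  by rewrite -eZ; apply: hx.
- by apply: (banach_disk_closed (bT i)) => s s0 s1; rewrite -eZ; apply: hx.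
- have ex_l : forall i, exists l : nat -> V i,
      (forall n, T i (l n)) /\ geometric_sum 4 (e i \o t) l.
    move=> i; have [//|n|l Tl lE] := @banach_geometric_sum _ _ (bT i) 4 (e i \o t).
      exact: Tt.
    by exists l.
  pose l i := sval (cid (ex_l i)).
  have hl i : (forall n, T i (l i n)) /\ geometric_sum 4 (e i \o t) (l i).
    exact: svalP (cid (ex_l i)).
  have [|i n|i|y yE] := lim t l; first by move=> i n; apply: Tt.
  - exact: (hl i).1.
  - exact: (hl i).2.
  exists y => [n i|n]; first by rewrite yE; apply: (hl i).1.
  apply/eqP; rewrite -subr_eq0; apply/eqP/inj => i.
  have := (hl i).2 n; rewrite /= -!yE -eZ -(linD (le i)) => lE.
  by rewrite (linD (le i)) (linN (le i)) lE subrr.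
Qed.

End Disks.

(** * Complete bornological spaces *)

Section SubLmod.
Context {R : realType} {V : lmodType R[i]} {U : set V}.

Definition subspace_pred (sU : subspace U) : {pred V} := fun x => `[< U x >].

Lemma subspace_pred_closed (sU : subspace U) : submod_closed (subspace_pred sU).
Proof.
split=> [|c x y /asboolP Ux /asboolP Uy]; apply/asboolP; first exact: sU.1.
exact: sU.2.
Qed.

HB.instance Definition _ (sU : subspace U) :=
  GRing.isSubmodClosed.Build R[i] V (subspace_pred sU) (subspace_pred_closed sU).

Record sub_lmod (sU : subspace U) :=
  SubLmod { sub_val : V; _ : sub_val \in subspace_pred sU }.

HB.instance Definition _ (sU : subspace U) := [isSub for @sub_val sU].
HB.instance Definition _ (sU : subspace U) := [Choice of sub_lmod sU by <:].
HB.instance Definition _ (sU : subspace U) :=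
  [SubChoice_isSubLmodule of sub_lmod sU by <:].

Variable sU : subspace U.

Lemma sub_valP (x : sub_lmod sU) : U (sub_val x).
Proof. by apply/asboolP; case: x. Qed.

Definition sub_mk (x : V) (Ux : U x) : sub_lmod sU :=
  @SubLmod sU x (asboolT Ux).

End SubLmod.

Section DepProd.
Context {R : realType} (I : Type) (V : I -> lmodType R[i]).

Definition dprod : Type := forall i, V i.

HB.instance Definition _ := gen_eqMixin dprod.
HB.instance Definition _ := gen_choiceMixin dprod.

Let add (f g : dprod) : dprod := fun i => f i + g i.
Let opp (f : dprod) : dprod := fun i => - f i.
Let scale (c : R[i]) (f : dprod) : dprod := fun i => c *: f i.

Fact dprod_addA : associative add.
Proof. by move=> f g h; apply: functional_extensionality_dep => i; rewrite /add addrA. Qed.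
Fact dprod_addC : commutative add.
Proof. by move=> f g; apply: functional_extensionality_dep => i; rewrite /add addrC. Qed.
Fact dprod_add0 : left_id (fun i => 0) add.
Proof. by move=> f; apply: functional_extensionality_dep => i; rewrite /add add0r. Qed.
Fact dprod_addN : left_inverse (fun i => 0) opp add.
Proof. by move=> f; apply: functional_extensionality_dep => i; rewrite /add addNr. Qed.

HB.instance Definition _ := GRing.isZmodule.Build dprod
  dprod_addA dprod_addC dprod_add0 dprod_addN.

Fact dprod_scaleA a b (f : dprod) : scale a (scale b f) = scale (a * b) f.
Proof. by apply: functional_extensionality_dep => i; rewrite /scale scalerA. Qed.
Fact dprod_scale1 : left_id 1 scale.
Proof. by move=> f; apply: functional_extensionality_dep => i; rewrite /scale scale1r. Qed.
Fact dprod_scaleDr : right_distributive scale +%R.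
Proof. by move=> c f g; apply: functional_extensionality_dep => i; apply: scalerDr. Qed.
Fact dprod_scaleDl (f : dprod) : {morph scale^~ f : a b / a + b}.
Proof. by move=> a b; apply: functional_extensionality_dep => i; apply: scalerDl. Qed.

HB.instance Definition _ := GRing.Zmodule_isLmodule.Build R[i] dprod
  dprod_scaleA dprod_scale1 dprod_scaleDr dprod_scaleDl.

Lemma dprodP (f g : dprod) : (forall i, f i = g i) -> f = g.
Proof. exact: functional_extensionality_dep. Qed.

End DepProd.

(** * Geometric series in complete bornological spaces *)

Section BornSeries.
Context {R : realType}.
Implicit Types V : bornSpace R.

(** The recursion gives [rho (n + k) = q ^+ k *: rho n], so a single Banach disk contains all these
    multiples of [rho n]. *)
Lemma bdd_geometric0 V (q : nat) (rho : nat -> V) : (1 < q)%N ->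
  bdd (range rho) -> (forall n, q%:R *: rho n = rho n.+1) -> forall n, rho n = 0.
Proof.
move=> q1 /bdd_banach[T [rT _ bT]] rE n; apply: (banach_disk_sep bT q1) => k.
suff -> : q%:R ^+ k *: rho n = rho (n + k)%N by apply: rT; exists (n + k)%N.
elim: k => [|k IHk]; first by rewrite expr0 scale1r addn0.
by rewrite exprS -scalerA IHk rE addnS.
Qed.

Lemma bdd_add_fun V (I : Type) (f g : I -> V) :
  bdd (range f) -> bdd (range g) -> bdd (range (fun i => f i + g i)).
Proof.
move=> bf bg; apply: bdd_sub (bdd_add bf bg) => _ [i _ <-].
by exists (f i); [exists i|exists (g i) => //; exists i].
Qed.

Lemma bdd_scale_fun V (I : Type) (c : R[i]) (f : I -> V) :
  bdd (range f) -> bdd (range (fun i => c *: f i)).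
Proof.
move=> bf; apply: bdd_sub (bdd_scale (normc c) bf) => _ [i _ <-].
by exists c => /=; rewrite ?lexx //; exists (f i) => //; exists i.
Qed.

Lemma geometric_sum_unique V (q : nat) (t rho rho' : nat -> V) : (1 < q)%N ->
  bdd (range rho) -> bdd (range rho') ->
  geometric_sum q t rho -> geometric_sum q t rho' -> forall n, rho n = rho' n.
Proof.
move=> q1 br br' rE rE' n; apply/eqP; rewrite -subr_eq0; apply/eqP.
move: n; apply: (bdd_geometric0 q1 (rho := fun n => rho n - rho' n)).
  apply: bdd_add_fun => //; apply: bdd_sub (bdd_opp br') => _ [n _ <-].
  by exists (rho' n) => //; exists n.
by move=> n; rewrite scalerBr rE rE' opprD addrACA subrr add0r.
Qed.

(** Closedness without a topology: it provides just the sums that make the trace of a Banach disk on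
    [U] complete. *)
Definition series_closed V (U : set V) : Prop :=
  forall t rho : nat -> V, (forall n, U (t n)) -> bdd (range rho) ->
    geometric_sum 4 t rho -> forall n, U (rho n).

(** The sequence [f \o rho] is bounded and solves the homogeneous recursion, so it vanishes. *)
Lemma series_closed_kernel V (W : bornSpace R) (f : V -> W) :
  bounded_linear f -> series_closed [set x | f x = 0].
Proof.
move=> [lf bf] t rho Ut br rE; apply: (@bdd_geometric0 W 4 (f \o rho)) => //.
  by have := bf _ br; rewrite image_comp.
move=> n /=; rewrite -[LHS]addr0 -(lin0 lf) -lf rE addr0 linD // Ut add0r.
by [].
Qed.

Lemma series_closedI V (U U' : set V) :
  series_closed U -> series_closed U' -> series_closed (U `&` U').
Proof.
move=> cU cU' t rho Ut br rE n.
by split; [apply: cU rE _ => // m|apply: cU' rE _ => // m]; case: (Ut m).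
Qed.

Lemma series_closed_imply V (P : Prop) (U : set V) :
  series_closed U -> series_closed [set x | P -> U x].
Proof. by move=> cU t rho Ut br rE n p; apply: cU rE n => // m; apply: Ut. Qed.

End BornSeries.

(** * Closed subspaces, products, direct sums and spaces of bounded maps *)

Section SubSpace.
Context {R : realType} (V : bornSpace R) (U : set V).
Hypotheses (sU : subspace U) (cU : series_closed U).

Program Definition subSpace : bornSpace R :=
  @BornSpace R (sub_lmod sU) [set S | bdd (@sub_val _ _ _ sU @` S)] _ _ _ _ _ _.
Next Obligation. by move=> x; rewrite /mkset image_set1; apply: bdd_set1. Qed.
Next Obligation. by move=> S T ST; apply: bdd_sub; apply: image_subset. Qed.
Next Obligation.
by move=> S T bS bT; rewrite /mkset image_setU; apply: bdd_setU.
Qed.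
Next Obligation.
move=> S T bS bT; apply: bdd_sub (bdd_add bS bT) => _ [_ [x Sx [y Ty <-]] <-].
by exists (sub_val x); [exists x|exists (sub_val y) => //; exists y].
Qed.
Next Obligation.
move=> r S bS; apply: bdd_sub (bdd_scale r bS) => _ [_ [c cr [x Sx <-]] <-].
by exists c => //; exists (sub_val x) => //; exists x.
Qed.
Next Obligation.
move=> S /bdd_banach[T [ST bT dT]]; exists [set x | T (sub_val x)]; split.
- by move=> x Sx; apply: ST; exists x.
- by apply: bdd_sub bT => _ [x Tx <-].
have -> : [set x : sub_lmod sU | T (sub_val x)] =
    [set x | forall i : unit, T (sub_val x)].
  by apply/seteqP; split=> x Tx; [move=> _|apply: Tx tt].
apply: (@banach_disk_preimage _ _ unit (fun=> V) (fun=> @sub_val _ _ _ sU)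
  (fun=> T)) => //.
- by move=> x /(_ tt) x0; apply: val_inj.
- move=> t l _ Tl lE.
  have Ul n : U (l tt n).
    apply: (cU _ _ (lE tt)) => [m|]; first exact: sub_valP.
    by apply: bdd_sub bT => _ [m _ <-].
  by exists (fun n => sub_mk sU (Ul n)) => -[].
Qed.

Lemma bounded_linear_sub_val : bounded_linear (@sub_val _ _ _ sU : subSpace -> V).
Proof. by split. Qed.

Lemma bounded_linear_sub_mk (W : bornSpace R) (f : W -> V) (Uf : forall x, U (f x)) :
  bounded_linear f -> bounded_linear (fun x => sub_mk sU (Uf x) : subSpace).
Proof.
move=> [lf bf]; split=> [c x y|S bS]; first by apply: val_inj; apply: lf.
by apply: bdd_sub (bf _ bS) => _ [_ [x Sx <-] <-]; exists x.
Qed.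

End SubSpace.

Section DirectProduct.
Context {R : realType} (I : Type) (V : I -> bornSpace R).

Program Definition dprodSpace : bornSpace R :=
  @BornSpace R (dprod V) [set S | forall i, bdd [set (f : dprod V) i | f in S]]
    _ _ _ _ _ _.
Next Obligation. by move=> f i; rewrite image_set1; apply: bdd_set1. Qed.
Next Obligation. by move=> S T ST bT i; apply: bdd_sub (bT i); apply: image_subset. Qed.
Next Obligation.
by move=> S T bS bT i; rewrite image_setU; apply: bdd_setU; [apply: bS|apply: bT].
Qed.
Next Obligation.
move=> S T bS bT i.
apply: bdd_sub (bdd_add (bS i) (bT i)) => _ [_ [x Sx [y Ty <-]] <-].
by exists (x i); [exists x|exists (y i) => //; exists y].
Qed.
Next Obligation.
move=> r S bS i; apply: bdd_sub (bdd_scale r (bS i)) => _ [_ [c cr [x Sx <-]] <-].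
by exists c => //; exists (x i) => //; exists x.
Qed.
Next Obligation.
move=> S bS; pose T i := sval (cid (bdd_banach (bS i))).
have hT i : [/\ [set (f : dprod V) i | f in S] `<=` T i, bdd (T i)
    & banach_disk (T i)] by apply: svalP (cid (bdd_banach (bS i))).
exists [set f | forall i, T i (f i)]; split.
- by move=> f Sf i; have [ST _ _] := hT i; apply: ST; exists f.
- by move=> i; have [_ bT _] := hT i; apply: bdd_sub bT => _ [f Tf <-]; apply: Tf.
apply: (@banach_disk_preimage _ (dprod V) I V (fun i f => f i) T) => //.
- by move=> f f0; apply: dprodP.
- by move=> i; have [] := hT i.
- by move=> t l _ _ _; exists (fun n i => l i n).
Qed.

Lemma bounded_linear_proj i : bounded_linear (fun f : dprodSpace => f i).
Proof. by split. Qed.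

Lemma bounded_linear_dprod (W : bornSpace R) (f : W -> dprodSpace) :
  (forall i, bounded_linear (fun x => f x i)) -> bounded_linear f.
Proof.
move=> bf; split=> [c x y|S bS i]; first by apply: dprodP => i; apply: (bf i).1.
by have := (bf i).2 _ bS; rewrite image_comp.
Qed.

End DirectProduct.

Section DirectSum.
Context {R : realType} (V : nat -> bornSpace R).

Definition finite_support : set (dprod V) :=
  [set f | exists K, forall n, (K <= n)%N -> f n = 0].

Lemma subspace_finite_support : subspace finite_support.
Proof.
split=> [|c f g [K hK] [L hL]]; first by exists 0%N.
exists (maxn K L) => n; rewrite geq_max => /andP[Kn Ln].
by rewrite -[LHS]/(c *: f n + g n) hK // hL // scaler0 addr0.
Qed.

Local Notation E := (sub_lmod subspace_finite_support).
Definition dsum_val (f : E) : forall n, V n := sub_val f.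
Local Notation val := dsum_val.

(** The bornology of a direct sum: the uniform [K] confines a bounded set to finitely many summands,
    which makes maps defined summand by summand bounded. *)
Definition dsum_bdd (S : set E) : Prop :=
  (exists K, forall f, S f -> forall n, (K <= n)%N -> val f n = 0) /\
  forall n, bdd [set val f n | f in S].

Program Definition dsumSpace : bornSpace R :=
  @BornSpace R E dsum_bdd _ _ _ _ _ _.
Next Obligation.
move=> f; split=> [|n]; last by rewrite image_set1; apply: bdd_set1.
by have [K hK] := sub_valP f; exists K => _ ->.
Qed.
Next Obligation.
move=> S T ST [[K hK] bT]; split; first by exists K => f /ST; apply: hK.
by move=> n; apply: bdd_sub (bT n); apply: image_subset.
Qed.
Next Obligation.
move=> S T [[K hK] bS] [[L hL] bT]; split.
  exists (maxn K L) => f STf n; rewrite geq_max => /andP[Kn Ln].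
  by case: STf => [Sf|Tf]; [apply: hK|apply: hL].
by move=> n; rewrite image_setU; apply: bdd_setU; [apply: bS|apply: bT].
Qed.
Next Obligation.
move=> S T [[K hK] bS] [[L hL] bT]; split.
  exists (maxn K L) => _ [f Sf [g Tg <-]] n; rewrite geq_max => /andP[Kn Ln].
  by rewrite -[LHS]/(val f n + val g n) hK // hL // addr0.
move=> n; apply: bdd_sub (bdd_add (bS n) (bT n)) => _ [_ [x Sx [y Ty <-]] <-].
by exists (val x n); [exists x|exists (val y n) => //; exists y].
Qed.
Next Obligation.
move=> r S [[K hK] bS]; split.
  exists K => _ [c cr [f Sf <-]] n Kn.
  by rewrite -[LHS]/(c *: val f n) hK // scaler0.
move=> n; apply: bdd_sub (bdd_scale r (bS n)) => _ [_ [c cr [x Sx <-]] <-].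
by exists c => //; exists (val x n) => //; exists x.
Qed.
Next Obligation.
move=> S [[K hK] bS].
(* Taking the zero disk from [K] on keeps the product of the chosen disks inside the first [K]
   summands. *)
have ex_T n : exists T : set (V n), [/\ [set val f n | f in S] `<=` T, bdd T,
    banach_disk T & (K <= n)%N -> T `<=` [set 0]].
  have [Kn|nK] := leqP K n; last first.
    by have [T [? ? ?]] := bdd_banach (bS n); exists T; split.
  exists [set 0]; split=> //; first by move=> _ [f Sf <-]; apply: hK.
    exact: bdd_set1.
  2: by move=> _ x.
  apply: disk_banach => //.
  - by move=> a b _ _ -> -> _; rewrite !scaler0 addr0.
  - by move=> x /(_ 1 ltr01); rewrite scale_real1.
  - move=> x /(_ (1 / 2)) h; have : (1 / 2 : R)%:C%C *: x = 0 by apply: h; lra.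
    move/(congr1 (fun y => 2%:C%C *: y)); rewrite scaler0 scale_realA.
    by have -> : 2 * (1 / 2) = 1 :> R; [field|rewrite scale_real1].
  - move=> t t0; exists (fun=> 0) => // n'.
    by rewrite t0 scaler0 addr0.
pose T n := sval (cid (ex_T n)).
have hT n : [/\ [set val f n | f in S] `<=` T n, bdd (T n),
    banach_disk (T n) & (K <= n)%N -> T n `<=` [set 0]] by apply: svalP (cid (ex_T n)).
exists [set f | forall n, T n (val f n)]; split.
- by move=> f Sf n; have [ST _ _ _] := hT n; apply: ST; exists f.
- split; last first.
    by move=> n; have [_ bT _ _] := hT n; apply: bdd_sub bT => _ [f Tf <-]; apply: Tf.
  exists K => f Tf n Kn; have [_ _ _ T0] := hT n; exact: T0 Kn _ (Tf n).
apply: (@banach_disk_preimage _ E nat V (fun n f => val f n) T) => //.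
- by move=> f f0; apply: val_inj; apply: dprodP.
- by move=> n; have [] := hT n.
- move=> t l _ Tl _.
  have fl m : finite_support (fun n => l n m).
    by exists K => n Kn; have [_ _ _ T0] := hT n; apply: T0 Kn _ (Tl n m).
  by exists (fun m => sub_mk _ (fl m)).
Qed.

End DirectSum.

Section HomSpace.
Context {R : realType} (U V : bornSpace R).

Lemma subspace_bounded_linear :
  subspace [set f : dprod (fun _ : U => V) | bounded_linear (f : U -> V)].
Proof.
split=> [|c f g bf bg]; first exact: bounded_linear_cst0.
apply: (bounded_linear_add (f := fun x => c *: f x)) bg; split=> [k x y|S bS].
  by rewrite bf.1 scalerDr !scalerA [c * k]mulrC.
apply: bdd_sub (bdd_scale (normc c) (bf.2 _ bS)) => _ [x Sx <-].
by exists c => /=; rewrite ?lexx //; exists (f x) => //; exists x.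
Qed.

Local Notation E := (sub_lmod subspace_bounded_linear).
Definition hom_val (f : E) : U -> V := sub_val f.

Lemma hom_valP f : bounded_linear (hom_val f).
Proof. exact: sub_valP f. Qed.

Program Definition homSpace : bornSpace R :=
  @BornSpace R E [set F | equibounded (hom_val @` F)] _ _ _ _ _ _.
Next Obligation.
move=> f S bS; apply: bdd_sub ((sub_valP f).2 _ bS) => _ [_ [_ -> <-] [x Sx <-]].
by exists x.
Qed.
Next Obligation.
move=> F G FG bG S bS; apply: bdd_sub (bG _ bS) => _ [_ [f Ff <-] [x Sx <-]].
by exists (hom_val f); [exists f => //; apply: FG|exists x].
Qed.
Next Obligation.
move=> F G bF bG S bS; apply: bdd_sub (bdd_setU (bF _ bS) (bG _ bS)).
move=> _ [_ [f [Ff|Gf] <-] [x Sx <-]]; [left|right].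
  by exists (hom_val f); [exists f|exists x].
by exists (hom_val f); [exists f|exists x].
Qed.
Next Obligation.
move=> F G bF bG S bS; apply: bdd_sub (bdd_add (bF _ bS) (bG _ bS)).
move=> _ [_ [_ [f Ff [g Gg <-]] <-] [x Sx <-]].
exists (hom_val f x); first by exists (hom_val f); [exists f|exists x].
by exists (hom_val g x) => //; exists (hom_val g); [exists g|exists x].
Qed.
Next Obligation.
move=> r F bF S bS; apply: bdd_sub (bdd_scale r (bF _ bS)).
move=> _ [_ [_ [c cr [f Ff <-]] <-] [x Sx <-]].
exists c => //; exists (hom_val f x) => //.
by exists (hom_val f); [exists f|exists x].
Qed.
Next Obligation.
move=> F bF; pose I := {S : set U | bdd S}.
pose T (S : I) := sval (cid (bdd_banach (bF _ (svalP S)))).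
have hT (S : I) : [/\ [set f x | f in hom_val @` F & x in sval S] `<=` T S,
    bdd (T S) & banach_disk (T S)].
  exact: svalP (cid (bdd_banach (bF _ (svalP S)))).
(* One condition for each point of each bounded set: the value at a point is constrained by the
   disks of all bounded sets containing it. *)
pose J := {p : I * U | sval p.1 p.2}.
pose D := [set f : E | forall j : J, T (sval j).1 (hom_val f (sval j).2)].
exists D; split.
- move=> f Ff [[S x] Sx]; have [FT _ _] := hT S; apply: FT.
  by exists (hom_val f); [exists f|exists x].
- move=> S bS; have [_ bT _] := hT (exist _ S bS).
  apply: bdd_sub bT => _ [_ [f Df <-] [x Sx <-]].
  exact: (Df (exist _ (exist _ S bS, x) Sx)).
apply: (@banach_disk_preimage _ E J (fun=> V) (fun j f => hom_val f (sval j).2)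
  (fun j => T (sval j).1)) => //.
- move=> f f0; apply: val_inj; apply: dprodP => x.
  exact: (f0 (exist _ (exist _ [set x] (bdd_set1 x), x) erefl)).
- by move=> [[S x] Sx]; have [] := hT S.
- move=> t l Tt Tl lE.
  have bl j : bdd (range (l j)).
    by case: (hT (sval j).1) => _ bT _; apply: bdd_sub bT => _ [n _ <-].
  (* Singletons define the limit pointwise. By uniqueness of bounded solutions it agrees with the
     limit found in the disk of any bounded set through the point ([gE]), so [g n] is bounded; its
     linearity follows from uniqueness as well. *)
  pose pt x : J := exist _ (exist _ [set x] (bdd_set1 x) : I, x) erefl.
  pose g n x := l (pt x) n.
  have gE j n : g n (sval j).2 = l j n.
    exact: (geometric_sum_unique (q := 4) _ (bl _) (bl _) (lE (pt _)) (lE j)).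
  have bg n : bounded_linear (g n).
    split=> [c x y|S bS].
      move: n; apply: (geometric_sum_unique (q := 4) _ (bl _) _ (lE (pt _))) => //.
        by apply: bdd_add_fun (bl _); apply: bdd_scale_fun (bl _).
      move=> n /=; rewrite scalerDr scalerA mulrC -scalerA.
      rewrite [4 *: l (pt x) n](lE (pt x)) [4 *: l (pt y) n](lE (pt y)) scalerDr.
      by rewrite /= (hom_valP (t n)).1 addrACA.
    have [_ bT _] := hT (exist _ S bS); apply: bdd_sub bT => _ [x Sx <-].
    pose j : J := exist _ (exist _ S bS : I, x) Sx.
    by rewrite (gE j); apply: (Tl j).
  exists (fun n => sub_mk _ (bg n)) => j n; exact: gE.
Qed.

End HomSpace.

(** * Completed tensor products *)

Section QuotLmod.
Local Open Scope quotient_scope.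
Context {R : realType} {E : lmodType R[i]} {K : set E}.
Variable sK : subspace K.

Definition quot_eq (x y : E) : bool := `[< K (x - y) >].

Fact quot_eq_refl : reflexive quot_eq.
Proof. by move=> x; apply/asboolP; rewrite subrr; apply: sK.1. Qed.

Fact quot_eq_sym : symmetric quot_eq.
Proof.
move=> x y; apply/asboolP/asboolP => Kxy; rewrite -opprB -[- _]add0r.
  exact: subspaceB sK.1 Kxy.
exact: subspaceB sK.1 Kxy.
Qed.

Fact quot_eq_trans : transitive quot_eq.
Proof.
move=> y x z /asboolP Kxy /asboolP Kyz; apply/asboolP.
by have := sK.2 1 _ _ Kxy Kyz; rewrite scale1r addrA subrK.
Qed.

Definition quot_equiv := EquivRel quot_eq quot_eq_refl quot_eq_sym quot_eq_trans.

Definition quot_lmod : Type := {eq_quot quot_equiv}.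

HB.instance Definition _ := Choice.copy quot_lmod {eq_quot quot_equiv}.

Definition quot_proj (x : E) : quot_lmod := \pi_({eq_quot quot_equiv}) x.

Lemma quot_projP x y : quot_proj x = quot_proj y <-> K (x - y).
Proof. by split=> [/eqmodP/asboolP|Kxy]; [|apply/eqmodP/asboolP]. Qed.

Lemma quot_projS (q : quot_lmod) : exists x, q = quot_proj x.
Proof. by exists (repr q); rewrite /quot_proj reprK. Qed.

Let rep (q : quot_lmod) : E := repr q.

Let repK x : K (rep (quot_proj x) - x).
Proof. by apply/quot_projP; rewrite /quot_proj reprK. Qed.

Let add (p q : quot_lmod) : quot_lmod := quot_proj (rep p + rep q).
Let opp (p : quot_lmod) : quot_lmod := quot_proj (- rep p).
Let scale (c : R[i]) (p : quot_lmod) : quot_lmod := quot_proj (c *: rep p).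

Let addE x y : add (quot_proj x) (quot_proj y) = quot_proj (x + y).
Proof.
apply/quot_projP; rewrite opprD addrACA.
by have := sK.2 1 _ _ (repK x) (repK y); rewrite scale1r.
Qed.

Let oppE x : opp (quot_proj x) = quot_proj (- x).
Proof.
apply/quot_projP; rewrite -opprD -[- _]add0r.
exact: subspaceB sK.1 (repK x).
Qed.

Let scaleE c x : scale c (quot_proj x) = quot_proj (c *: x).
Proof.
apply/quot_projP; rewrite -scalerBr.
by have := sK.2 c _ _ (repK x) sK.1; rewrite addr0.
Qed.

Fact quot_addA : associative add.
Proof.
move=> p q r; have [[x ->] [y ->] [z ->]] := And3 (quot_projS p) (quot_projS q) (quot_projS r).
by rewrite !addE addrA.
Qed.
Fact quot_addC : commutative add.
Proof. by move=> p q; rewrite /add addrC. Qed.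
Fact quot_add0 : left_id (quot_proj 0) add.
Proof. by move=> p; have [x ->] := quot_projS p; rewrite addE add0r. Qed.
Fact quot_addN : left_inverse (quot_proj 0) opp add.
Proof. by move=> p; have [x ->] := quot_projS p; rewrite oppE addE addNr. Qed.

HB.instance Definition _ := GRing.isZmodule.Build quot_lmod
  quot_addA quot_addC quot_add0 quot_addN.

Fact quot_scaleA a b p : scale a (scale b p) = scale (a * b) p.
Proof. by have [x ->] := quot_projS p; rewrite !scaleE scalerA. Qed.
Fact quot_scale1 : left_id 1 scale.
Proof. by move=> p; have [x ->] := quot_projS p; rewrite scaleE scale1r. Qed.
Fact quot_scaleDr : right_distributive scale +%R.
Proof.
move=> c p q; have [x ->] := quot_projS p; have [y ->] := quot_projS q.
by rewrite [quot_proj x + _]addE !scaleE [RHS]addE scalerDr.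
Qed.
Fact quot_scaleDl p : {morph scale^~ p : a b / a + b}.
Proof.
move=> a b; have [x ->] := quot_projS p.
by rewrite !scaleE [RHS]addE scalerDl.
Qed.

HB.instance Definition _ := GRing.Zmodule_isLmodule.Build R[i] quot_lmod
  quot_scaleA quot_scale1 quot_scaleDr quot_scaleDl.

Lemma quot_proj_linear : linear quot_proj.
Proof. by move=> c x y; rewrite -[RHS]/(add (scale c _) _) scaleE addE. Qed.

Lemma quot_proj0 x : quot_proj x = 0 <-> K x.
Proof. by rewrite -[0]/(quot_proj 0) quot_projP subr0. Qed.

End QuotLmod.

Section FreeLmod.
Context {R : realType} {X : choiceType} {M : lmodType R[i]}.

Lemma freeg_basisE (k : R[i]) (x : X) : << k *g x >> = k *: << x >>.
Proof. by apply/eqP/freeg_eqP => y; rewrite coeffZ !coeffU mul1r. Qed.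

HB.instance Definition _ (f : X -> M) :=
  GRing.isZmodMorphism.Build {freeg X / R[i]} M (fglift f) (lift_is_additive f).

Lemma fglift_linear (f : X -> M) : linear (fglift f).
Proof.
move=> c D D'; rewrite raddfD /=; congr (_ + _).
rewrite -[in LHS](freeg_sumE D) -[in RHS](freeg_sumE D) scaler_sumr !raddf_sum.
apply: eq_bigr => x _ /=; rewrite freeg_basisE scalerA -!freeg_basisE.
by rewrite !liftU scalerA.
Qed.

Lemma freeg_linear_eq (f g : {freeg X / R[i]} -> M) : linear f -> linear g ->
  (forall x, f << x >> = g << x >>) -> f =1 g.
Proof.
move=> lf lg fg D; rewrite -(freeg_sumE D).
elim: (dom D) => [|x s IHs]; first by rewrite !big_nil (lin0 lf) (lin0 lg).
by rewrite !big_cons freeg_basisE lf lg fg IHs.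
Qed.

End FreeLmod.

(* [geom_value t] is the sum of [2 ^- k.+1 *: t k]; it is [0] by convention when
   [t] is unbounded. *)
Section GeomValue.
Context {R : realType}.
Implicit Types Z : bornSpace R.

Lemma bdd_geometric_sum Z (t : nat -> Z) : bdd (range t) ->
  exists rho, bdd (range rho) /\ geometric_sum 2 t rho.
Proof.
move=> /bdd_banach[T [tT bT dT]].
have [//|n|rho Tr rE] := @banach_geometric_sum _ _ _ dT 2 t.
  by apply: tT; exists n.
by exists rho; split=> //; apply: bdd_sub bT => _ [n _ <-].
Qed.

Definition geom_value Z (t : nat -> Z) : Z :=
  if pselect (bdd (range t)) is left bt then
    sval (cid (bdd_geometric_sum bt)) 0%N else 0.

Lemma geom_valueE Z (t rho : nat -> Z) : bdd (range t) -> bdd (range rho) ->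
  geometric_sum 2 t rho -> geom_value t = rho 0%N.
Proof.
move=> bt br rE; rewrite /geom_value; case: pselect => // bt'.
case: cid => sigma [bs sE] /=.
exact: (geometric_sum_unique (q := 2) _ bs br sE rE).
Qed.

Lemma geom_value_disk Z (T : set Z) (t : nat -> Z) : bdd T -> banach_disk T ->
  (forall n, T (t n)) -> T (geom_value t).
Proof.
move=> bT dT tT; have [//|//|rho Tr rE] := @banach_geometric_sum _ _ _ dT 2 t.
rewrite (geom_valueE _ _ rE) //; apply: bdd_sub bT => _ [n _ <-] //.
Qed.

Lemma geom_value_linear Z (c : R[i]) (t t' : nat -> Z) :
  bdd (range t) -> bdd (range t') ->
  geom_value (fun n => c *: t n + t' n) = c *: geom_value t + geom_value t'.
Proof.
move=> bt bt'; have [rho [br rE]] := bdd_geometric_sum bt.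
have [rho' [br' rE']] := bdd_geometric_sum bt'.
rewrite (geom_valueE bt br rE) (geom_valueE bt' br' rE').
apply: (@geom_valueE Z _ (fun n => c *: rho n + rho' n)).
- by apply: bdd_add_fun => //; apply: bdd_scale_fun.
- by apply: bdd_add_fun => //; apply: bdd_scale_fun.
- by move=> n; rewrite scalerDr scalerA mulrC -scalerA rE rE' scalerDr addrACA.
Qed.

(** A bounded linear map carries the bounded solution of the recursion to a bounded solution, and
    there is only one. *)
Lemma geom_value_map Z (W : bornSpace R) (f : Z -> W) (t : nat -> Z) :
  bounded_linear f -> bdd (range t) -> f (geom_value t) = geom_value (f \o t).
Proof.
move=> [lf bf] bt; have [rho [br rE]] := bdd_geometric_sum bt.
rewrite (geom_valueE bt br rE) (@geom_valueE _ _ (f \o rho)) //.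
- by have := bf _ bt; rewrite image_comp.
- by have := bf _ br; rewrite image_comp.
- move=> n /=; rewrite -(linD lf) -rE.
  by have := lf 2%:R (rho n) 0; rewrite (lin0 lf) !addr0.
Qed.

Lemma geom_value_rec Z (t : nat -> Z) : bdd (range t) ->
  2%:R *: geom_value t = t 0%N + geom_value (fun n => t n.+1).
Proof.
move=> bt; have [rho [br rE]] := bdd_geometric_sum bt.
rewrite (geom_valueE bt br rE) rE; congr (_ + _).
rewrite (@geom_valueE _ _ (fun n => rho n.+1)).
- by [].
- by apply: bdd_sub bt => _ [n _ <-]; exists n.+1.
- by apply: bdd_sub br => _ [n _ <-]; exists n.+1.
- by move=> n; apply: rE.
Qed.

(** The weights [2 ^- k.+1] add up to 1. This is why constant sequences can stand for the algebraic
    tensors in [tensor_cst]. *)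
Lemma geom_value_cst Z (z : Z) : geom_value (fun=> z) = z.
Proof.
have bz : bdd (range (fun _ : nat => z)).
  by apply: bdd_sub (bdd_set1 z) => _ [n _ <-].
rewrite (@geom_valueE _ _ (fun=> z)) // => n.
by rewrite scaler_nat mulr2n.
Qed.

End GeomValue.

(** * Construction of the completed tensor product *)

Section TensorProduct.
Context {R : realType} (U V : bornSpace R).
Implicit Types Z : bornSpace R.

Let F : lmodType R[i] := {freeg (U * V)%type / R[i]}.

Definition tensor_lift (Z : bornSpace R) (b : U -> V -> Z) : F -> Z :=
  fglift (fun p : (U * V)%type => b p.1 p.2).

Lemma tensor_lift_linear Z (b : U -> V -> Z) : linear (tensor_lift b).
Proof. exact: fglift_linear. Qed.

Lemma tensor_liftU Z (b : U -> V -> Z) u v : tensor_lift b << (u, v) >> = b u v.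
Proof. by rewrite /tensor_lift liftU scale1r. Qed.

(** The largest bornology for which every lift is bounded, so that the universal property is built
    in. *)
Definition tensor_bdd (P : set F) : Prop :=
  forall (Z : bornSpace R) (b : U -> V -> Z), bounded_bilinear b ->
    bdd (tensor_lift b @` P).

Lemma tensor_bdd_sub P Q : P `<=` Q -> tensor_bdd Q -> tensor_bdd P.
Proof. by move=> PQ bQ Z b bb; apply: bdd_sub (bQ _ _ bb); apply: image_subset. Qed.

Lemma tensor_bdd1 f : tensor_bdd [set f].
Proof. by move=> Z b bb; rewrite image_set1; apply: bdd_set1. Qed.

Lemma tensor_bddU P Q : tensor_bdd P -> tensor_bdd Q -> tensor_bdd (P `|` Q).
Proof.
by move=> bP bQ Z b bb; rewrite image_setU; apply: bdd_setU; [apply: bP|apply: bQ].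
Qed.

Lemma tensor_bdd_add P Q : tensor_bdd P -> tensor_bdd Q ->
  tensor_bdd [set x + y | x in P & y in Q].
Proof.
move=> bP bQ Z b bb.
apply: bdd_sub (bdd_add (bP _ _ bb) (bQ _ _ bb)) => _ [_ [x Px [y Qy <-]] <-].
exists (tensor_lift b x); first by exists x.
by exists (tensor_lift b y); [exists y|rewrite (linD (tensor_lift_linear b))].
Qed.

Lemma tensor_bdd_scale (r : R) P : tensor_bdd P ->
  tensor_bdd [set c *: x | c in [set c : R[i] | normc c <= r] & x in P].
Proof.
move=> bP Z b bb.
apply: bdd_sub (bdd_scale r (bP _ _ bb)) => _ [_ [c cr [x Px <-]] <-].
exists c => //; exists (tensor_lift b x); first by exists x.
have := tensor_lift_linear b c x 0.
by rewrite (lin0 (tensor_lift_linear b)) !addr0.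
Qed.

Definition disk_hull (P : set F) : set F :=
  [set x | forall D, absolutely_convex D -> D 0 -> P `<=` D -> D x].

Lemma disk_hull_convex P : absolutely_convex (disk_hull P).
Proof.
by move=> a b x y hx hy ab D cD D0 PD; apply: (cD) => //; [apply: hx|apply: hy].
Qed.

(** The preimage of a Banach disk under a lift is itself a disk, so it contains the hull once it
    contains [P]. *)
Lemma tensor_bdd_hull P : tensor_bdd P -> tensor_bdd (disk_hull P).
Proof.
move=> bP Z b bb; have [T [PT bT dT]] := bdd_banach (bP _ _ bb).
apply: bdd_sub bT => _ [x hx <-].
have ll := tensor_lift_linear b.
apply: (hx [set x | T (tensor_lift b x)]) => [a c y z Ty Tz ac| |y Py] /=.
- rewrite ll; have := ll c z 0; rewrite (lin0 ll) !addr0 => ->.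
  exact: dT.1.
- by rewrite (lin0 ll); apply: banach_disk0 dT.
- by apply: PT; exists y.
Qed.

Let bounded_seq : set (dprod (fun _ : nat => F)) := [set p | tensor_bdd (range p)].

Lemma subspace_bounded_seq : subspace bounded_seq.
Proof.
split=> [|c p q bp bq].
  by apply: tensor_bdd_sub (tensor_bdd1 0) => _ [n _ <-].
apply: tensor_bdd_sub (tensor_bdd_add (tensor_bdd_scale (normc c) bp) bq).
move=> _ [n _ <-]; exists (c *: p n); last by exists (q n) => //; exists n.
by exists c => /=; rewrite ?lexx //; exists (p n) => //; exists n.
Qed.

Local Notation E := (sub_lmod subspace_bounded_seq).

Definition seq_val (p : E) : nat -> F := sub_val p.

Lemma seq_val_bdd (p : E) : tensor_bdd (range (seq_val p)).
Proof. exact: sub_valP p. Qed.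

Lemma seq_val_lift_bdd (p : E) Z (b : U -> V -> Z) : bounded_bilinear b ->
  bdd (range (tensor_lift b \o seq_val p)).
Proof. by move=> bb; have := seq_val_bdd p bb; rewrite image_comp. Qed.

Definition tensor_eval Z (b : U -> V -> Z) (p : E) : Z :=
  geom_value (tensor_lift b \o seq_val p).

Lemma tensor_eval_linear Z (b : U -> V -> Z) : bounded_bilinear b ->
  linear (tensor_eval b).
Proof.
move=> bb c p q; rewrite /tensor_eval -geom_value_linear; try exact: seq_val_lift_bdd.
by congr geom_value; apply: funext => n; apply: tensor_lift_linear.
Qed.

Let null : set E :=
  [set p | forall (Z : bornSpace R) (b : U -> V -> Z), bounded_bilinear b -> tensor_eval b p = 0].

Lemma subspace_null : subspace null.
Proof.
split=> [Z b bb|c p q np nq Z b bb]; first exact: lin0 (tensor_eval_linear bb).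
by rewrite (tensor_eval_linear bb) np // nq // scaler0 addr0.
Qed.

Local Notation W := (quot_lmod subspace_null).
Local Notation proj := (quot_proj subspace_null).

Let projP (p q : E) :
  (forall (Z : bornSpace R) (b : U -> V -> Z), bounded_bilinear b ->
     tensor_eval b p = tensor_eval b q) -> proj p = proj q.
Proof.
move=> pq; apply/quot_projP => Z b bb; have ll := tensor_eval_linear bb.
by rewrite (linD ll) (linN ll) pq // subrr.
Qed.

Let projD p q : proj (p + q) = proj p + proj q.
Proof. exact: linD (quot_proj_linear _) _ _. Qed.

Let projZ c p : proj (c *: p) = c *: proj p.
Proof.
have ll := quot_proj_linear subspace_null.
by have := ll c p 0; rewrite (lin0 ll) !addr0.
Qed.

Definition tensor_ball (P : set F) : set W :=
  [set proj p | p in [set p | forall n, P (seq_val p n)]].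

Lemma tensor_ball_convex P : absolutely_convex P -> absolutely_convex (tensor_ball P).
Proof.
move=> cP a b _ _ [p Pp <-] [q Pq <-] ab; exists (a *: p + b *: q).
  by move=> n; apply: cP.
by rewrite projD !projZ.
Qed.

(** The quotient kills exactly what all bilinear maps miss, so separation may be tested after each
    evaluation, where the values lie in a Banach disk. *)
Lemma tensor_ball_separated P : tensor_bdd P -> disk_separated (tensor_ball P).
Proof.
move=> bP x hx; have [p xE] := quot_projS x; rewrite xE in hx *.
apply/quot_proj0 => Z b bb; have [T [PT bT dT]] := bdd_banach (bP _ _ bb).
have ll := tensor_eval_linear bb.
apply: (banach_disk_separated dT) => r r0.
have [q Pq] := hx r r0; rewrite -projZ => /quot_projP/(_ _ _ bb).
rewrite (linD ll) (linN ll) => /eqP; rewrite subr_eq0 => /eqP qE.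
have := ll (r%:C)%C p 0; rewrite (lin0 ll) !addr0 => <-; rewrite -qE.
by apply: geom_value_disk => // n; apply: PT; exists (seq_val q n).
Qed.

(* Cauchy product of the geometric series of ratios 1/4 and 1/2. *)
Fixpoint cauchy_seq (p : nat -> nat -> F) (j n : nat) : F :=
  if j is j'.+1 then
    4%:R^-1 *: p n j'.+1 + 2%:R^-1 *: cauchy_seq p j' n.+1
  else 4%:R^-1 *: p n 0%N.

(** Writing [t n] as the series of [p n], the sum sought is a double series in [p (n + m) k] with
    coefficients [4 ^- m.+1] times [2 ^- k.+1]. Collected along [j = m + k], the coefficient of
    [2 ^- j.+1] is [c j n], the sum of [2 ^- m.+2 *: p (n + m) (j - m)] over [m <= j]. It stays in
    [P] because its recursion has coefficients 1/4 and 1/2. *)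
Lemma tensor_ball_complete P (t : nat -> W) : tensor_bdd P ->
  absolutely_convex P -> (forall n, tensor_ball P (t n)) ->
  exists2 rho, (forall n, tensor_ball P (rho n)) & geometric_sum 4 t rho.
Proof.
move=> bP cP Bt.
have /choice[p hp] : forall n, exists p : E, (forall k, P (seq_val p k)) /\ proj p = t n.
  by move=> n; have [p Pp pE] := Bt n; exists p.
pose c j n := cauchy_seq (fun n => seq_val (p n)) j n.
have Pc j n : P (c j n).
  have P1 k : P (seq_val (p n) k) by have [] := hp n.
  elim: j n P1 => [|j IHj] n P1; rewrite /c /=.
    have := cP 4%:R^-1 0 _ _ (P1 0%N) (P1 0%N); rewrite scale0r addr0; apply.
    by rewrite normcV normc_nat normc0; lra.
  apply: cP => //; first by apply: IHj => k; have [] := hp n.+1.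
  by rewrite !normcV !normc_nat; lra.
have bc n : bounded_seq (fun j => c j n).
  by apply: tensor_bdd_sub bP => _ [j _ <-].
pose r n : E := sub_mk subspace_bounded_seq (bc n).
exists (fun n => proj (r n)); first by move=> n; exists (r n) => // j; apply: Pc.
move=> n; have [_ <-] := hp n; rewrite -projZ -projD; apply: projP => Z b bb.
have ll := tensor_lift_linear b; have le := tensor_eval_linear bb.
have lZ k x : tensor_lift b (k *: x) = k *: tensor_lift b x.
  by have := ll k x 0; rewrite (lin0 ll) !addr0.
have eZ k x : tensor_eval b (k *: x) = k *: tensor_eval b x.
  by have := le k x 0; rewrite (lin0 le) !addr0.
have br m := seq_val_lift_bdd (r m) bb.
have bp m := seq_val_lift_bdd (p m) bb.
have bS (s : nat -> Z) : bdd (range s) -> bdd (range (fun j => s j.+1)).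
  by apply: bdd_sub => _ [j _ <-]; exists j.+1.
(* One factor 2 of the ratio 4 is absorbed by [geom_value_rec]; the other remains as 1/2 on the
   right and is cleared at the end. *)
have H : 2%:R *: tensor_eval b (r n) =
    2%:R^-1 *: (tensor_eval b (p n) + tensor_eval b (r n.+1)).
  have pE : tensor_eval b (p n) = 2%:R^-1 *: (tensor_lift b (seq_val (p n) 0%N) +
      geom_value (fun j => tensor_lift b (seq_val (p n) j.+1))).
    rewrite -(geom_value_rec (bp n)) scalerA mulVf ?pnatr_eq0 // scale1r //.
  rewrite pE {1}/tensor_eval (geom_value_rec (br n)) /=.
  have -> : (fun j => tensor_lift b (c j.+1 n)) =
      (fun j => 4%:R^-1 *: tensor_lift b (seq_val (p n) j.+1) +
                2%:R^-1 *: tensor_lift b (c j n.+1)).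
    by apply: funext => j; rewrite [c _ _]/= (linD ll) !lZ.
  have zZ (k : R[i]) (s : nat -> Z) : bdd (range s) ->
      geom_value (fun j => k *: s j) = k *: geom_value s.
    move=> bs; have b0 : bdd (range (fun _ : nat => 0 : Z)).
      by apply: bdd_sub (bdd_set1 0) => _ [j _ <-].
    have := geom_value_linear k bs b0; rewrite geom_value_cst addr0 => <-.
    by congr geom_value; apply: funext => j; rewrite addr0.
  rewrite geom_value_linear; [|exact: bS (bp n)|exact: bdd_scale_fun (br n.+1)].
  rewrite zZ; last exact: br n.+1.
  have q4 : 4%:R^-1 = 2%:R^-1 * 2%:R^-1 :> R[i] by rewrite -invfM -natrM.
  by rewrite [c 0%N n]/= lZ q4 !scalerDr !scalerA addrA.
rewrite (linD le) eZ.
have -> : (4 : R[i]) = 2 * 2 by rewrite -natrM.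
by rewrite -scalerA H scalerA mulfV ?pnatr_eq0 // scale1r.
Qed.

Program Definition tensorSpace : bornSpace R :=
  @BornSpace R W [set X | exists2 P, tensor_bdd P & X `<=` tensor_ball P]
    _ _ _ _ _ _.
Next Obligation.
move=> x; have [p ->] := quot_projS x; exists (range (seq_val p)).
  exact: seq_val_bdd.
by move=> _ ->; exists p => // n; exists n.
Qed.
Next Obligation. by move=> X Y XY [P bP YP]; exists P => // x /XY/YP. Qed.
Next Obligation.
move=> X Y [P bP XP] [Q bQ YQ]; exists (P `|` Q); first exact: tensor_bddU.
move=> x [/XP|/YQ] [p hp <-]; exists p => // n; [left|right]; exact: hp.
Qed.
Next Obligation.
move=> X Y [P bP XP] [Q bQ YQ]; exists [set x + y | x in P & y in Q].
  exact: tensor_bdd_add.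
move=> _ [x /XP[p hp <-] [y /YQ[q hq <-] <-]]; exists (p + q); last exact: projD.
by move=> n; exists (seq_val p n) => //; exists (seq_val q n).
Qed.
Next Obligation.
move=> r X [P bP XP].
exists [set c *: x | c in [set c : R[i] | normc c <= r] & x in P].
  exact: tensor_bdd_scale.
move=> _ [c cr [x /XP[p hp <-] <-]]; exists (c *: p); last exact: projZ.
by move=> n; exists c => //; exists (seq_val p n).
Qed.
Next Obligation.
move=> X [P0 bP0 XP]; pose P := disk_hull P0.
have bP : tensor_bdd P by apply: tensor_bdd_hull.
have cP : absolutely_convex P by apply: disk_hull_convex.
have cB := tensor_ball_convex cP.
have B0 : tensor_ball P 0.
  exists 0; last exact: lin0 (quot_proj_linear _).
  by move=> n D _ D0.
(* A boundary point may have no representing sequence in [P], so the ball is replaced by its radial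
   closure. This is still bounded, being contained in twice the ball. *)
exists (disk_closure (tensor_ball P)); split.
- move=> x /XP[p hp <-] s s0 s1; apply: disk_scale => //.
    by rewrite normc_real ger0_norm ltW.
  by exists p => // n D _ _; apply.
- exists [set c *: x | c in [set c : R[i] | normc c <= 2] & x in P].
    exact: tensor_bdd_scale.
  move=> x hx; have [||p hp pE] := hx (1 / 2); [lra|lra|].
  exists (2%:R *: p).
    move=> n; exists 2%:R; first by rewrite /mkset normc_nat.
    by exists (seq_val p n).
  rewrite projZ pE scale_natE scale_realA.
  by have -> : 2 * (1 / 2) = 1 :> R; [field|rewrite scale_real1].
- apply: disk_closure_banach => //; first exact: tensor_ball_separated.
  by move=> t; apply: tensor_ball_complete.
Qed.

Lemma bounded_seq_cst (f : F) : bounded_seq (fun=> f).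
Proof. by apply: tensor_bdd_sub (tensor_bdd1 f) => _ [n _ <-]. Qed.

Definition tensor_cst (f : F) : tensorSpace :=
  proj (sub_mk subspace_bounded_seq (bounded_seq_cst f)).

Lemma tensor_cst_linear : linear tensor_cst.
Proof.
move=> c f g; rewrite /tensor_cst -projZ -projD.
by congr proj; apply: val_inj; apply: dprodP.
Qed.

Lemma tensor_eval_cst Z (b : U -> V -> Z) f :
  tensor_eval b (sub_mk subspace_bounded_seq (bounded_seq_cst f)) = tensor_lift b f.
Proof. exact: geom_value_cst (tensor_lift b f). Qed.

Lemma tensor_cst_eq f g :
  (forall Z (b : U -> V -> Z), bounded_bilinear b ->
     tensor_lift b f = tensor_lift b g) -> tensor_cst f = tensor_cst g.
Proof. by move=> fg; apply: projP => Z b bb; rewrite !tensor_eval_cst fg. Qed.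

Definition tensor (u : U) (v : V) : tensorSpace := tensor_cst << (u, v) >>.

Lemma tensor_bilinear : bounded_bilinear tensor.
Proof.
split=> [v c u u'|u c v v'|S T bS bT].
- rewrite /tensor -tensor_cst_linear; apply: tensor_cst_eq => Z b bb.
  by rewrite tensor_lift_linear !tensor_liftU; case: bb => /(_ v) ->.
- rewrite /tensor -tensor_cst_linear; apply: tensor_cst_eq => Z b bb.
  by rewrite tensor_lift_linear !tensor_liftU; case: bb => _ /(_ u) ->.
exists [set << (u, v) >> | u in S & v in T].
  move=> Z b bb; case: (bb) => _ _ /(_ _ _ bS bT); apply: bdd_sub.
  move=> _ [_ [u Su [v Tv <-]] <-]; rewrite tensor_liftU.
  by exists u => //; exists v.
move=> _ [u Su [v Tv <-]]; exists (sub_mk subspace_bounded_seq (bounded_seq_cst << (u, v) >>)) => //.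
by move=> n; exists u => //; exists v.
Qed.

(** Every element is the geometric series of the classes of its terms, the truncated sequences [s n]
    being the remainders. Bounded linear maps commute with such series, so they are determined by
    their values on the algebraic tensors. *)
Lemma tensor_geom_value (Z : bornSpace R) (h : tensorSpace -> Z) (p : E) :
  bounded_linear h -> h (proj p) = geom_value (h \o tensor_cst \o seq_val p).
Proof.
move=> bh.
have bs n : bounded_seq (fun k => seq_val p (n + k)).
  by apply: tensor_bdd_sub (seq_val_bdd p) => _ [k _ <-]; exists (n + k)%N.
pose s n : tensorSpace := proj (sub_mk subspace_bounded_seq (bs n)).
have bt : bdd (range (tensor_cst \o seq_val p)).
  exists (range (seq_val p)); first exact: seq_val_bdd.
  move=> _ [n _ <-].
  by exists (sub_mk subspace_bounded_seq (bounded_seq_cst (seq_val p n))) => // k; exists n.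
have sE : proj p = s 0%N by congr proj; apply: val_inj; apply: dprodP.
rewrite -(geom_value_map bh bt) sE (@geom_valueE _ _ _ s) //.
  exists (range (seq_val p)); first exact: seq_val_bdd.
  move=> _ [n _ <-]; exists (sub_mk subspace_bounded_seq (bs n)) => //.
move=> n; rewrite -projZ -projD; apply: projP => Z' b bb.
have le := tensor_eval_linear bb.
rewrite (linD le); have := le 2%:R (sub_mk _ (bs n)) 0; rewrite (lin0 le) !addr0 => ->.
rewrite tensor_eval_cst geom_value_rec; last exact: seq_val_lift_bdd.
congr (_ + _); first by rewrite /= /seq_val /= addn0.
by congr geom_value; apply: funext => k; rewrite /= /seq_val /= addSnnS.
Qed.

(** Summing the lifted series is well defined on the quotient, since null sequences have value zero
    under every bilinear map. Uniqueness is [tensor_geom_value]. *)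
Lemma tensorP : is_tensor_product tensor.
Proof.
split=> [|Z b bb]; first exact: tensor_bilinear.
have le := tensor_eval_linear bb.
pose h (x : tensorSpace) : Z := tensor_eval b (sval (cid (quot_projS x))).
have hE p : h (proj p) = tensor_eval b p.
  rewrite /h; case: cid => q /= /esym/quot_projP/(_ _ _ bb).
  by rewrite (linD le) (linN le) => /eqP; rewrite subr_eq0 => /eqP.
exists h; split; last first.
  move=> h' [bh' h'E]; apply: funext => x; have [p ->] := quot_projS x.
  rewrite hE (tensor_geom_value _ bh'); congr geom_value; apply: funext => n /=.
  apply: (freeg_linear_eq (g := h' \o tensor_cst)) => [||[u v]].
  - exact: tensor_lift_linear.
  - by move=> c f g; rewrite /= tensor_cst_linear bh'.1.
  - by rewrite tensor_liftU -h'E.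
split; last first.
  by move=> u v; rewrite hE tensor_eval_cst tensor_liftU.
split=> [c x y|X [P bP XP]].
  have [p ->] := quot_projS x; have [q ->] := quot_projS y.
  by rewrite -projZ -projD !hE le.
have [T [PT bT dT]] := bdd_banach (bP _ _ bb).
apply: bdd_sub (bT) => _ [x /XP[p hp <-] <-]; rewrite hE.
by apply: geom_value_disk => // n; apply: PT; exists (seq_val p n).
Qed.

End TensorProduct.

(** * Modules *)

Section Modules.
Context {R : realType} {A : bornAlg R}.
Implicit Types M N P : bornMod A.

Lemma act_linear_l M (x : M) : linear (fun a : A => act a x).
Proof. by case: (act_bounded M). Qed.

Lemma act_linear_r M (a : A) : linear (@act _ _ M a).
Proof. by case: (act_bounded M). Qed.

Lemma act_bdd M (S : set A) (T : set M) : bdd S -> bdd T ->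
  bdd [set act a x | a in S & x in T].
Proof. by case: (act_bounded M) => _ _; apply. Qed.

Lemma act_hom_bounded M (a : A) : bounded_linear (@act _ _ M a).
Proof.
split; first exact: act_linear_r.
move=> S bS; apply: bdd_sub (act_bdd (bdd_set1 a) bS) => _ [x Sx <-].
by exists a => //; exists x.
Qed.

Lemma homL M N (f : modHom M N) : linear f.
Proof. by case: (hom_bounded f). Qed.

Lemma homB M N (f : modHom M N) x y : f (x - y) = f x - f y.
Proof. by rewrite homD homN. Qed.

Program Definition addHom M N (f g : modHom M N) : modHom M N :=
  @ModHom R A M N (fun x => f x + g x) _ _.
Next Obligation. by move=> *; apply: bounded_linear_add; apply: hom_bounded. Qed.
Next Obligation. by move=> *; rewrite /= !hom_act act_add. Qed.

(** * Closed submodules and products of modules *)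

Section SubMod.
Variables (M : bornMod A) (U : set M).

Record closed_submodule : Prop := {
  csub_subspace : subspace U;
  csub_act : forall a x, U x -> U (act a x);
  csub_closed : series_closed U
}.

Hypothesis cU : closed_submodule.
Let sU := csub_subspace cU.

Program Definition subMod : bornMod A :=
  @BornMod R A (subSpace sU (csub_closed cU))
    (fun a x => sub_mk sU (csub_act cU a (sub_valP x))) _ _ _.
Next Obligation.
split=> [x c a b|a c x y|S T bS bT].
- by apply: val_inj; apply: act_linear_l.
- by apply: val_inj; apply: act_linear_r.
- apply: bdd_sub (act_bdd bS bT) => _ [_ [a Sa [x Tx <-]] <-].
  by exists a => //; exists (sub_val x) => //; exists x.
Qed.
Next Obligation. by move=> a b x; apply: val_inj; apply: actA. Qed.
Next Obligation. by move=> x; apply: val_inj; apply: act1. Qed.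

Definition sub_incl : modHom subMod M :=
  @ModHom R A subMod M (@sub_val _ _ _ sU)
    (bounded_linear_sub_val sU (csub_closed cU)) (fun _ _ => erefl).

Lemma sub_incl_inj : injective sub_incl.
Proof. exact: val_inj. Qed.

Lemma sub_inclP (x : subMod) : U (sub_incl x).
Proof. exact: sub_valP. Qed.

Definition sub_fun (W : Type) (f : W -> M) (Uf : forall x, U (f x)) : W -> subMod :=
  fun x => sub_mk sU (Uf x).

Lemma sub_fun_bounded (W : bornSpace R) (f : W -> M) (Uf : forall x, U (f x)) :
  bounded_linear f -> bounded_linear (sub_fun Uf).
Proof. exact: bounded_linear_sub_mk. Qed.

Program Definition sub_lift N (f : modHom N M) (Uf : forall x, U (f x)) :
    modHom N subMod := @ModHom R A N subMod (sub_fun Uf) _ _.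
Next Obligation. by move=> *; apply: sub_fun_bounded; apply: hom_bounded. Qed.
Next Obligation. by move=> N f Uf a x; apply: val_inj; apply: hom_act. Qed.

End SubMod.

Lemma closed_submodule_kernel M N (f : modHom M N) :
  closed_submodule [set x | f x = 0].
Proof.
split=> [|a x /= fx|]; last exact: series_closed_kernel (hom_bounded f).
  split=> [|c x y /= fx fy] /=; first by rewrite hom0.
  by rewrite homL fx fy scaler0 addr0.
by rewrite hom_act fx act0.
Qed.

Lemma closed_submoduleI M (U U' : set M) :
  closed_submodule U -> closed_submodule U' -> closed_submodule (U `&` U').
Proof.
move=> [sU aU cU] [sU' aU' cU']; split=> [|a x [Ux Ux']|]; last exact: series_closedI.
  split; first by split; [apply: sU.1|apply: sU'.1].
  by move=> c x y [? ?] [? ?]; split; [apply: sU.2|apply: sU'.2].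
by split; [apply: aU|apply: aU'].
Qed.

(** With [p] a condition on the degree, this lets a truncation be cut out uniformly in all degrees,
    without a case distinction in the types. *)
Lemma closed_submodule_imply M (p : Prop) (U : set M) :
  closed_submodule U -> closed_submodule [set x | p -> U x].
Proof.
move=> [sU aU cU]; split=> [|a x Ux /Ux|]; last exact: series_closed_imply.
  split=> [_|c x y Ux Uy hp]; first exact: sU.1.
  by apply: sU.2; [apply: Ux|apply: Uy].
exact: aU.
Qed.

Program Definition dprodMod (I : Type) (M : I -> bornMod A) : bornMod A :=
  @BornMod R A (dprodSpace M) (fun a f => (fun i => act a (f i)) : dprod M) _ _ _.
Next Obligation.
move=> I M; split=> [f c a b|a c f g|S T bS bT i].
- by apply: dprodP => i; apply: act_linear_l.
- by apply: dprodP => i; apply: act_linear_r.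
- apply: bdd_sub (act_bdd bS (bT i)) => _ [_ [a Sa [f Tf <-]] <-].
  by exists a => //; exists (f i) => //; exists f.
Qed.
Next Obligation. by move=> I M a b f; apply: dprodP => i; apply: actA. Qed.
Next Obligation. by move=> I M f; apply: dprodP => i; apply: act1. Qed.

Definition dprod_proj (I : Type) (M : I -> bornMod A) i : modHom (dprodMod M) (M i) :=
  @ModHom R A (dprodMod M) (M i) (fun f => (f : dprod M) i)
    (bounded_linear_proj _ _) (fun _ _ => erefl).

Program Definition dprod_pair (I : Type) (M : I -> bornMod A) N
    (g : forall i, modHom N (M i)) : modHom N (dprodMod M) :=
  @ModHom R A N (dprodMod M) (fun x => (fun i => g i x) : dprod M) _ _.
Next Obligation.
by move=> I M N g; apply: bounded_linear_dprod => i; apply: hom_bounded.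
Qed.
Next Obligation. by move=> I M N g a x; apply: dprodP => i; apply: hom_act. Qed.

Lemma dprod_product (I : Type) (M : I -> bornMod A) :
  is_product (dprod_proj M).
Proof.
move=> N g; exists (dprod_pair g); split=> // h' h'E x.
by apply: dprodP => i; apply: h'E.
Qed.

(** * Countable direct sums of modules *)

Section DirectSumMod.
Variable M : nat -> bornMod A.

Let sF := subspace_finite_support M.

Lemma dsum_mk_subproof (a : A) (f : sub_lmod sF) :
  finite_support (fun n => act a (dsum_val f n)).
Proof. by have [K hK] := sub_valP f; exists K => n /hK fn; rewrite (fn : dsum_val f n = 0) act0. Qed.

Program Definition dsumMod : bornMod A :=
  @BornMod R A (dsumSpace M) (fun a f => sub_mk sF (dsum_mk_subproof a f)) _ _ _.
Next Obligation.
split=> [f c a b|a c f g|S T bS [[K hK] bT]].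
- by apply: val_inj; apply: dprodP => i; apply: act_linear_l.
- by apply: val_inj; apply: dprodP => i; apply: act_linear_r.
split=> [|i].
  by exists K => _ [a Sa [f Tf <-]] n Kn; rewrite /dsum_val /= [sub_val f n]hK // act0.
apply: bdd_sub (act_bdd bS (bT i)) => _ [_ [a Sa [f Tf <-]] <-].
by exists a => //; exists (dsum_val f i) => //; exists f.
Qed.
Next Obligation. by move=> a b f; apply: val_inj; apply: dprodP => i; apply: actA. Qed.
Next Obligation. by move=> f; apply: val_inj; apply: dprodP => i; apply: act1. Qed.

Definition dsum_coord (f : dsumMod) (n : nat) : M n := dsum_val f n.

Lemma dsumP (f g : dsumMod) : (forall n, dsum_coord f n = dsum_coord g n) -> f = g.
Proof. by move=> fg; apply: val_inj; apply: dprodP. Qed.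

Lemma dsum_coord_act a f n : dsum_coord (act a f) n = act a (dsum_coord f n).
Proof. by []. Qed.

Lemma dsum_coordL n : linear (dsum_coord^~ n).
Proof. by []. Qed.

Lemma dsum_coord_bounded n : bounded_linear (dsum_coord^~ n).
Proof. by split=> // S [_ /(_ n)]. Qed.

Lemma dsum_support (f : dsumMod) :
  exists K, forall n, (K <= n)%N -> dsum_coord f n = 0.
Proof. exact: sub_valP f. Qed.

Definition dsum_mk (f : forall n, M n)
  (hf : exists K, forall n, (K <= n)%N -> f n = 0) : dsumMod := sub_mk sF hf.

Lemma dsum_mk_bounded (W : bornSpace R) (f : W -> forall n, M n)
    (hf : forall x, exists K, forall n, (K <= n)%N -> f x n = 0) :
  (forall n, bounded_linear (f^~ n)) ->
  (forall S : set W, bdd S -> exists K, forall x, S x -> forall n, (K <= n)%N -> f x n = 0) ->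
  bounded_linear (fun x => dsum_mk (hf x)).
Proof.
move=> bf hS; split=> [c x y|S bS].
  by apply: val_inj; apply: dprodP => n; apply: (bf n).1.
split=> [|n].
  by have [K hK] := hS _ bS; exists K => _ [x Sx <-] n Kn; apply: hK.
apply: bdd_sub ((bf n).2 _ bS) => _ [_ [x Sx <-] <-].
by exists x.
Qed.

Section Out.
Variables (N : bornMod A) (g : forall n, modHom (M n) N).

Definition dsum_partial (K : nat) (f : dsumMod) : N :=
  \sum_(n < K) g n (dsum_coord f n).

Lemma dsum_partial_eq K L f : (K <= L)%N ->
  (forall n, (K <= n)%N -> dsum_coord f n = 0) -> dsum_partial L f = dsum_partial K f.
Proof.
move=> /subnKC <-; elim: (L - K)%N => [|j IHj] f0; first by rewrite addn0.
by rewrite addnS /dsum_partial big_ord_recr /= f0 ?leq_addr // hom0 addr0; apply: IHj.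
Qed.

Definition dsum_out_fun (f : dsumMod) : N :=
  dsum_partial (sval (cid (dsum_support f))) f.

Lemma dsum_out_funE K f : (forall n, (K <= n)%N -> dsum_coord f n = 0) ->
  dsum_out_fun f = dsum_partial K f.
Proof.
rewrite /dsum_out_fun; case: cid => L f0 /= f0'.
rewrite -(dsum_partial_eq (leq_maxl L K) f0).
by rewrite -(dsum_partial_eq (leq_maxr L K) f0').
Qed.

Lemma dsum_partial_bounded K : bounded_linear (dsum_partial K).
Proof.
elim: K => [|K IHK].
  rewrite (_ : dsum_partial 0 = fun=> 0); first exact: bounded_linear_cst0.
  by apply: funext => f; rewrite /dsum_partial big_ord0.
rewrite (_ : dsum_partial K.+1 = fun f => dsum_partial K f + g K (dsum_coord f K)).
  apply: bounded_linear_add => //.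
  exact: bounded_linear_comp (hom_bounded _) (dsum_coord_bounded K).
by apply: funext => f; rewrite /dsum_partial big_ord_recr.
Qed.

Program Definition dsum_out : modHom dsumMod N :=
  @ModHom R A dsumMod N dsum_out_fun _ _.
Next Obligation.
split=> [c f f'|S bS].
  have [K hK] := dsum_support f; have [L hL] := dsum_support f'.
  have m1 n : (maxn K L <= n)%N -> dsum_coord f n = 0.
    by rewrite geq_max => /andP[/hK].
  have m2 n : (maxn K L <= n)%N -> dsum_coord f' n = 0.
    by rewrite geq_max => /andP[_ /hL].
  rewrite (dsum_out_funE m1) (dsum_out_funE m2) (@dsum_out_funE (maxn K L)).
    exact: (dsum_partial_bounded _).1.
  by move=> n Kn; rewrite dsum_coordL m1 // m2 // scaler0 addr0.
case: (bS) => -[K hK] _; apply: bdd_sub ((dsum_partial_bounded K).2 _ bS).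
by move=> _ [f Sf <-]; exists f => //; rewrite (dsum_out_funE (hK f Sf)).
Qed.
Next Obligation.
move=> a f; have [K hK] := dsum_support f.
rewrite (dsum_out_funE hK) (@dsum_out_funE K); last first.
  by move=> n Kn; rewrite dsum_coord_act hK // act0.
rewrite /dsum_partial; elim: K {hK} => [|K IHK]; first by rewrite !big_ord0 act0.
by rewrite !big_ord_recr IHK act_add; congr (_ + _); apply: hom_act.
Qed.

End Out.

Definition delta (k : nat) (x : M k) (n : nat) : M n :=
  if k =P n is ReflectT e then ecast n (M n) e x else 0.

Lemma delta_eq k (x : M k) : delta x k = x.
Proof. by rewrite /delta; case: eqP => // e; rewrite (eq_irrelevance e erefl). Qed.

Lemma delta_neq k (x : M k) n : k <> n -> delta x n = 0.
Proof. by rewrite /delta; case: eqP. Qed.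

Lemma delta_bounded k n : bounded_linear (fun x : M k => delta x n).
Proof.
rewrite /delta; case: eqP => [e|_]; last exact: bounded_linear_cst0.
by case: _ / e; apply: bounded_linear_id.
Qed.

Lemma delta_act k n a (x : M k) : delta (act a x) n = act a (delta x n).
Proof. by rewrite /delta; case: eqP => [e|_]; [case: _ / e|rewrite act0]. Qed.

Lemma delta_support k (x : M k) : exists K, forall n, (K <= n)%N -> delta x n = 0.
Proof. by exists k.+1 => n kn; apply: delta_neq => e; rewrite e ltnn in kn. Qed.

Program Definition dsum_in (k : nat) : modHom (M k) dsumMod :=
  @ModHom R A (M k) dsumMod (fun x => dsum_mk (delta_support x)) _ _.
Next Obligation.
move=> k; apply: dsum_mk_bounded => [n|S _]; first exact: delta_bounded.
by exists k.+1 => x _ n kn; apply: delta_neq => e; rewrite e ltnn in kn.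
Qed.
Next Obligation. by move=> k a x; apply: dsumP => n; apply: delta_act. Qed.

Lemma dsum_coord_in k (x : M k) n : dsum_coord (dsum_in k x) n = delta x n.
Proof. by []. Qed.

Lemma dsum_out_in N (g : forall n, modHom (M n) N) k (x : M k) :
  dsum_out g (dsum_in k x) = g k x.
Proof.
rewrite -[LHS]/(dsum_out_fun g (dsum_in k x)) (@dsum_out_funE _ _ k.+1); last first.
  by move=> n kn; apply: delta_neq => e; rewrite e ltnn in kn.
rewrite /dsum_partial big_ord_recr dsum_coord_in delta_eq big1 => [|n _]; first exact: add0r.
rewrite dsum_coord_in delta_neq ?hom0 // => e.
by have := ltn_ord n; rewrite [X in (_ < X)%N]e ltnn.
Qed.

Lemma dsum_ind (Q : dsumMod -> Prop) : Q 0 -> (forall f g, Q f -> Q g -> Q (f + g)) ->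
  (forall k x, Q (dsum_in k x)) -> forall f, Q f.
Proof.
move=> Q0 QD Qin f; have [K] := dsum_support f.
elim: K f => [|K IHK] f f0.
  by have -> : f = 0 by apply: dsumP => n; rewrite f0.
rewrite -(subrK (dsum_in K (dsum_coord f K)) f); apply: QD => //.
apply: IHK => n; rewrite -[dsum_coord _ _]/(dsum_coord f n - delta (dsum_coord f K) n).
rewrite leq_eqVlt => /orP[/eqP <-|Kn]; first by rewrite delta_eq subrr.
by rewrite f0 // delta_neq ?subr0 // => e; rewrite e ltnn in Kn.
Qed.

Lemma dsum_coproduct : is_coproduct dsum_in.
Proof.
move=> N g; exists (dsum_out g); split=> [i x|h h_in f]; first exact: dsum_out_in.
move: f; apply: dsum_ind => [|f f' hf hf'|k x].
- by rewrite !hom0.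
- by rewrite !homD hf hf'.
- by rewrite dsum_out_in.
Qed.

End DirectSumMod.

(** Only [ext_in] and [ext_out] respect the action; the splitting is merely bounded linear, like the
    contractions in [exact]. *)
Record split_extension (M' M M'' : bornMod A) := SplitExtension {
  ext_in : modHom M' M;
  ext_out : modHom M M'';
  ext_retr : M -> M';
  ext_sect : M'' -> M;
  ext_retr_bounded : bounded_linear ext_retr;
  ext_sect_bounded : bounded_linear ext_sect;
  ext_inK : forall x, ext_retr (ext_in x) = x;
  ext_sectK : forall x, ext_out (ext_sect x) = x;
  ext_decomp : forall x, ext_in (ext_retr x) + ext_sect (ext_out x) = x
}.

(** By [ext_inK] the decomposition of [ext_in x] leaves [ext_sect (ext_out (ext_in x)) = 0], and
    [ext_out] undoes the section. *)
Lemma ext_out_in M' M M'' (e : split_extension M' M M'') x :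
  ext_out e (ext_in e x) = 0.
Proof.
have /eqP := ext_decomp e (ext_in e x); rewrite ext_inK -subr_eq0 addrAC subrr add0r.
by move=> /eqP/(congr1 (ext_out e)); rewrite ext_sectK hom0.
Qed.

Definition hom_mk (U V : bornSpace R) (f : U -> V) (bf : bounded_linear f) :
  homSpace U V := sub_mk _ bf.

Lemma hom_mkE (U V : bornSpace R) (f : U -> V) (bf : bounded_linear f) :
  hom_val (hom_mk bf) = f.
Proof. by []. Qed.

Lemma homP (U V : bornSpace R) (f g : homSpace U V) : hom_val f =1 hom_val g -> f = g.
Proof. by move=> fg; apply: val_inj; apply: dprodP. Qed.

Lemma eval_bounded (U V : bornSpace R) (x : U) :
  bounded_linear (fun f : homSpace U V => hom_val f x).
Proof.
split=> // S bS; apply: bdd_sub (bS _ (bdd_set1 x)) => _ [f Sf <-].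
by exists (hom_val f); [exists f|exists x].
Qed.

Lemma amul_linear_l (b : A) : linear (fun a : A => amul a b).
Proof. by case: (amul_bounded A). Qed.

Lemma amul_linear_r (a : A) : linear (fun b : A => amul a b).
Proof. by case: (amul_bounded A). Qed.

Lemma amul_bdd (S T : set A) : bdd S -> bdd T -> bdd [set amul a b | a in S & b in T].
Proof. by case: (amul_bounded A) => _ _; apply. Qed.

Lemma amul_bounded_l (b : A) : bounded_linear (fun a : A => amul a b).
Proof.
split; first exact: amul_linear_l.
move=> S bS; apply: bdd_sub (amul_bdd bS (bdd_set1 b)) => _ [x Sx <-].
by exists x => //; exists b.
Qed.

(** * Free modules and free presentations *)

Section Free.
Variable V : bornSpace R.
Let W := tensorSpace A V.
Let t : A -> V -> W := @tensor R A V.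

Lemma tensor_act_bounded (b : A) (v : V) : bounded_linear (fun a : A => t (amul a b) v).
Proof.
have [t1 t2 t3] := tensor_bilinear A V.
apply: (bounded_linear_comp (g := fun a => t a v)) (amul_bounded_l b).
split; first exact: t1.
move=> S bS; apply: bdd_sub (t3 _ _ bS (bdd_set1 v)) => _ [x Sx <-].
by exists x => //; exists v.
Qed.

Let theta0 (b : A) (v : V) : homSpace A W := hom_mk (tensor_act_bounded b v).

(** The action is constructed in curried form, with values in the space of maps from [A]:
    equiboundedness there is joint boundedness of the action. *)
Lemma tensor_act_bilinear : bounded_bilinear theta0.
Proof.
have [t1 t2 t3] := tensor_bilinear A V.
split=> [v c a b|a c v v'|S T bS bT X bX].
- apply: homP => x; rewrite -[RHS]/(c *: t (amul x a) v + t (amul x b) v).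
  by rewrite -[LHS]/(t (amul x (c *: a + b)) v) amul_linear_r; apply: t1.
- by apply: homP => x; apply: t2.
- apply: bdd_sub (t3 _ _ (amul_bdd bX bS) bT).
  move=> _ [_ [_ [a Sa [v Tv <-]] <-] [x Xx <-]].
  by exists (amul x a); [exists x => //; exists a|exists v].
Qed.

Let theta := sval (cid ((tensorP A V).2 _ _ tensor_act_bilinear)).

Let thetaP : bounded_linear theta /\ forall b v, theta (t b v) = theta0 b v.
Proof. by rewrite /theta; case: cid => h /= []. Qed.

Let ext_unique (Z : bornSpace R) (f g : W -> Z) : bounded_linear f ->
  bounded_linear g -> (forall a v, f (t a v) = g (t a v)) -> f =1 g.
Proof.
move=> bf bg fg.
have bb : bounded_bilinear (fun a v => f (t a v)).
  have [t1 t2 t3] := tensor_bilinear A V.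
  split=> [v c a b|a c v v'|S T bS bT]; [|by rewrite (t2 a : linear (t a)) bf.1|].
    by rewrite (t1 v : linear (t^~ v)) bf.1.
  apply: bdd_sub (bf.2 _ (t3 _ _ bS bT)) => _ [a Sa [v Tv <-]].
  by exists (t a v) => //; exists a => //; exists v.
have [h [_ hU]] := (tensorP A V).2 _ _ bb.
have hf : h = f by apply: hU; split.
have hg : h = g by apply: hU; split.
by move=> x; rewrite -hf -hg.
Qed.

Let free_act_bounded a : bounded_linear (fun x => hom_val (theta x) a).
Proof. exact: (bounded_linear_comp (eval_bounded W a) thetaP.1). Qed.

Let thetaE b a v : hom_val (theta (t b v)) a = t (amul a b) v.
Proof. by rewrite thetaP.2. Qed.

Program Definition freeMod : bornMod A :=
  @BornMod R A W (fun a x => hom_val (theta x) a) _ _ _.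
Next Obligation.
split=> [x c a b|a|S T bS bT]; first exact: (hom_valP (theta x)).1.
  exact: (free_act_bounded a).1.
apply: bdd_sub (thetaP.1.2 _ bT _ bS) => _ [a Sa [x Tx <-]].
by exists (hom_val (theta x)); [exists (theta x) => //; exists x|exists a].
Qed.
Next Obligation.
move=> a b; apply: ext_unique => [||c v].
- exact: bounded_linear_comp (free_act_bounded a) (free_act_bounded b).
- exact: free_act_bounded.
- by rewrite !thetaE amulA.
Qed.
Next Obligation.
apply: ext_unique => [||c v]; [exact: free_act_bounded|exact: bounded_linear_id|].
by rewrite thetaE amul1l.
Qed.

Lemma freeMod_free : is_free freeMod.
Proof. by exists V, t; split; [apply: tensorP|move=> a b v; apply: thetaE]. Qed.

Lemma free_lift M (b : A -> V -> M) : bounded_bilinear b ->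
  (forall a c v, act a (b c v) = b (amul a c) v) ->
  exists h : modHom freeMod M, forall a v, h (t a v) = b a v.
Proof.
move=> bb ab; have [h [[bh hE] _]] := (tensorP A V).2 _ _ bb.
suff hA a x : h (act a (x : freeMod)) = act a (h x) by exists (@ModHom _ _ freeMod M h bh hA).
move: x; apply: (ext_unique (f := fun x => h (hom_val (theta x) a))
  (g := fun x => act a (h x))) => [||c v].
- exact: bounded_linear_comp bh (free_act_bounded a).
- exact: (bounded_linear_comp (@act_hom_bounded M a) bh).
- by rewrite thetaE !hE ab.
Qed.

End Free.

(** The action induces a map from the free module on [M], and [tensor (aone A)] is a bounded linear
    section of it, in general not [A]-linear. The data are kept in [Type] because the resolution
    extracts modules from them by iteration. *)
Lemma free_presentation M :
  {K : bornMod A & {P : bornMod A & {e : split_extension K P M | is_free P}}}.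
Proof.
have [mu muE] := cid (free_lift (act_bounded M) (fun a c x => actA a c x)).
pose U := [set x | mu x = 0]; have cU := closed_submodule_kernel mu.
pose s (x : M) : freeMod M := tensor (aone A) x.
have bs : bounded_linear s.
  have [t1 t2 t3] := tensor_bilinear A M; split; first exact: t2.
  move=> S bS; apply: bdd_sub (t3 _ _ (bdd_set1 (aone A)) bS) => _ [x Sx <-].
  by exists (aone A) => //; exists x.
have muK x : mu (s x) = x by rewrite muE act1.
have rU x : U (x - s (mu x)) by rewrite /U /= homB muK subrr.
exists (subMod cU), (freeMod M).
have br : bounded_linear (sub_fun cU rU).
  apply: sub_fun_bounded; apply: bounded_linear_add; first exact: bounded_linear_id.
  by apply: bounded_linear_opp; apply: bounded_linear_comp bs (hom_bounded mu).
suff e : split_extension (subMod cU) (freeMod M) M by exists e; apply: freeMod_free.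
apply: (@SplitExtension _ _ _ (sub_incl cU) mu (sub_fun cU rU) s) => //.
- move=> x; apply: sub_incl_inj; rewrite /= (sub_inclP x : mu _ = 0).
  by rewrite (lin0 bs.1) subr0.
- by move=> x /=; rewrite subrK.
Qed.

(** * Cofree modules and cofree copresentations *)

Section Cofree.
Variable V : bornSpace R.

Lemma cofree_act_bounded (a : A) (f : homSpace A V) :
  bounded_linear (fun x => hom_val f (amul x a)).
Proof. exact: bounded_linear_comp (hom_valP f) (amul_bounded_l a). Qed.

Program Definition cofreeMod : bornMod A :=
  @BornMod R A (homSpace A V) (fun a f => hom_mk (cofree_act_bounded a f)) _ _ _.
Next Obligation.
split=> [f c a b|a c f g|S T bS bT X bX].
- apply: homP => x; rewrite hom_mkE amul_linear_r (hom_valP f).1.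
  by [].
- by apply: homP.
- apply: bdd_sub (bT _ (amul_bdd bX bS)).
  move=> _ [_ [_ [a Sa [f Tf <-]] <-] [x Xx <-]].
  exists (hom_val f); first by exists f.
  by exists (amul x a) => //; exists x => //; exists a.
Qed.
Next Obligation.
by move=> a b f; apply: homP => x; rewrite !hom_mkE amulA.
Qed.
Next Obligation. by move=> f; apply: homP => x; rewrite hom_mkE amul1r. Qed.

Lemma cofreeMod_cofree : is_cofree cofreeMod.
Proof.
exists V, (@hom_val R A V); split=> //.
- by move=> f g fg; apply: homP => x; rewrite fg.
- apply/seteqP; split=> [_ [f _ <-]|f bf]; first exact: hom_valP.
  by exists (hom_mk bf).
Qed.

End Cofree.

Section CofreeQuotient.
Variable M : bornMod A.

Lemma act_bounded_l (x : M) : bounded_linear (fun a : A => act a x).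
Proof.
split; first exact: act_linear_l.
move=> S bS; apply: bdd_sub (act_bdd bS (bdd_set1 x)) => _ [a Sa <-].
by exists a => //; exists x.
Qed.

Program Definition cofree_unit : modHom M (cofreeMod M) :=
  @ModHom R A M (cofreeMod M) (fun x => hom_mk (act_bounded_l x)) _ _.
Next Obligation.
split=> [c x y|S bS X bX]; first by apply: homP => a; apply: act_linear_r.
apply: bdd_sub (act_bdd bX bS) => _ [_ [_ [x Sx <-] <-] [a Xa <-]].
by exists a => //; exists x.
Qed.
Next Obligation. by move=> a x; apply: homP => b; apply: actA. Qed.

Local Notation eta := cofree_unit.
Local Notation H := (cofreeMod M).

Let ev1 (f : H) : M := hom_val f (aone A).

Let ev1_bounded : bounded_linear ev1.
Proof. exact: eval_bounded. Qed.

Let U : set H := [set f | ev1 f = 0].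

Let sU : subspace U.
Proof.
split=> [|c f g f0 g0]; first exact: lin0 ev1_bounded.1.
by rewrite /U /mkset ev1_bounded.1 (f0 : ev1 f = 0) (g0 : ev1 g = 0) scaler0 addr0.
Qed.

Let cU : series_closed U := series_closed_kernel ev1_bounded.

Let qact_fun (a : A) (f : H) : H := act a f - eta (hom_val f a).

Let qact_funE a f x :
  hom_val (qact_fun a f) x = hom_val f (amul x a) - act x (hom_val f a).
Proof. by []. Qed.

Let qact_fun_linear a : linear (qact_fun a).
Proof.
move=> c f g; rewrite /qact_fun act_linear_r.
have -> := (@eval_bounded A M a).1 c f g.
by rewrite (homL eta) scalerBr opprD addrACA.
Qed.

Let qact_closed a f : U (qact_fun a f).
Proof. by rewrite /U /mkset /ev1 qact_funE amul1l act1 subrr. Qed.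

(* The quotient of the cofree module by [M], realised on the complement
   [{f | f 1 = 0}] of [M]: the action is that of [A] followed by the projection
   along [M]. *)
Program Definition cofree_quot : bornMod A :=
  @BornMod R A (subSpace sU cU) (fun a f => sub_mk sU (qact_closed a (sub_val f))) _ _ _.
Next Obligation.
split=> [f c a b|a c f g|S T bS bT].
- apply: val_inj; apply: homP => x.
  rewrite -[RHS]/(c *: hom_val (qact_fun a (sub_val f)) x + hom_val (qact_fun b (sub_val f)) x).
  rewrite -[LHS]/(hom_val (qact_fun (c *: a + b) (sub_val f)) x).
  have lf := (hom_valP (sub_val f)).1.
  rewrite !qact_funE amul_linear_r !lf act_linear_r scalerBr opprD.
  by rewrite addrACA.
- by apply: val_inj; apply: qact_fun_linear.
- have b1 := act_bdd (M := H) bS bT.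
  have b2 : bdd (-%R @` (eta @` [set hom_val (sub_val f) a | f in T & a in S])).
    apply: bdd_opp; apply: (hom_bounded eta).2.
    apply: bdd_sub (bT _ bS) => _ [f Tf [a Sa <-]].
    exists (hom_val (sub_val f)); last by exists a.
    by exists (sub_val f) => //; exists f.
  apply: bdd_sub (bdd_add b1 b2) => _ [_ [a Sa [f Tf <-]] <-].
  exists (act a (sub_val f : H)); first by exists a => //; exists (sub_val f) => //; exists f.
  exists (- eta (hom_val (sub_val f) a)) => //.
  exists (eta (hom_val (sub_val f) a)) => //; exists (hom_val (sub_val f) a) => //.
  by exists f => //; exists a.
Qed.
Next Obligation.
move=> a b f; apply: val_inj; apply: homP => x.
rewrite -[LHS]/(hom_val (qact_fun a (qact_fun b (sub_val f))) x).
rewrite -[RHS]/(hom_val (qact_fun (amul a b) (sub_val f)) x).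
rewrite !qact_funE act_add act_opp actA amulA opprB.
by rewrite addrA subrK.
Qed.
Next Obligation.
move=> f; apply: val_inj; apply: homP => x.
rewrite -[LHS]/(hom_val (qact_fun (aone A) (sub_val f)) x) qact_funE amul1r.
by rewrite [hom_val _ (aone A)](sub_valP f) act0 subr0.
Qed.

Let proj_closed (f : H) : U (f - eta (ev1 f)).
Proof.
rewrite /U /mkset /ev1 -[LHS]/(hom_val f (aone A) - act (aone A) (hom_val f (aone A))).
by rewrite act1 subrr.
Qed.

Program Definition cofree_proj : modHom H cofree_quot :=
  @ModHom R A H cofree_quot (fun f => sub_mk sU (proj_closed f)) _ _.
Next Obligation.
apply: (@bounded_linear_sub_mk _ _ _ sU cU).
apply: bounded_linear_add; first exact: bounded_linear_id.
by apply: bounded_linear_opp; apply: bounded_linear_comp (hom_bounded eta) ev1_bounded.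
Qed.
Next Obligation.
move=> a f; apply: val_inj; apply: homP => x.
rewrite -[LHS]/(hom_val f (amul x a) - act x (hom_val f (amul (aone A) a))).
rewrite -[RHS]/(hom_val f (amul x a) - act (amul x a) (ev1 f) -
  act x (hom_val f a - act a (ev1 f))).
by rewrite amul1l act_add act_opp actA opprB addrA subrK.
Qed.

(** Evaluation at the unit is a linear retraction of [eta], and the inclusion of its kernel is the
    section of the quotient. *)
Definition cofree_extension : split_extension M (cofreeMod M) cofree_quot.
Proof.
apply: (@SplitExtension _ _ _ eta cofree_proj ev1 (@sub_val _ _ _ sU)).
- exact: ev1_bounded.
- exact: bounded_linear_sub_val.
- by move=> x; apply: act1.
- move=> f; apply: val_inj; rewrite -[LHS]/((sub_val f : H) - eta (ev1 (sub_val f))).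
  by rewrite (sub_valP f : ev1 _ = 0) (hom0 eta) subr0.
- by move=> f; rewrite -[ext in _ + ext]/(f - eta (ev1 f)) addrC subrK.
Defined.

End CofreeQuotient.

Lemma cofree_copresentation M :
  {K : bornMod A & {P : bornMod A & {e : split_extension M P K | is_cofree P}}}.
Proof.
exists (cofree_quot M), (cofreeMod M), (cofree_extension M).
exact: cofreeMod_cofree.
Qed.

End Modules.

(** * Complexes and triangles *)

Section ChainComplexes.
Context {R : realType} {A : bornAlg R}.
Implicit Types X Y Z : chainComplex A.

Lemma prod_eta (M N : bornMod A) (p : prodMod M N) : p = (p.1, p.2).
Proof. by case: p. Qed.

(** * Degreewise split short exact sequences *)

Section ShortExact.
Variables (X' X X'' : chainComplex A) (i : chainMap X' X) (p : chainMap X X'').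
Variables (r : forall n, X n -> X' n) (s : forall n, X'' n -> X n).
Hypotheses (br : forall n, bounded_linear (@r n))
  (bs : forall n, bounded_linear (@s n)) (ri : forall n x, r (i n x) = x)
  (ps : forall n x, p n (s x) = x)
  (dec : forall n x, i n (r x) + s (p n x) = x).

Let pi n x : p n (i n x) = 0.
Proof.
have /eqP := dec (i n x); rewrite ri -subr_eq0 addrAC subrr add0r.
by move=> /eqP/(congr1 (p n)); rewrite ps hom0.
Qed.

Let rD n (x y : X n) : r (x + y) = r x + r y := linD (br n).1 x y.
Let rN n (x : X n) : r (- x) = - r x := linN (br n).1 x.
Let r0 n : r (0 : X n) = 0 := lin0 (br n).1.
Let sD n (x y : X'' n) : s (x + y) = s x + s y := linD (bs n).1 x y.

Program Definition cone_quot : chainMap (cone i) X'' :=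
  @ChainMap R A (cone i) X'' (fun n =>
    @ModHom R A (cone i n) (X'' n) (fun y => p n y.1) _ _) _.
Next Obligation.
move=> n; exact: bounded_linear_comp (hom_bounded _) (bounded_linear_fst _ _).
Qed.
Next Obligation. by move=> n a y; rewrite /= hom_act. Qed.
Next Obligation. by move=> n y; rewrite /= homD pi addr0 chain_comm. Qed.

(* The failure of the degreewise splittings to be chain maps; it corrects the
   obvious contracting homotopy of the cone. *)
Let theta n (x : X'' n) : X' (n - 1) := r (cpx_d X n (s x)).

Let ds n (x : X'' n) : cpx_d X n (s x) = i (n - 1) (theta x) + s (cpx_d X'' n x).
Proof. by rewrite -[LHS]dec chain_comm ps. Qed.

Let rd n (x : X n) : r (cpx_d X n x) = cpx_d X' n (r x) + theta (p n x).
Proof.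
by rewrite -{1}(dec x) homD -chain_comm rD ri.
Qed.

Let dtheta n (x : X'' n) : cpx_d X' (n - 1) (theta x) + theta (cpx_d X'' n x) = 0.
Proof.
have := rd (cpx_d X n (s x)); rewrite cpx_dd r0 => ->.
by rewrite chain_comm ps.
Qed.

Let h n (y : cone cone_quot (n - 1)) : cone cone_quot n :=
  (0, (s y.1, - r y.2.1 - theta y.1)).

(** Replaces the quotient by the cone of the inclusion, so that a degreewise split sequence yields a
    triangle even though its splittings are not chain maps. *)
Lemma quasi_iso_cone_quot : quasi_iso cone_quot.
Proof.
exists h.
  move=> n; apply: bounded_linear_pair; first exact: bounded_linear_cst0.
  have b1 := bounded_linear_fst (X'' (n - 1)) (cone i (n - 1 - 1)).
  have b2 := bounded_linear_snd (X'' (n - 1)) (cone i (n - 1 - 1)).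
  have b3 := bounded_linear_fst (X (n - 1 - 1)) (X' (n - 1 - 1 - 1)).
  apply: bounded_linear_pair; first exact: bounded_linear_comp (bs _) b1.
  apply: bounded_linear_add; apply: bounded_linear_opp.
    exact: bounded_linear_comp (br _) (bounded_linear_comp b3 b2).
  apply: bounded_linear_comp (br _) _.
  exact: bounded_linear_comp (hom_bounded _) (bounded_linear_comp (bs _) b1).
move=> n [x'' [x x']].
set z := - r x - theta x''.
rewrite -[cpx_d (cone cone_quot) n _]/((cpx_d X'' n 0 + p (n - 1) (s x''),
  (- (cpx_d X (n - 1) (s x'') + i (n - 1 - 1) z), - - cpx_d X' (n - 1 - 1) z))
  : cone cone_quot (n - 1)).
rewrite -[cpx_d (cone cone_quot) (n - 1) _]/((cpx_d X'' (n - 1) x'' + p (n - 1 - 1) x,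
  (- (cpx_d X (n - 1 - 1) x + i (n - 1 - 1 - 1) x'), - - cpx_d X' (n - 1 - 1 - 1) x'))
  : cone cone_quot (n - 1 - 1)).
rewrite /h /=.
(* The three coordinates reduce to [ps], to [ds] together with [dec], and to [rd] together with
   [dtheta]. *)
congr (_, (_, _)) => /=.
- by rewrite hom0 add0r addr0 ps.
- have zm (V : zmodType) (a b c e : V) : c + e = - (a + b - (c + a)) + (b + e).
    by rewrite [a + b]addrC [c + a]addrC addrKA opprB addrA subrK.
  by rewrite sD ds /z homD !homN -opprD -[LHS](dec x); apply: zm.
- have zm (V : zmodType) (a b c t y : V) : b + t = 0 ->
      y = - a - b + (a + c + y - (t + c)).
    move=> /eqP; rewrite addr_eq0 => /eqP ->; rewrite opprK.
    by rewrite [a + c + y]addrAC [t + c]addrC addrKA addrACA addKr subrr addr0.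
  have thD m (a b : X'' m) : theta (a + b) = theta a + theta b.
    by rewrite /theta sD homD rD.
  rewrite opprK rN opprK rD ri rd /z homD !homN thD; apply: zm.
  exact: dtheta.
Qed.

End ShortExact.
(** The map sending [(y, x)] to [(0, g y)] contracts the cone; [g] commutes with the differentials
    because it inverts a chain map. *)
Lemma quasi_iso_bijective X Y (f : chainMap X Y) (g : forall n, Y n -> X n) :
  (forall n, bounded_linear (g n)) -> (forall n x, g n (f n x) = x) ->
  (forall n y, f n (g n y) = y) -> quasi_iso f.
Proof.
move=> bg gf fg.
exists (fun n (y : cone f (n - 1)) => (0, g (n - 1) y.1) : cone f n).
  move=> n; apply: bounded_linear_pair; first exact: bounded_linear_cst0.
  exact: bounded_linear_comp (bg _) (bounded_linear_fst _ _).
move=> n [y x] /=; have gd m z : g (m - 1) (cpx_d Y m z) = cpx_d X m (g m z).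
  by rewrite -{1}(fg m z) -chain_comm gf.
congr (_, _); first by rewrite /= hom0 add0r fg addr0.
by rewrite /= (linD (bg _).1) gd gf addrA addNr add0r.
Qed.

(** * Brutal truncation, desuspension, and complexes in a single degree *)

Definition null_mod (M : bornMod A) : Prop := forall x : M, x = 0.

Lemma zeroMod_null : null_mod (zeroMod A).
Proof. by move=> x; apply/rowP; case. Qed.

Lemma null_modE (M : bornMod A) : null_mod M -> forall x y : M, x = y.
Proof. by move=> M0 x y; rewrite (M0 x) (M0 y). Qed.

Definition window (b : bool) (M : bornMod A) : bornMod A :=
  if b then M else zeroMod A.

Definition window_in b M : modHom (window b M) M :=
  if b as b return modHom (window b M) M then idHom M else zeroHom _ _.

Definition window_out b M : modHom M (window b M) :=
  if b as b return modHom M (window b M) then idHom M else zeroHom _ _.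

Lemma window_inK b M x : window_out b M (window_in b M x) = x.
Proof. by case: b x => //= x; apply: (null_modE zeroMod_null). Qed.

Lemma window_outK b M x : window_in b M (window_out b M x) = if b then x else 0.
Proof. by case: b. Qed.

Lemma window_null b M : ~~ b -> null_mod (window b M).
Proof. by case: b => // _; apply: zeroMod_null. Qed.

Lemma window_null_mod b M : null_mod M -> null_mod (window b M).
Proof. by case: b => // _; apply: zeroMod_null. Qed.

(** Consecutive differentials compose as in [X] or pass through a zero module, so any set of degrees
    gives a complex. It is a subcomplex if [b] is closed under lowering the degree and a quotient if
    [b] is closed under raising it. *)
Program Definition brutal X (b : int -> bool) : chainComplex A :=
  @Defs.Complex R A (fun n => window (b n) (X n)) (fun n =>
    compHom (window_out (b (n - 1)) _) (compHom (cpx_d X n) (window_in (b n) _))) _.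
Next Obligation.
move=> X b n x; rewrite /= window_outK.
by case: ifP => _; rewrite ?cpx_dd ?hom0.
Qed.

Program Definition brutal_in X (b : int -> bool)
    (hb : forall n, b n -> b (n - 1)) : chainMap (brutal X b) X :=
  @ChainMap R A (brutal X b) X (fun n => window_in (b n) (X n)) _.
Next Obligation.
move=> X b hb n; rewrite /= /brutal /=; case E : (b n) => x.
  by rewrite window_outK hb.
by rewrite /= window_outK !hom0; case: ifP.
Qed.

Program Definition brutal_out X (b : int -> bool)
    (hb : forall n, b (n - 1) -> b n) : chainMap X (brutal X b) :=
  @ChainMap R A X (brutal X b) (fun n => window_out (b n) (X n)) _.
Next Obligation.
move=> X b hb n x; rewrite /= window_outK; case E : (b n) => //.
by apply: (null_modE (window_null _)); apply: contraFN E => /hb.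
Qed.

(** Degrees such as [n - 1 + 1] and [n] are equal but not convertible. Equality proofs between
    integers are unique, so all transports between two given degrees agree. *)
Definition cast_ob X (m n : int) (e : m = n) : modHom (X m) (X n) :=
  match e with erefl => idHom (X m) end.

Lemma cast_ob_d X (m n : int) (e : m = n) (e' : m - 1 = n - 1) x :
  cpx_d X n (cast_ob X e x) = cast_ob X e' (cpx_d X m x).
Proof. by case: n / e e' => e'; rewrite (eq_irrelevance e' erefl). Qed.

Lemma cast_ob_comp X (m n k : int) (e : m = n) (e' : n = k) (e'' : m = k) (x : X m) :
  cast_ob X e' (cast_ob X e x) = cast_ob X e'' x.
Proof. by case: k / e' e''; case: n / e => e; rewrite (eq_irrelevance e erefl). Qed.

Fact unshift_index (n : int) : n + 1 - 1 = n - 1 + 1.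
Proof. by rewrite addrAC. Qed.

(** Presents every complex as a suspension up to isomorphism, which lets [tri_shift] raise the
    degree in which a complex is concentrated. The sign compensates for the one in [shift]. *)
Program Definition unshift X : chainComplex A :=
  @Defs.Complex R A (fun n => X (n + 1))
    (fun n => oppHom (compHom (cast_ob X (unshift_index n)) (cpx_d X (n + 1)))) _.
Next Obligation.
move=> X n x; rewrite /= !homN opprK.
rewrite (cast_ob_d _ (congr1 (fun m => m - 1) (unshift_index n))).
by rewrite cpx_dd !hom0.
Qed.

Fact shift_unshift_index (n : int) : n - 1 + 1 = n.
Proof. by rewrite subrK. Qed.

Program Definition shift_unshift X : chainMap (shift (unshift X)) X :=
  @ChainMap R A (shift (unshift X)) X (fun n => cast_ob X (shift_unshift_index n)) _.
Next Obligation.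
move=> X n x; rewrite /= opprK.
rewrite (cast_ob_d _ (congr1 (fun m => m - 1) (shift_unshift_index n))).
exact: cast_ob_comp.
Qed.

Lemma quasi_iso_shift_unshift X : quasi_iso (shift_unshift X).
Proof.
apply: (@quasi_iso_bijective _ _ (shift_unshift X)
  (fun n (x : X n) => cast_ob X (esym (shift_unshift_index n)) x)).
- by move=> n; apply: hom_bounded.
- by move=> n x; rewrite /= (cast_ob_comp _ _ erefl).
- by move=> n x; rewrite /= (cast_ob_comp _ _ erefl).
Qed.

Definition degree0_in X n : modHom (degree0_ob (X 0) n) (X n) :=
  match n as n return modHom (degree0_ob (X 0) n) (X n) with
  | Posz 0 => idHom (X 0) | _ => zeroHom _ _ end.

Definition degree0_out X n : modHom (X n) (degree0_ob (X 0) n) :=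
  match n as n return modHom (X n) (degree0_ob (X 0) n) with
  | Posz 0 => idHom (X 0) | _ => zeroHom _ _ end.

Lemma quasi_iso_degree0 X : (forall n, n != 0 -> null_mod (X n)) ->
  exists f : chainMap (in_degree0 (X 0)) X, quasi_iso f.
Proof.
move=> X0.
have comm n x : degree0_in X (n - 1) (cpx_d (in_degree0 (X 0)) n x) =
    cpx_d X n (degree0_in X n x).
  rewrite hom0; have [n0|n0] := eqVneq n 0.
    by subst n; apply: (null_modE (X0 _ _)).
  by rewrite [degree0_in _ _ _]X0 // hom0.
pose f : chainMap (in_degree0 (X 0)) X := ChainMap comm.
exists f; apply: (@quasi_iso_bijective _ _ f (fun n (x : X n) => degree0_out X n x)).
- by move=> n; apply: hom_bounded.
- by move=> [[|n]|n] x //=; apply: (null_modE zeroMod_null).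
- by move=> [[|n]|n] x //=; apply: (null_modE (X0 _ _)).
Qed.

(** * Closure properties of a triangulated subcategory *)

Section Triangulated.
Variable T : chainComplex A -> Prop.
Hypothesis tT : triangulated_subcategory T.

Lemma der_iso_id X : der_iso (Der_map (idMap X)).
Proof. by exists (Der_map (idMap X)); split; apply: Der_idl. Qed.

Lemma tri_quasi_iso X Y (f : chainMap X Y) : quasi_iso f -> (T X <-> T Y).
Proof.
move=> qf; split.
  apply: (tri_iso tT (f := Der_map f)).
  by exists (Der_inv qf); split; [apply: Der_invl|apply: Der_invr].
apply: (tri_iso tT (f := Der_inv qf)).
by exists (Der_map f); split; [apply: Der_invr|apply: Der_invl].
Qed.

Lemma tri_cone X Y (f : chainMap X Y) :
  [/\ T X -> T Y -> T (cone f), T Y -> T (cone f) -> T X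
    & T X -> T (cone f) -> T Y].
Proof.
apply: (tri_triangle tT (u := Der_map f) (v := Der_map (cone_in f))
  (w := Der_map (cone_out f))).
exists X, Y, f, (Der_map (idMap X)), (Der_map (idMap Y)), (Der_map (idMap (cone f))).
split.
- by split; apply: der_iso_id.
- exact: Der_trans (Der_idl _) (Der_sym (Der_idr _)).
- exact: Der_trans (Der_idl _) (Der_sym (Der_idr _)).
- apply: Der_trans (Der_sym (Der_idr _)).
  apply: Der_trans (Der_idl _); apply: Der_congr (Der_refl _).
  (* The suspended identity and the identity of the suspension have the same components, so the zero
     homotopy relates them. *)
  apply: Der_homotopic; exists (fun n => zeroHom _ _) => n x /=.
by rewrite subrr hom0 oppr0 addr0.
Qed.

Lemma tri_short_exact X' X X'' (i : chainMap X' X) (p : chainMap X X'')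
    (r : forall n, X n -> X' n) (s : forall n, X'' n -> X n) :
  (forall n, bounded_linear (r n)) -> (forall n, bounded_linear (s n)) ->
  (forall n x, r n (i n x) = x) -> (forall n x, p n (s n x) = x) ->
  (forall n x, i n (r n x) + s n (p n x) = x) ->
  [/\ T X' -> T X -> T X'', T X -> T X'' -> T X' & T X' -> T X'' -> T X].
Proof.
move=> br bs ri ps dec; have [h1 h2 h3] := tri_cone i.
have q := tri_quasi_iso (quasi_iso_cone_quot br bs ri ps dec).
by split=> t1 t2; [apply/q; apply: h1|apply: h2 => //; apply/q|apply: h3 => //; apply/q].
Qed.

Lemma tri_brutal X (b : int -> bool) : (forall n, b n -> b (n - 1)) ->
  [/\ T (brutal X b) -> T X -> T (brutal X (fun n => ~~ b n)),
      T X -> T (brutal X (fun n => ~~ b n)) -> T (brutal X b)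
    & T (brutal X b) -> T (brutal X (fun n => ~~ b n)) -> T X].
Proof.
move=> hb.
have hb' n : ~~ b (n - 1) -> ~~ b n by apply: contra; apply: hb.
apply: (@tri_short_exact _ _ _ (brutal_in X hb) (brutal_out X hb')
  (fun n => window_out (b n) (X n)) (fun n => window_in (~~ b n) (X n))).
- by move=> n; apply: hom_bounded.
- by move=> n; apply: hom_bounded.
- by move=> n x; apply: window_inK.
- by move=> n x; apply: window_inK.
- by move=> n x; rewrite /= !window_outK; case: (b n); rewrite ?addr0 ?add0r.
Qed.

Hypothesis T0 : forall X, (forall n, null_mod (X n)) -> T X.

(** The cone of the map from a zero complex is [X] up to null summands, so this map is invertible in
    the derived category. *)
Lemma tri_exact X : exact X -> T X.
Proof.
move=> [h bh hE].
have Z0 n : null_mod (in_degree0 (zeroMod A) n).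
  by case: n => [[|n]|n]; apply: zeroMod_null.
have comm n x : zeroHom (in_degree0 (zeroMod A) (n - 1)) (X (n - 1))
    (cpx_d (in_degree0 (zeroMod A)) n x) = cpx_d X n (zeroHom _ (X n) x).
  by rewrite /= hom0.
apply/(@tri_quasi_iso _ _ (ChainMap comm)); last exact: T0.
exists (fun n (y : cone (ChainMap comm) (n - 1)) => (h n y.1, 0) : cone (ChainMap comm) n).
  move=> n; apply: bounded_linear_pair; last exact: bounded_linear_cst0.
  exact: bounded_linear_comp (bh _) (bounded_linear_fst _ _).
move=> n [x z]; congr (_, _); last exact: (null_modE (Z0 _)).
by rewrite /= !addr0.
Qed.

Lemma tri_degree0 X : (forall n, n != 0 -> null_mod (X n)) ->
  (T (in_degree0 (X 0)) <-> T X).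
Proof. by move=> /quasi_iso_degree0[f]; apply: tri_quasi_iso. Qed.

Lemma tri_degree0_null M : null_mod M -> T (in_degree0 M).
Proof. by move=> M0; apply: T0 => -[[|n]|n] //=; apply: zeroMod_null. Qed.

Lemma tri_degree0_window b M : T (in_degree0 M) -> T (in_degree0 (window b M)).
Proof. by case: b => // _; apply: tri_degree0_null; apply: zeroMod_null. Qed.

Let concentrated (a : int) : Prop := forall X,
  (forall n, n != a -> null_mod (X n)) -> T (in_degree0 (X a)) -> T X.

(** Induction on the degree in both directions: upwards through [unshift] and [tri_shift], downwards
    through [tri_unshift]. *)
Lemma tri_concentrated a : concentrated a.
Proof.
have up m : concentrated m -> concentrated (m + 1).
  move=> cm X X0 TX; apply/(tri_quasi_iso (quasi_iso_shift_unshift X)).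
  apply: (tri_shift tT); apply: cm => // n nm; apply: X0.
  by apply: contra nm => /eqP/addIr ->.
have down m : concentrated m -> concentrated (m - 1).
  move=> cm X X0 TX; apply: (tri_unshift tT); apply: cm => // n nm; apply: X0.
  by apply: contra nm => /eqP/addIr ->.
elim/int_ind: a => [X X0|n IHn|n IHn]; first by move/(tri_degree0 X0).
  by rewrite -addn1 PoszD; apply: up.
by rewrite -addn1 PoszD opprD; apply: down.
Qed.

(** Induction on the length: the top degree splits off as a quotient. *)
Lemma tri_bounded (k : nat) (a : int) X :
  (forall n, ~~ (a <= n < a + k%:Z) -> null_mod (X n)) ->
  (forall n, T (in_degree0 (X n))) -> T X.
Proof.
elim: k X => [|k IHk] X X0 TX.
  by apply: T0 => n; apply: X0; lia.
have hb n : n < a + k%:Z -> n - 1 < a + k%:Z by lia.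
have [_ _ TT] := tri_brutal X hb; apply: TT.
  apply: IHk => n; last exact: tri_degree0_window.
  move=> hn; have [nk|nk] := boolP (n < a + k%:Z); last exact: (window_null nk).
  by apply: window_null_mod; apply: X0; lia.
apply: (@tri_concentrated (a + k%:Z)); last exact: tri_degree0_window.
move=> n nk; have [nk'|nk'] := boolP (n < a + k%:Z); first by apply: window_null; rewrite negbK.
by apply: window_null_mod; apply: X0; lia.
Qed.

End Triangulated.
End ChainComplexes.

(** * Homotopy colimits and limits *)

Section DirectSumComplex.
Context {R : realType} {A : bornAlg R}.

Lemma dsum_coordD (M : nat -> bornMod A) (f g : dsumMod M) k :
  dsum_coord (f + g) k = dsum_coord f k + dsum_coord g k.
Proof. by []. Qed.

Lemma dsum_mkE (M : nat -> bornMod A) (f : forall n, M n) hf k :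
  dsum_coord (@dsum_mk _ _ _ f hf) k = f k.
Proof. by []. Qed.

Lemma dsum_bdd_support (M : nat -> bornMod A) (S : set (dsumMod M)) : bdd S ->
  exists K, forall y, S y -> forall k, (K <= k)%N -> dsum_coord y k = 0.
Proof. by case=> -[K hK] _; exists K. Qed.

Section Map.
Variables (M N : nat -> bornMod A) (f : forall k, modHom (M k) (N k)).

Fact dsum_map_support (y : dsumMod M) :
  exists K, forall k, (K <= k)%N -> f k (dsum_coord y k) = 0.
Proof. by have [K hK] := dsum_support y; exists K => k /hK ->; rewrite hom0. Qed.

Program Definition dsum_map : modHom (dsumMod M) (dsumMod N) :=
  @ModHom R A (dsumMod M) (dsumMod N) (fun y => dsum_mk (dsum_map_support y)) _ _.
Next Obligation.
apply: dsum_mk_bounded => [k|S /dsum_bdd_support[K hK]].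
  exact: (bounded_linear_comp (hom_bounded (f k)) (@dsum_coord_bounded _ _ M k)).
by exists K => y Sy k Kk; rewrite hK // hom0.
Qed.
Next Obligation. by move=> a y; apply: dsumP => k; apply: hom_act. Qed.

Lemma dsum_map_in k x : dsum_map (dsum_in _ k x) = dsum_in _ k (f k x).
Proof.
apply: dsumP => n; rewrite dsum_mkE !dsum_coord_in.
have [<-|kn] := eqVneq k n; first by rewrite !delta_eq.
by rewrite !delta_neq ?hom0 //; apply/eqP.
Qed.

End Map.

Variable Xk : nat -> chainComplex A.

Program Definition dsumComplex : chainComplex A :=
  @Defs.Complex R A (fun n => dsumMod (fun k => Xk k n))
    (fun n => dsum_map (fun k => cpx_d (Xk k) n)) _.
Next Obligation. by move=> n y; apply: dsumP => k; rewrite !dsum_mkE cpx_dd. Qed.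

Program Definition dsumComplex_in k : chainMap (Xk k) dsumComplex :=
  @ChainMap R A (Xk k) dsumComplex (fun n => dsum_in _ k) _.
Next Obligation. by move=> k n x; rewrite [RHS]dsum_map_in. Qed.

Lemma dsumComplex_sum : is_direct_sum Xk dsumComplex.
Proof. by exists dsumComplex_in => n; apply: dsum_coproduct. Qed.

End DirectSumComplex.

(** * The Milnor sequence of a telescope *)

Section HomotopyColimit.
Context {R : realType} {A : bornAlg R}.
Variables (X : chainComplex A) (Xk : nat -> chainComplex A).
Variables (iota : forall k, chainMap (Xk k) X).
Variables (sigma : forall k n, modHom (X n) (Xk k n)) (N : int -> nat).
Hypotheses (iota_inj : forall k n, injective (iota k n))
  (sigmaK : forall j k n x, (j < k)%N ->
     iota k n (sigma k n (iota j n x)) = iota j n x)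
  (iotaK : forall k n x, (N n <= k)%N -> iota k n (sigma k n x) = x).

Let S := dsumComplex Xk.

Let shift_fun n (y : S n) (k : nat) : Xk k n :=
  if k is k'.+1 then dsum_coord y k'.+1 - sigma k'.+1 n (iota k' n (dsum_coord y k'))
  else dsum_coord y 0.

Fact telescope_support n (y : S n) :
  exists K, forall k, (K <= k)%N -> shift_fun y k = 0.
Proof.
have [K hK] := dsum_support y; exists K.+1 => -[|k] //= Kk.
by rewrite !hK ?hom0 ?subr0 // leqW.
Qed.

(** Identity minus shift. The transition maps are [sigma k.+1 \o iota k]; they are chain maps by
    injectivity of [iota], although [sigma] itself is not assumed to be one. [sigmaK] is restricted
    to [j < k] because a truncation may end in a kernel that is no retract of the term of [X]. *)
Program Definition telescope : chainMap S S :=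
  @ChainMap R A S S (fun n =>
    @ModHom R A (S n) (S n) (fun y => dsum_mk (telescope_support y)) _ _) _.
Next Obligation.
move=> n; apply: dsum_mk_bounded => [[|k]|B /dsum_bdd_support[K hK]].
- exact: dsum_coord_bounded.
- apply: bounded_linear_add; first exact: dsum_coord_bounded.
  apply: bounded_linear_opp.
  apply: (bounded_linear_comp (hom_bounded (sigma k.+1 n))).
  apply: (bounded_linear_comp (hom_bounded (iota k n))).
  exact: dsum_coord_bounded.
- exists K.+1 => y By [|k] //= Kk.
  by rewrite !(hK y By) ?hom0 ?subr0 // leqW.
Qed.
Next Obligation.
move=> n a y; apply: dsumP => -[|k]; first by [].
by rewrite dsum_coord_act !dsum_mkE /shift_fun !dsum_coord_act !hom_act act_add act_opp.
Qed.
Next Obligation.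
move=> n y; apply: dsumP => -[|k]; first by [].
rewrite -[LHS]/(cpx_d (Xk k.+1) n (dsum_coord y k.+1) -
  sigma k.+1 (n - 1) (iota k (n - 1) (cpx_d (Xk k) n (dsum_coord y k)))).
rewrite -[RHS]/(cpx_d (Xk k.+1) n (dsum_coord y k.+1 -
  sigma k.+1 n (iota k n (dsum_coord y k)))).
rewrite homB; congr (_ - _); apply: iota_inj.
by rewrite sigmaK // !chain_comm sigmaK.
Qed.

Let p n : modHom (S n) (X n) := dsum_out (fun k => iota k n).

Program Definition colim_out : chainMap S X := @ChainMap R A S X p _.
Next Obligation.
move=> n y; move: y; apply: dsum_ind => [|y z yE zE|k x]; first by rewrite !hom0.
  by rewrite !homD yE zE.
by rewrite [cpx_d S n _]dsum_map_in /p !dsum_out_in chain_comm.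
Qed.

Let a n (k : nat) (y : S n) : X n := dsum_partial (fun k => iota k n) k y.

Let aS n k (y : S n) : a k.+1 y = a k y + iota k n (dsum_coord y k).
Proof. by rewrite /a /dsum_partial big_ord_recr. Qed.

Let a0 n (y : S n) : a 0 y = 0.
Proof. by rewrite /a /dsum_partial big_ord0. Qed.

Let pE n k (y : S n) : (forall j, (k <= j)%N -> dsum_coord y j = 0) -> p n y = a k y.
Proof. exact: dsum_out_funE. Qed.

Let sigma_a n k (y : S n) : iota k n (sigma k n (a k y)) = a k y.
Proof.
have : forall j, (j <= k)%N -> iota k n (sigma k n (a j y)) = a j y.
  elim=> [_|j IHj jk]; first by rewrite a0 !hom0.
  by rewrite aS !homD sigmaK // IHj // ltnW.
exact.
Qed.

(** The formal inverse of identity minus shift forms partial sums, whose support is infinite in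
    general. Subtracting the total [p n y] from stage [N n] on makes the coordinates vanish
    eventually. The coordinate [k] itself stays outside [sigma] because [sigma k] need not undo
    [iota k]. *)
Let retr_fun n (y : S n) (k : nat) : Xk k n :=
  dsum_coord y k + sigma k n (a k y - (if (N n <= k)%N then p n y else 0)).

Fact colim_retr_support n (y : S n) :
  exists K, forall k, (K <= k)%N -> retr_fun y k = 0.
Proof.
have [K hK] := dsum_support y; exists (maxn (N n) K) => k; rewrite geq_max.
move=> /andP[Nk Kk]; rewrite /retr_fun Nk hK // add0r (@pE n k) ?subrr ?hom0 //.
by move=> j kj; rewrite hK // (leq_trans Kk).
Qed.

Let retr n (y : S n) : S n := dsum_mk (colim_retr_support y).

Let retr_bounded n : bounded_linear (@retr n).
Proof.
apply: dsum_mk_bounded => [k|B /dsum_bdd_support[K hK]].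
  apply: bounded_linear_add; first exact: dsum_coord_bounded.
  apply: (bounded_linear_comp (hom_bounded (sigma k n))).
  apply: bounded_linear_add; first exact: dsum_partial_bounded.
  apply: bounded_linear_opp; case: (N n <= k)%N; first exact: hom_bounded.
  exact: bounded_linear_cst0.
exists (maxn (N n) K) => y By k; rewrite geq_max.
move=> /andP[Nk Kk]; rewrite /retr_fun Nk hK // add0r (@pE n k) ?subrr ?hom0 //.
by move=> j kj; rewrite hK // (leq_trans Kk).
Qed.

Let sect n (x : X n) : S n := dsum_in _ (N n) (sigma (N n) n x).

Let telescopeE n (y : S n) k : dsum_coord (telescope n y) k = shift_fun y k.
Proof. by []. Qed.

Let a_telescope n (y : S n) k : a k.+1 (telescope n y) = iota k n (dsum_coord y k).
Proof.
elim: k => [|k IHk]; first by rewrite aS a0 add0r.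
by rewrite aS IHk telescopeE /= homB sigmaK // addrC subrK.
Qed.

Let p_telescope n (y : S n) : p n (telescope n y) = 0.
Proof.
have [K hK] := telescope_support y; have [L hL] := dsum_support y.
rewrite (@pE n (maxn K L).+1) => [|j Kj].
  by rewrite a_telescope hL ?hom0 // leq_maxr.
by rewrite telescopeE hK // (leq_trans _ Kj) // leqW // leq_maxl.
Qed.

Lemma tri_hocolim (T : chainComplex A -> Prop) : triangulated_subcategory T ->
  closed_under_direct_sums T -> (forall k, T (Xk k)) -> T X.
Proof.
move=> tT sT TX; have TS : T S by apply: sT (dsumComplex_sum Xk) TX.
suff [h _ _] : [/\ T S -> T S -> T X, T S -> T X -> T S & T S -> T X -> T S].
  exact: h.
apply: (@tri_short_exact _ _ _ tT _ _ _ telescope colim_out retr sect) => //.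
- move=> n; exact: bounded_linear_comp (hom_bounded _) (hom_bounded _).
- move=> n y; apply: dsumP => k; rewrite dsum_mkE /retr_fun p_telescope.
  rewrite if_same subr0 telescopeE; case: k => [|k] /=; first by rewrite a0 hom0 addr0.
  by rewrite a_telescope subrK.
- by move=> n x; rewrite [LHS]dsum_out_in iotaK.
- move=> n y; apply: dsumP => k; rewrite dsum_coordD telescopeE.
  rewrite -[colim_out n y]/(p n y) dsum_coord_in.
  case: k => [|k].
    rewrite -[shift_fun _ _]/(retr_fun y 0) /retr_fun a0 sub0r.
    have [N0|N0] := posnP (N n).
      by rewrite N0 leqnn homN delta_eq subrK.
    rewrite leqn0 gtn_eqF // oppr0 hom0 addr0 delta_neq ?addr0 //.
    by move=> e; rewrite e in N0.
  rewrite -[shift_fun _ _]/(retr_fun y k.+1 - sigma k.+1 n (iota k n (retr_fun y k))).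
  have -> : iota k n (retr_fun y k) = a k.+1 y - (if (N n <= k)%N then p n y else 0).
    rewrite /retr_fun homD aS [a k y + iota k n _]addrC -addrA; congr (_ + _).
    by case: ifP => Nk; [rewrite iotaK|rewrite subr0 sigma_a].
  rewrite /retr_fun -[_ + _ - sigma _ _ _]addrA -homB -addrA; set c := if _ then _ else _.
  set e := if _ then _ else _.
  have -> : a k.+1 y - c - (a k.+1 y - e) = e - c.
    by rewrite opprB addrC addrA subrK.
  rewrite -[RHS]addr0; congr (_ + _); rewrite /c /e.
  (* The correction by the total sum sets in at stage [N n], so [e - c] is nonzero at most for
     [k.+1 = N n], where the section supplies the missing term. *)
  have [->|Nk] := eqVneq (N n) k.+1.
    by rewrite leqnn ltnn sub0r homN delta_eq addNr.
  rewrite delta_neq; last by apply/eqP.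
  by rewrite [(N n <= k.+1)%N]leq_eqVlt (negPf Nk) /= ltnS subrr hom0 addr0.
Qed.

End HomotopyColimit.

(** * The dual Milnor sequence, for products *)

Section HomotopyLimit.
Context {R : realType} {A : bornAlg R}.
Variables (X : chainComplex A) (Xk : nat -> chainComplex A).
Variables (pi : forall k, chainMap X (Xk k)).
Variables (rho : forall k n, modHom (Xk k n) (X n)) (N : int -> nat).
Hypotheses (rhoK : forall j k n x, (j < k)%N ->
     pi j n (rho k n (pi k n x)) = pi j n x)
  (rho_d : forall k n x, pi k (n - 1) (rho k.+1 (n - 1) (cpx_d (Xk k.+1) n x)) =
     pi k (n - 1) (cpx_d X n (rho k.+1 n x)))
  (piK : forall k n x, (N n <= k)%N -> rho k n (pi k n x) = x).

Program Definition dprodComplex : chainComplex A :=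
  @Defs.Complex R A (fun n => dprodMod (fun k => Xk k n))
    (fun n => dprod_pair (fun k => compHom (cpx_d (Xk k) n) (dprod_proj _ k))) _.
Next Obligation. by move=> n y; apply: dprodP => k; apply: cpx_dd. Qed.

Local Notation P := dprodComplex.

Program Definition dprodComplex_out k : chainMap P (Xk k) :=
  @ChainMap R A P (Xk k) (fun n => dprod_proj _ k) _.
Next Obligation. by []. Qed.

Lemma dprodComplex_product : is_direct_product Xk P.
Proof. by exists dprodComplex_out => n; apply: dprod_product. Qed.

Program Definition lim_in : chainMap X P :=
  @ChainMap R A X P (fun n => dprod_pair (fun k => pi k n)) _.
Next Obligation. by move=> n x; apply: dprodP => k; apply: chain_comm. Qed.

Let coord n (y : P n) k : Xk k n := (y : dprod _) k.

(** The transition maps are [pi k \o rho k.+1]. That they are chain maps is the assumption [rho_d]: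
    the argument by injectivity of the colimit case has no counterpart, since [pi k] need not be
    onto. *)
Program Definition cotelescope : chainMap P P :=
  @ChainMap R A P P (fun n => dprod_pair (fun k =>
    addHom (dprod_proj _ k)
      (oppHom (compHom (compHom (pi k n) (rho k.+1 n)) (dprod_proj _ k.+1))))) _.
Next Obligation.
move=> n y; apply: dprodP => k.
rewrite -[LHS]/(cpx_d _ n (coord y k) -
  pi k (n - 1) (rho k.+1 (n - 1) (cpx_d _ n (coord y k.+1)))).
rewrite -[RHS]/(cpx_d _ n (coord y k - pi k n (rho k.+1 n (coord y k.+1)))).
by rewrite homB rho_d chain_comm.
Qed.

Let cotelescopeE n (y : P n) k :
  coord (cotelescope n y) k = coord y k - pi k n (rho k.+1 n (coord y k.+1)).
Proof. by []. Qed.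

Let retr n (y : P n) : X n := rho (N n) n (coord y (N n)).

Let b n (z : P n) (k : nat) : X n := \sum_(j < k) rho j n (coord z j).

Let bS n (z : P n) k : b z k.+1 = b z k + rho k n (coord z k).
Proof. by rewrite /b big_ord_recr. Qed.

(** Solving [y k - pi k (rho k.+1 (y k.+1)) = z k] formally adds the images of all later [z j], an
    infinite sum. It is cut off at [N n] and continued beyond with the opposite sign; by [rhoK] this
    still solves the equations, and the cut makes [retr (sect z)] vanish. *)
Let sect n (z : P n) : P n :=
  (fun k => coord z k + pi k n (b z (N n) - b z k.+1)) : dprod (fun k => Xk k n).

Let b_bounded n k : bounded_linear (fun z : P n => b z k).
Proof.
elim: k => [|k IHk].
  rewrite (_ : (fun z => b z 0) = fun=> 0); first exact: bounded_linear_cst0.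
  by apply: funext => z; rewrite /b big_ord0.
rewrite (_ : (fun z => b z k.+1) = fun z => b z k + rho k n (coord z k)).
  apply: bounded_linear_add => //.
  exact: (bounded_linear_comp (hom_bounded (rho k n)) (hom_bounded (dprod_proj _ k))).
by apply: funext => z.
Qed.

Let sect_bounded n : bounded_linear (@sect n).
Proof.
apply: bounded_linear_dprod => k; apply: bounded_linear_add.
  exact: (hom_bounded (dprod_proj _ k)).
apply: (bounded_linear_comp (hom_bounded (pi k n))).
by apply: bounded_linear_add; [|apply: bounded_linear_opp]; apply: b_bounded.
Qed.

Let sectE n (z : P n) k : coord (sect z) k = coord z k + pi k n (b z (N n) - b z k.+1).
Proof. by []. Qed.

(* Below [N n] only the images under [pi k] telescope, above it the terms themselves. *)
Let pi_b n k (y : P n) : pi k n (b (cotelescope n y) (N n) - b (cotelescope n y) k.+1) =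
  pi k n (rho k.+1 n (coord y k.+1) - rho (N n) n (coord y (N n))).
Proof.
set z := cotelescope n y.
have [kN|Nk] := leqP k.+1 (N n).
  have : forall m, (k < m)%N -> pi k n (b z m - b z k.+1) =
      pi k n (rho k.+1 n (coord y k.+1) - rho m n (coord y m)).
    elim=> // m IHm; rewrite ltnS leq_eqVlt => /orP[/eqP <-|km].
      by rewrite !subrr.
    rewrite [b z m.+1]bS addrAC [LHS]homD.
    rewrite IHm // cotelescopeE !homB rhoK //.
    by rewrite addrA subrK.
  exact.
have : forall m, (N n <= m)%N -> b z (N n) - b z m =
    rho m n (coord y m) - rho (N n) n (coord y (N n)).
  elim=> [|m IHm]; first by rewrite leqn0 => /eqP ->; rewrite !subrr.
  rewrite leq_eqVlt => /orP[/eqP <-|Nm]; first by rewrite !subrr.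
  rewrite [b z m.+1]bS opprD addrA IHm // cotelescopeE homB piK // opprB.
  by rewrite addrC addrA subrK.
by move=> /(_ k.+1) -> //; apply: ltnW.
Qed.

Lemma tri_holim (T : chainComplex A -> Prop) : triangulated_subcategory T ->
  closed_under_direct_products T -> (forall k, T (Xk k)) -> T X.
Proof.
move=> tT pT TX; have TP : T P by apply: pT dprodComplex_product TX.
suff [_ h _] : [/\ T X -> T P -> T P, T P -> T P -> T X & T X -> T P -> T P].
  exact: h.
apply: (@tri_short_exact _ _ _ tT _ _ _ lim_in cotelescope retr sect) => //.
- by move=> n; apply: (bounded_linear_comp (hom_bounded (rho _ n))
    (hom_bounded (dprod_proj _ (N n)))).
- by move=> n x; apply: piK.
- move=> n z; apply: dprodP => k.
  rewrite -[LHS]/(coord (cotelescope n (sect z)) k) cotelescopeE !sectE.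
  rewrite (homD (rho k.+1 n)) [pi k n (rho _ _ _ + _)]homD rhoK //.
  rewrite -(homD (pi k n) (rho _ _ _)) [b z k.+2]bS.
  by rewrite [rho _ _ _ + _]addrC opprD addrA subrK addrK.
- move=> n y; apply: dprodP => k.
  rewrite -[LHS]/(pi k n (rho (N n) n (coord y (N n))) +
    coord (sect (cotelescope n y)) k) sectE pi_b cotelescopeE homB.
  by rewrite addrC [_ - _ + (_ - _)]addrA !subrK.
Qed.

End HomotopyLimit.

(** * Truncations *)

Section Truncations.
Context {R : realType} {A : bornAlg R}.
Implicit Types X : chainComplex A.

Program Definition subComplex X (U : forall n, set (X n))
    (cU : forall n, closed_submodule (U n))
    (dU : forall n x, U n x -> U (n - 1) (cpx_d X n x)) : chainComplex A :=
  @Defs.Complex R A (fun n => subMod (cU n)) (fun n =>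
    @sub_lift _ _ _ _ (cU (n - 1)) _ (compHom (cpx_d X n) (sub_incl (cU n)))
      (fun x => dU n _ (sub_inclP x))) _.
Next Obligation.
by move=> X U cU dU n x; apply: sub_incl_inj; apply: cpx_dd.
Qed.

Definition pick_hom (b : bool) (M : bornMod A) : modHom M M :=
  if b then idHom M else zeroHom M M.

Lemma pick_homE b M x : pick_hom b M x = if b then x else 0.
Proof. by case: b. Qed.

(** * From modules to all complexes by direct sums *)

Section Colimits.
Variable T : chainComplex A -> Prop.
Hypotheses (tT : triangulated_subcategory T) (sT : closed_under_direct_sums T).
Hypothesis T0 : forall X, (forall n, null_mod (X n)) -> T X.

(** The truncations to degrees at most [k] are bounded subcomplexes, and degree [n] is complete from
    [k = absz n] on. *)
Lemma tri_bounded_below a X : (forall n, n < a -> null_mod (X n)) ->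
  (forall n, T (in_degree0 (X n))) -> T X.
Proof.
move=> X0 TX.
have hb (k : nat) n : n <= k%:Z -> n - 1 <= k%:Z by lia.
pose Xk (k : nat) := brutal X (fun n => n <= k%:Z).
pose iota k : chainMap (Xk k) X := brutal_in X (hb k).
pose sigma k n : modHom (X n) (Xk k n) := window_out (n <= k%:Z) (X n).
apply: (@tri_hocolim _ _ X Xk iota sigma absz) => //.
- by move=> k n; apply: can_inj (@window_inK _ _ _ _).
- move=> j k n x jk; rewrite /= window_outK; case: ifP => // /negbT nk.
  have nj : ~~ (n <= j%:Z) by lia.
  by rewrite [x](null_modE (window_null nj) x 0) hom0.
- by move=> k n x nk; rewrite /= window_outK; case: ifP => // /negbT; lia.
(* The number of degrees from [a] to [k]. For [k + 1 < a] the absolute value is not such a number,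
   which is harmless because then all terms are null. *)
move=> k; pose m := absz (k%:Z + 1 - a)%R.
apply: (tri_bounded tT T0 (k := m) (a := a)) => n; last exact: tri_degree0_window.
move=> hn; have [na|na] := ltP n a; first by apply: window_null_mod; apply: X0.
by apply: window_null; lia.
Qed.

(** Brutal truncation to degrees at least [- k] is a quotient and cannot form an increasing union.
    Keeping only the cycles in the lowest degree gives a subcomplex. *)
Let trunc X (k : nat) n : set (X n) :=
  [set x | n < - k%:Z -> x = 0] `&` [set x | n = - k%:Z -> cpx_d X n x = 0].

Let trunc_closed X k n : closed_submodule (@trunc X k n).
Proof.
apply: closed_submoduleI; apply: closed_submodule_imply.
  exact: (closed_submodule_kernel (idHom (X n))).
exact: (closed_submodule_kernel (cpx_d X n)).
Qed.

Let trunc_d X k n (x : X n) : trunc k x -> trunc k (cpx_d X n x).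
Proof.
move=> [x0 dx0]; split=> /= nk; last exact: cpx_dd.
have [nk'|nk'] := eqVneq n (- k%:Z); first exact: dx0.
by rewrite x0 ?hom0 //=; lia.
Qed.

Lemma tri_all_sum : (forall M, T (in_degree0 M)) -> forall X, T X.
Proof.
move=> TM X; pose Xk (k : nat) := subComplex (trunc_closed X k) (@trunc_d X k).
pose iota (k : nat) : chainMap (Xk k) X :=
  @ChainMap _ _ (Xk k) X (fun n => sub_incl (trunc_closed X k n)) (fun _ _ => erefl).
(* In degree [- k] the cycles need not be a direct summand of [X n], so [sigma] is zero there. Hence
   degree [n] is stable only from [(absz n).+1] on. *)
have sP (k : nat) n x : trunc k (pick_hom (- k%:Z < n) (X n) x).
  rewrite pick_homE; case: ifP => nk; split=> //= nk'; try by lia.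
  exact: hom0.
pose sigma k n : modHom (X n) (Xk k n) :=
  sub_lift (trunc_closed X k n) (sP k n).
have sE k n x : iota k n (sigma k n x) = if - k%:Z < n then x else 0.
  by rewrite -pick_homE.
apply: (@tri_hocolim _ _ X Xk iota sigma (fun n => (absz n).+1)) => //.
- by move=> k n; apply: sub_incl_inj.
- move=> j k n x jk; rewrite sE; case: ifP => // /negbT nk.
  by have [x0 _] := sub_inclP x; rewrite [iota j n x]x0 //=; lia.
- by move=> k n x nk; rewrite sE; case: ifP => // /negbT; lia.
move=> k; apply: (@tri_bounded_below (- k%:Z)) => n //.
move=> nk x; apply: sub_incl_inj; have [x0 _] := sub_inclP x.
by rewrite hom0; apply: x0.
Qed.

End Colimits.

(** * From modules to all complexes by direct products *)

Section Limits.
Variable T : chainComplex A -> Prop.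
Hypotheses (tT : triangulated_subcategory T) (pT : closed_under_direct_products T).
Hypothesis T0 : forall X, (forall n, null_mod (X n)) -> T X.

Lemma tri_bounded_above a X : (forall n, a < n -> null_mod (X n)) ->
  (forall n, T (in_degree0 (X n))) -> T X.
Proof.
move=> X0 TX.
have hb (k : nat) n : - k%:Z <= n - 1 -> - k%:Z <= n by lia.
pose Xk (k : nat) := brutal X (fun n => - k%:Z <= n).
pose pi k : chainMap X (Xk k) := brutal_out X (hb k).
pose rho k n : modHom (Xk k n) (X n) := window_in (- k%:Z <= n) (X n).
apply: (@tri_holim _ _ X Xk pi rho absz) => //.
- move=> j k n x jk; rewrite /= window_outK; case: ifP => // /negbT nk.
  by apply: (null_modE (window_null _)); lia.
- move=> k n x; rewrite [X in pi k _ X]window_outK; case: ifP => // /negbT nk.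
  by apply: (null_modE (window_null _)); lia.
- by move=> k n x nk; rewrite /= window_outK; case: ifP => // /negbT; lia.
move=> k; pose m := absz (a + k%:Z + 1)%R.
apply: (tri_bounded tT T0 (k := m) (a := - k%:Z)) => n; last exact: tri_degree0_window.
move=> hn; have [na|na] := ltP a n; first by apply: window_null_mod; apply: X0.
by apply: window_null; lia.
Qed.

(* The degree [k + 1] part of the truncation is the kernel of [d] in degree [k],
   which avoids a quotient; it is realised inside the cone of the identity. *)
Let cotrunc X (k : nat) n : set (cone (idMap X) n) :=
  ([set u | n <= k%:Z -> u.2 = 0] `&` [set u | k%:Z < n -> u.1 = 0]) `&`
  ([set u | n = k%:Z + 1 -> cpx_d X (n - 1) u.2 = 0] `&`
   [set u | k%:Z + 1 < n -> u.2 = 0]).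

Program Definition fst_hom (M N : bornMod A) : modHom (prodMod M N) M :=
  @ModHom R A (prodMod M N) M fst (bounded_linear_fst _ _) _.
Next Obligation. by []. Qed.

Program Definition snd_hom (M N : bornMod A) : modHom (prodMod M N) N :=
  @ModHom R A (prodMod M N) N snd (bounded_linear_snd _ _) _.
Next Obligation. by []. Qed.

Program Definition pair_hom (L M N : bornMod A) (f : modHom L M) (g : modHom L N) :
    modHom L (prodMod M N) :=
  @ModHom R A L (prodMod M N) (fun x => (f x, g x)) _ _.
Next Obligation. by move=> *; apply: bounded_linear_pair; apply: hom_bounded. Qed.
Next Obligation. by move=> *; rewrite /= !hom_act. Qed.

Let cotrunc_closed X k n : closed_submodule (@cotrunc X k n).
Proof.
apply: closed_submoduleI; apply: closed_submoduleI; apply: closed_submodule_imply.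
- exact: (closed_submodule_kernel (snd_hom _ _)).
- exact: (closed_submodule_kernel (fst_hom _ _)).
- exact: (closed_submodule_kernel (compHom (cpx_d X (n - 1)) (snd_hom _ _))).
- exact: (closed_submodule_kernel (snd_hom _ _)).
Qed.

Let cotrunc_d X k n (u : cone (idMap X) n) :
  cotrunc k u -> cotrunc k (cpx_d (cone (idMap X)) n u).
Proof.
case: u => x y [[/= y0 x0] [/= dy0 y0']].
have dy : k%:Z + 1 <> n -> y = 0.
  by move=> nk; have [nk'|nk'] := leP n k%:Z; [apply: y0|apply: y0'; lia].
have dy' : cpx_d X (n - 1) y = 0.
  by have [nk|/eqP nk] := eqVneq (k%:Z + 1) n; [apply: dy0|rewrite dy ?hom0].
split; split=> /= nk; rewrite ?dy' ?oppr0 ?hom0 //.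
by rewrite x0 ?dy ?hom0 ?addr0 //; lia.
Qed.

Lemma tri_all_product : (forall M, T (in_degree0 M)) -> forall X, T X.
Proof.
move=> TM X; pose C := cone (idMap X).
pose Xk (k : nat) := subComplex (@cotrunc_closed X k) (@cotrunc_d X k).
(* In degree [k + 1] the projection is the differential of [X], whose values are cycles; it kills
   all higher degrees. *)
pose pi0 (k : nat) n : modHom (X n) (C n) :=
  pair_hom (pick_hom (n <= k%:Z) (X n))
    (compHom (pick_hom (n == k%:Z + 1) (X (n - 1))) (cpx_d X n)).
have pi0E k n x : pi0 k n x = (if n <= k%:Z then x else 0,
    if n == k%:Z + 1 then cpx_d X n x else 0) by rewrite /= !pick_homE.
have piP (k : nat) n x : cotrunc k (pi0 k n x).
  rewrite pi0E; split; split=> /= nk.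
  - by case: eqP => //; lia.
  - by case: ifP => //; lia.
  - by case: ifP; rewrite ?cpx_dd ?hom0.
  - by case: eqP => //; lia.
pose pi1 (k : nat) n : modHom (X n) (Xk k n) :=
  sub_lift (cotrunc_closed X k n) (piP k n).
have comm (k : nat) n x : pi1 k (n - 1) (cpx_d X n x) = cpx_d (Xk k) n (pi1 k n x).
  apply: sub_incl_inj; rewrite -[LHS]/(pi0 k (n - 1) (cpx_d X n x)).
  rewrite -[RHS]/(cpx_d C n (pi0 k n x)) !pi0E /= cpx_dd if_same.
  congr (_, _); last first.
    by case: ifP; rewrite ?cpx_dd ?hom0 oppr0.
  have [nk|nk] := eqVneq n (k%:Z + 1).
    have -> : n - 1 <= k%:Z by lia.
    have -> : (n <= k%:Z) = false by lia.
    by rewrite hom0 add0r.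
  have -> : (n - 1 <= k%:Z) = (n <= k%:Z) by lia.
  by case: ifP; rewrite ?hom0 addr0.
pose pi (k : nat) : chainMap X (Xk k) := ChainMap (comm k).
pose rho (k : nat) n : modHom (Xk k n) (X n) :=
  compHom (fst_hom _ _) (sub_incl (cotrunc_closed X k n)).
have rpE (k : nat) n x : rho k n (pi k n x) = if n <= k%:Z then x else 0.
  by rewrite -[LHS]/(pi0 k n x).1 pi0E.
have piE (k : nat) n x : sub_incl (cotrunc_closed X k n) (pi k n x) = pi0 k n x by [].
apply: (@tri_holim _ _ X Xk pi rho absz) => //.
- move=> j k n x jk; rewrite rpE; case: ifP => // /negbT nk.
  apply: sub_incl_inj; rewrite !piE !pi0E.
  have -> : (n <= j%:Z) = false by lia.
  by have -> : (n == j%:Z + 1) = false by lia.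
- move=> k n u; pose v := sub_incl (cotrunc_closed X k.+1 n) u.
  rewrite -[rho k.+1 (n - 1) _]/(cpx_d X n v.1 + v.2) homD.
  (* The map [rho] fails to be a chain map by [v.2], which is zero unless [n = k.+1 + 1]. In that
     case it is a cycle of degree [k + 1], where [pi k] applies the differential. *)
  suff -> : pi k (n - 1) v.2 = 0 by rewrite addr0.
  apply: sub_incl_inj.
  have [[y0 _] [dy0 y0']] : cotrunc k.+1 v := sub_inclP u.
  rewrite piE pi0E hom0; have [nk|nk] := eqVneq n (k.+1%:Z + 1).
    have -> : (n - 1 <= k%:Z) = false by lia.
    by rewrite [cpx_d X (n - 1) v.2]dy0 // if_same.
  have -> : v.2 = 0.
    by have [nk'|nk'] := leP n k.+1%:Z; [apply: y0|apply: y0' => /=; lia].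
  by rewrite hom0 !if_same.
- by move=> k n x nk; rewrite rpE; case: ifP => // /negbT; lia.
move=> k; apply: (@tri_bounded_above (k%:Z + 1)) => n //.
move=> nk u; apply: sub_incl_inj; have [[_ x0] [_ y0]] := sub_inclP u.
by rewrite hom0 [LHS]prod_eta [X in (X, _)]x0 ?[X in (_, X)]y0 //=; lia.
Qed.

End Limits.
End Truncations.

(** * Resolutions *)

Section Ladder.
Context {R : realType} {A : bornAlg R}.
Variable C : nat -> bornMod A.

Definition ladder_ob (a : int) : bornMod A := if a is Posz n then C n else zeroMod A.

(* Maps between neighbouring objects, extended by zero to all pairs of degrees:
   this makes sense of them in degrees [n - 1] and [n] without transport. *)
Definition ladder_up (f : forall n, C n -> C n.+1) (a b : int) :
    ladder_ob a -> ladder_ob b :=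
  match a, b return ladder_ob a -> ladder_ob b with
  | Posz n, Posz m => fun x =>
      if n.+1 =P m is ReflectT e then ecast m (C m) e (f n x) else 0
  | _, _ => fun=> 0
  end.

Definition ladder_down (g : forall n, C n.+1 -> C n) (a b : int) :
    ladder_ob a -> ladder_ob b :=
  match a, b return ladder_ob a -> ladder_ob b with
  | Posz n, Posz m => fun x =>
      if n =P m.+1 is ReflectT e then g m (ecast n (C n) e x) else 0
  | _, _ => fun=> 0
  end.

Lemma ladder_upE f n x : ladder_up f (a := Posz n) (Posz n.+1) x = f n x.
Proof. by rewrite /=; case: eqP => // e; rewrite (eq_irrelevance e erefl). Qed.

Lemma ladder_downE g n x : ladder_down g (a := Posz n.+1) (Posz n) x = g n x.
Proof. by rewrite /=; case: eqP => // e; rewrite (eq_irrelevance e erefl). Qed.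

Section Bounded.
Variables (f : forall n, C n -> C n.+1) (g : forall n, C n.+1 -> C n).
Hypotheses (bf : forall n, bounded_linear (@f n)) (bg : forall n, bounded_linear (@g n)).

Lemma ladder_up_bounded a b : bounded_linear (ladder_up f (a := a) b).
Proof.
case: a b => [n|n] [m|m]; try exact: bounded_linear_cst0.
rewrite /=; case: eqP => [e|_]; last exact: bounded_linear_cst0.
by case: m / e; apply: bf.
Qed.

Lemma ladder_down_bounded a b : bounded_linear (ladder_down g (a := a) b).
Proof.
case: a b => [n|n] [m|m]; try exact: bounded_linear_cst0.
rewrite /=; case: eqP => [e|_]; last exact: bounded_linear_cst0.
by subst n; apply: bg.
Qed.

Hypotheses (gf0 : forall x, g (f x) = x :> C 0)
  (fg : forall n (x : C n.+1), f (g x) + g (f x) = x).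

(** The neighbours [b] and [c] are tied to [a] by equations, so that the gradings by [n] and by
    [- n] can both use the result. *)
Lemma ladder_contraction a b c (x : ladder_ob a) : b = a + 1 -> c = a - 1 ->
  x = ladder_down g a (ladder_up f b x) + ladder_up f a (ladder_down g c x).
Proof.
move=> -> ->; case: a x => [[|n]|n] x; last exact: (null_modE (@zeroMod_null _ _)).
- have -> : Posz 0 + 1 = Posz 1 by [].
  by rewrite ladder_upE ladder_downE gf0 addr0.
- have -> : Posz n.+1 + 1 = Posz n.+2 by lia.
  have -> : Posz n.+1 - 1 = Posz n by lia.
  by rewrite ladder_upE !ladder_downE ladder_upE addrC fg.
Qed.

End Bounded.

Lemma ladder_up_up (f : forall n, C n -> C n.+1) a b c (x : ladder_ob a) :
  (forall n, f n 0 = 0) -> (forall n (x : C n), f n.+1 (f n x) = 0) ->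
  b = a + 1 -> c = b + 1 -> ladder_up f c (ladder_up f b x) = 0.
Proof.
move=> f0 ff -> ->; case: a x => [n|[|n]] x; last by [].
  have -> : Posz n + 1 = Posz n.+1 by lia.
  have -> : Posz n.+1 + 1 = Posz n.+2 by lia.
  by rewrite !ladder_upE ff.
have -> : Negz 0 + 1 = Posz 0 by [].
have -> : Posz 0 + 1 = Posz 1 by [].
by rewrite ladder_upE; apply: f0.
Qed.

Lemma ladder_down_down (g : forall n, C n.+1 -> C n) a b c (x : ladder_ob a) :
  (forall n (x : C n.+2), g n (g n.+1 x) = 0) ->
  b = a - 1 -> c = b - 1 -> ladder_down g c (ladder_down g b x) = 0.
Proof.
move=> gg -> ->; case: a x => [[|[|n]]|n] x //.
have -> : Posz n.+2 - 1 = Posz n.+1 by lia.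
have -> : Posz n.+1 - 1 = Posz n by lia.
by rewrite !ladder_downE gg.
Qed.

Section Down.
Variables (f : forall n, C n -> C n.+1) (g : forall n, modHom (C n.+1) (C n)).
Hypotheses (bf : forall n, bounded_linear (@f n))
  (gg : forall n x, g n (g n.+1 x) = 0)
  (gf0 : forall x, g 0 (f x) = x)
  (fg : forall n (x : C n.+1), f (g n x) + g n.+1 (f x) = x).

Program Definition down_hom a b : modHom (ladder_ob a) (ladder_ob b) :=
  @ModHom R A (ladder_ob a) (ladder_ob b) (ladder_down g (a := a) b) _ _.
Next Obligation. by move=> a b; apply: ladder_down_bounded => n; apply: hom_bounded. Qed.
Next Obligation.
move=> [n|n] [m|m] c x; rewrite /= ?act0 //.
by case: eqP => [e|_]; rewrite ?act0 //; subst n; apply: hom_act.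
Qed.

Program Definition down_complex : chainComplex A :=
  @Defs.Complex R A ladder_ob (fun n => down_hom n (n - 1)) _.
Next Obligation. by move=> n x; apply: ladder_down_down. Qed.

Lemma down_complex_exact : exact down_complex.
Proof.
exists (fun n => ladder_up f (a := n - 1) n) => [n|n x]; first exact: ladder_up_bounded.
by apply: (@ladder_contraction f g); rewrite ?subrK.
Qed.

End Down.

Section Up.
Variables (f : forall n, modHom (C n) (C n.+1)) (g : forall n, C n.+1 -> C n).
Hypotheses (bg : forall n, bounded_linear (@g n))
  (ff : forall n x, f n.+1 (f n x) = 0)
  (gf0 : forall x, g (f 0 x) = x)
  (fg : forall n (x : C n.+1), f n (g x) + g (f n.+1 x) = x).

Program Definition up_hom a b : modHom (ladder_ob a) (ladder_ob b) :=
  @ModHom R A (ladder_ob a) (ladder_ob b) (ladder_up f (a := a) b) _ _.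
Next Obligation. by move=> a b; apply: ladder_up_bounded => n; apply: hom_bounded. Qed.
Next Obligation.
move=> [n|n] [m|m] c x; rewrite /= ?act0 //.
by case: eqP => [e|_]; rewrite ?act0 //; subst m; apply: hom_act.
Qed.

Program Definition up_complex : chainComplex A :=
  @Defs.Complex R A (fun n => ladder_ob (- n)) (fun n => up_hom (- n) (- (n - 1))) _.
Next Obligation.
by move=> n x; apply: ladder_up_up => [m|m y||]; rewrite ?hom0 ?ff //; lia.
Qed.

Lemma up_complex_exact : exact up_complex.
Proof.
exists (fun n => ladder_down g (a := - (n - 1)) (- n)) => [n|n x].
  exact: ladder_down_bounded.
by rewrite [RHS]addrC; apply: (@ladder_contraction f g) => //; lia.
Qed.

End Up.
End Ladder.

(** * Generation of all modules by free and by cofree ones *)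

Section Generation.
Context {R : realType} {A : bornAlg R}.
Implicit Types (M : bornMod A) (X : chainComplex A).

Section Resolution.
Variable M : bornMod A.

Fixpoint syzygy (n : nat) : bornMod A :=
  if n is n'.+1 then projT1 (free_presentation (syzygy n')) else M.

Definition free_cover n : bornMod A := projT1 (projT2 (free_presentation (syzygy n))).

Definition free_ext n : split_extension (syzygy n.+1) (free_cover n) (syzygy n) :=
  sval (projT2 (projT2 (free_presentation (syzygy n)))).

Lemma free_coverP n : is_free (free_cover n).
Proof. exact: svalP (projT2 (projT2 (free_presentation (syzygy n)))). Qed.

(** The augmented resolution: [M] is in degree 0 and the free modules start in degree 1. The whole
    complex is then exact, with [M] as a brutal truncation. *)
Definition free_ladder n : bornMod A := if n is n'.+1 then free_cover n' else M.

(** The contraction of a complex spliced from linearly split extensions: retract onto the syzygy,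
    then apply the section of its cover. *)
Definition free_up n : free_ladder n -> free_ladder n.+1 :=
  match n return free_ladder n -> free_ladder n.+1 with
  | 0 => ext_sect (free_ext 0)
  | n'.+1 => fun x => ext_sect (free_ext n'.+1) (ext_retr (free_ext n') x)
  end.

Definition free_down n : modHom (free_ladder n.+1) (free_ladder n) :=
  match n return modHom (free_ladder n.+1) (free_ladder n) with
  | 0 => ext_out (free_ext 0)
  | n'.+1 => compHom (ext_in (free_ext n')) (ext_out (free_ext n'.+1))
  end.

Lemma free_down_down n x : free_down n (free_down n.+1 x) = 0.
Proof. by case: n x => [|n] x /=; rewrite ext_out_in ?hom0. Qed.

Definition free_resolution : chainComplex A := down_complex free_down_down.

Lemma free_resolution_exact : exact free_resolution.
Proof.
apply: (@down_complex_exact _ _ _ free_up) => [n|x|n x].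
- case: n => [|n] /=; first exact: ext_sect_bounded.
  exact: bounded_linear_comp (ext_sect_bounded _) (ext_retr_bounded _).
- exact: ext_sectK.
- case: n x => [|n] x /=; first by rewrite ext_sectK addrC ext_decomp.
  by rewrite ext_inK ext_sectK addrC ext_decomp.
Qed.

Fixpoint cosyzygy (n : nat) : bornMod A :=
  if n is n'.+1 then projT1 (cofree_copresentation (cosyzygy n')) else M.

Definition cofree_hull n : bornMod A :=
  projT1 (projT2 (cofree_copresentation (cosyzygy n))).

Definition cofree_ext n : split_extension (cosyzygy n) (cofree_hull n) (cosyzygy n.+1) :=
  sval (projT2 (projT2 (cofree_copresentation (cosyzygy n)))).

Lemma cofree_hullP n : is_cofree (cofree_hull n).
Proof. exact: svalP (projT2 (projT2 (cofree_copresentation (cosyzygy n)))). Qed.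

Definition cofree_ladder n : bornMod A := if n is n'.+1 then cofree_hull n' else M.

Definition cofree_up n : modHom (cofree_ladder n) (cofree_ladder n.+1) :=
  match n return modHom (cofree_ladder n) (cofree_ladder n.+1) with
  | 0 => ext_in (cofree_ext 0)
  | n'.+1 => compHom (ext_in (cofree_ext n'.+1)) (ext_out (cofree_ext n'))
  end.

Definition cofree_down n : cofree_ladder n.+1 -> cofree_ladder n :=
  match n return cofree_ladder n.+1 -> cofree_ladder n with
  | 0 => ext_retr (cofree_ext 0)
  | n'.+1 => fun x => ext_sect (cofree_ext n') (ext_retr (cofree_ext n'.+1) x)
  end.

Lemma cofree_up_up n x : cofree_up n.+1 (cofree_up n x) = 0.
Proof. by case: n x => [|n] x /=; rewrite ext_out_in hom0. Qed.

Definition cofree_resolution : chainComplex A := up_complex cofree_up_up.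

Lemma cofree_resolution_exact : exact cofree_resolution.
Proof.
apply: (@up_complex_exact _ _ _ cofree_up cofree_down) => [n|x|n x].
- case: n => [|n] /=; first exact: ext_retr_bounded.
  exact: bounded_linear_comp (ext_sect_bounded _) (ext_retr_bounded _).
- exact: ext_inK.
- case: n x => [|n] x /=; first by rewrite ext_inK ext_decomp.
  by rewrite ext_sectK ext_inK ext_decomp.
Qed.

End Resolution.

Section Generated.
Variable T : chainComplex A -> Prop.
Hypothesis tT : triangulated_subcategory T.

(** A zero complex is an empty direct sum. The axioms of a triangulated subcategory by themselves
    provide no object, so the zero complexes come from the closure under sums. *)
Lemma tri_null_sum : closed_under_direct_sums T ->
  forall X, (forall n, null_mod (X n)) -> T X.
Proof.
move=> sT X X0; apply: (sT void (fun i : void => match i with end)) => //.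
exists (fun i : void => match i with end) => n N g.
exists (zeroHom _ _); split=> [[]|h _ x]; by rewrite (X0 n x) !hom0.
Qed.

Lemma tri_null_product : closed_under_direct_products T ->
  forall X, (forall n, null_mod (X n)) -> T X.
Proof.
move=> pT X X0; apply: (pT void (fun i : void => match i with end)) => //.
exists (fun i : void => match i with end) => n N g.
by exists (zeroHom _ _); split=> [[]|h _ x]; apply: X0.
Qed.

(** In the truncation triangle of the augmented resolution, the middle term is exact and the part in
    degrees at least 1 is a bounded below complex of free modules; the third term is [M]. *)
Lemma tri_module_free : closed_under_direct_sums T ->
  (forall F : bornMod A, is_free F -> T (in_degree0 F)) -> forall M, T (in_degree0 M).
Proof.
move=> sT TF M; have T0 := tri_null_sum sT; pose X := free_resolution M.
have hb (n : int) : n <= 0 -> n - 1 <= 0 by lia.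
have [_ h _] := tri_brutal tT X hb.
apply/(tri_degree0 tT (X := brutal X (fun n => n <= 0))).
  move=> n n0; have [n1|n1] := boolP (n <= 0); last exact: (window_null n1).
  by apply: window_null_mod; case: n n0 n1 => [[|n]|n] // _ _; apply: zeroMod_null.
apply: h; first exact: tri_exact (free_resolution_exact M).
apply: (tri_bounded_below tT sT T0 (a := 1)) => [n n1|n].
  by apply: window_null; lia.
case: n => [[|n]|n]; try by apply: (tri_degree0_null T0); apply: window_null.
by apply: TF; apply: free_coverP.
Qed.

(** The cofree modules occupy the negative degrees, so here they form the subcomplex and [M] is the
    quotient. *)
Lemma tri_module_cofree : closed_under_direct_products T ->
  (forall F : bornMod A, is_cofree F -> T (in_degree0 F)) -> forall M, T (in_degree0 M).
Proof.
move=> pT TF M; have T0 := tri_null_product pT; pose X := cofree_resolution M.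
have hb (n : int) : n < 0 -> n - 1 < 0 by lia.
have [h _ _] := tri_brutal tT X hb.
apply/(tri_degree0 tT (X := brutal X (fun n => ~~ (n < 0)))).
  move=> n n0; have [n1|n1] := boolP (n < 0); first by apply: window_null; rewrite negbK.
  by apply: window_null_mod; case: n n0 n1 => [[|n]|n] // _ _; apply: zeroMod_null.
apply: h; last exact: tri_exact (cofree_resolution_exact M).
apply: (tri_bounded_above tT pT T0 (a := -1)) => [n n1|n].
  by apply: window_null; lia.
case: n => [[|n]|n]; try by apply: (tri_degree0_null T0); apply: window_null.
by apply: TF; apply: cofree_hullP.
Qed.

End Generated.
End Generation.

Theorem proposition10 (R : realType) (A : bornAlg R)
    (T : chainComplex A -> Prop) :
  triangulated_subcategory T ->
  ((forall F : bornMod A, is_free F -> T (in_degree0 F)) /\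
    closed_under_direct_sums T) \/
  ((forall F : bornMod A, is_cofree F -> T (in_degree0 F)) /\
    closed_under_direct_products T) ->
  forall X : chainComplex A, T X.
Proof.
move=> tT [[TF sT]|[TF pT]].
  exact: tri_all_sum tT sT (tri_null_sum sT) (tri_module_free tT sT TF).
exact: tri_all_product tT pT (tri_null_product pT) (tri_module_cofree tT pT TF).
Qed.
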